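(* Let $n\ge2$ and let $\mathcal F$ be a family of curve perturbations ($P$-family) in $\mathbb R^n$. Then for every open set $U\subset\mathbb R^n$ and all pairs of non-empty, disjoint continua $F_1,F_2\subset U$ we have $$\mathrm{Mod}_n\Gamma(F_1,F_2;U)=\mathrm{Mod}_n(\Gamma(F_1,F_2;U)\cap\mathcal F).$$
   Context: A path (or curve) is a continuous map $\gamma\colon I\to\mathbb R^n$ with $I\subset\mathbb R$ a compact interval; its trace is $|\gamma|=\gamma(I)$; $\partial\gamma$ is the set of its endpoints; $\gamma+x$ is the path $t\mapsto\gamma(t)+x$. A strong subpath of $\gamma$ is the restriction of $\gamma$ to a closed subinterval of $I$. A reparametrization of $\gamma\colon[a,b]\to\mathbb R^n$ is a path $\gamma\circ s$ where $s\colon[c,d]\to[a,b]$ is an increasing or decreasing (i.e. monotone) continuous surjection. For a family $\Gamma$ of curves in $\mathbb R^n$, $\mathrm{Mod}_n\Gamma=\inf_\rho\int_{\mathbb R^n}\rho^n$, the infimum over all Borel $\rho\colon\mathbb R^n\to[0,\infty]$ with $\int_\gamma\rho\,ds\ge1$ for every rectifiable $\gamma\in\Gamma$ ($\mathrm{Mod}_n\Gamma=\infty$ if there are none). A continuum is a compact connected set. $\Gamma(F_1,F_2;U)$ is the family of curves $\gamma\colon[a,b]\to\overline U$ with $\gamma(a)\in F_1$, $\gamma(b)\in F_2$, $\gamma((a,b))\subset U$. $\mathcal H^{n-1}$ is Hausdorff $(n-1)$-measure, $S^{n-1}(0,1)$ the unit sphere. For a path family $\mathcal F$ in $\mathbb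 R^n$, $\partial\mathcal F$ is the set of points $x\in\mathbb R^n$ that are endpoints of some path of $\mathcal F$ and satisfy $x\notin|\gamma|\setminus\partial\gamma$ for every $\gamma\in\mathcal F$. A path family $\mathcal F$ in $\mathbb R^n$ is a family of curve perturbations, or $P$-family, if (P1) for all non-constant rectifiable paths $\gamma$ in $\mathbb R^n$ we have $\gamma+x\in\mathcal F$ for a.e. $x\in\mathbb R^n$; (P2) for every $x\in\mathbb R^n$ and $r>0$, the radial segment $t\mapsto x+tw$, $0\le t\le r$, lies in $\mathcal F$ for $\mathcal H^{n-1}$-a.e. $w\in S^{n-1}(0,1)$; (P3) $\mathcal F$ is closed under strong subpaths and reparametrizations; and (P4) if two paths $\gamma_1,\gamma_2\in\mathcal F$ have a common endpoint that does not lie in $\partial\mathcal F$, then the concatenation of $\gamma_1$ with $\gamma_2$ on that endpoint lies in $\mathcal F$. *)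

(* Defs.v *)
From HB Require Import structures.
From mathcomp Require Import all_boot all_order all_algebra.
From mathcomp Require Import all_classical all_reals all_analysis.
From mathcomp Require Import measurable_realfun lra.

Set Implicit Arguments.
Unset Strict Implicit.
Unset Printing Implicit Defensive.

Import Order.TTheory GRing.Theory Num.Theory.
Import numFieldNormedType.Exports.

Local Open Scope classical_set_scope.
Local Open Scope ring_scope.

Section borel.
Context (R : realType) (n : nat).

HB.instance Definition _ := @isMeasurable.Build
  (sigma_display (@open 'rV[R]_n)) 'rV[R]_n <<s @open 'rV[R]_n >>
  (@sigma_algebra0 _ setT open) (@sigma_algebraC _ open)
  (@sigma_algebra_bigcup _ setT open).

Lemma open_measurable_rV (U : set 'rV[R]_n) : open U -> measurable U.
Proof. by move=> oU; exact: sub_sigma_algebra. Qed.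

Lemma closed_measurable_rV (U : set 'rV[R]_n) : closed U -> measurable U.
Proof.
move=> cU; rewrite -(setCK U); apply: measurableC.
by apply: open_measurable_rV; exact: closed_openC.
Qed.

End borel.

Section lebesgue_rV.
Context {R : realType}.

Definition rV_cons n (p : R * 'rV[R]_n) : 'rV[R]_n.+1 := row_mx p.1%:M p.2.

Fixpoint lebesgue_rV n : set 'rV[R]_n -> \bar R :=
  match n with
  | 0 => \d_ (0 : 'rV[R]_0)
  | m.+1 => pushforward (lebesgue_measure \x @lebesgue_rV m)%E (@rV_cons m)
  end.

Lemma rV_cons0 n p : @rV_cons n p 0 ord0 = p.1.
Proof.
transitivity (row_mx p.1%:M p.2 0 (lshift n 0)).
  by congr (_ _ _); exact/val_inj.
by rewrite row_mxEl mxE eqxx mulr1n.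
Qed.

Lemma rV_consS n p (i : 'I_n) : @rV_cons n p 0 (lift ord0 i) = p.2 0 i.
Proof.
transitivity (row_mx p.1%:M p.2 0 (rshift 1 i)); last by rewrite row_mxEr.
by congr (_ _ _); exact/val_inj.
Qed.

Lemma rV_dense_rat n (v : 'rV[R]_n) (e : R) : 0 < e ->
  exists q : 'rV[rat]_n, ball (map_mx ratr q : 'rV[R]_n) e v.
Proof.
move=> e0.
have H i : exists q : rat, ball (ratr q : R) e (v 0 i).
  have := @rat_in_itvoo R (v 0 i - e) (v 0 i + e).
  case; first by rewrite ltrBlDr -addrA ltrDl addr_gt0.
  move=> q; rewrite in_itv/= => qv; exists q.
  by rewrite /ball/= ltr_distl; move: qv; lra.
have [q Hq] := choice H.
exists (\row_i q i); split => // i j.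
by rewrite !mxE ord1; exact: Hq.
Qed.

Lemma measurable_rV_cons n : measurable_fun [set: R * 'rV[R]_n] (@rV_cons n).
Proof.
apply: (@measurability _ _ _ _ _ _ (@open 'rV[R]_n.+1)) => //.
move=> _ [U oU <-]; rewrite setTI.
pose B (k : rat * 'rV[rat]_n * nat) : set (R * 'rV[R]_n) :=
  ball (ratr k.1.1 : R) k.2.+1%:R^-1 `*` ball (map_mx ratr k.1.2 : 'rV[R]_n) k.2.+1%:R^-1.
rewrite (_ : _ @^-1` U =
  \bigcup_(k in [set k | B k `<=` @rV_cons n @^-1` U]) B k); last first.
  apply/seteqP; split; last by move=> p [k]/= + Bp; exact.
  move=> [x v]/= Ux.
  have /nbhs_ballP[e /= e0 He] : nbhs (rV_cons (x, v)) U by exact: open_nbhs_nbhs.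
  have [k ke] : exists k, k.+1%:R^-1 < e / 2.
    have e20 : 0 < e / 2 by rewrite divr_gt0.
    have [k _ Hk] := near_infty_natSinv_lt (PosNum e20).
    by exists k; exact: Hk (leqnn k).
  have k0 : 0 < (k.+1%:R^-1 : R) by [].
  have [q xq] := @rV_dense_rat 1 x%:M _ k0.
  have [w vw] := rV_dense_rat v k0.
  have xq' : ball (ratr (q 0 0) : R) k.+1%:R^-1 x.
    by have [_ /(_ 0 0)] := xq; rewrite !mxE eqxx mulr1n.
  exists (q 0 0, w, k) => //= -[y z] [/= yB zB]; apply: He.
  have xy : ball x e y.
    apply: (@le_ball _ _ _ (k.+1%:R^-1 + k.+1%:R^-1)).
      by rewrite (splitr e) lerD// ltW.
    by apply: ball_triangle yB; exact: ball_sym.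
  have [_ vz] : ball v e z.
    apply: (@le_ball _ _ _ (k.+1%:R^-1 + k.+1%:R^-1)).
      by rewrite (splitr e) lerD// ltW.
    by apply: ball_triangle zB; exact: ball_sym.
  split => // i j; rewrite ord1.
  have [->|[i' ->]] : j = ord0 \/ exists i', j = lift ord0 i'.
    by case: (unliftP ord0 j) => [j' ->|->]; [right; exists j'|left].
  - by rewrite !rV_cons0.
  - by rewrite !rV_consS.
rewrite bigcup_mkcond; apply: countable_bigcupT_measurable => // k.
case: ifPn => // _; apply: measurableX.
  by apply: open_measurable; exact: ball_open.
by apply: open_measurable_rV; exact: ball_open.
Qed.

Definition rV_box n (a b : 'rV[R]_n) : set 'rV[R]_n :=
  [set v | forall i, a 0 i <= v 0 i <= b 0 i].

Lemma measurable_rV_box n (a b : 'rV[R]_n) : measurable (rV_box a b).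
Proof.
rewrite (_ : rV_box a b = \bigcap_(i in [set: 'I_n])
    ((fun v : 'rV[R]_n => v 0 i) @^-1` `[a 0 i, b 0 i])); last first.
  apply/seteqP; split=> [v vab i _|v vab i]/=.
    by rewrite in_itv/=; exact: vab.
  by have := vab i Logic.I; rewrite /= in_itv.
apply: fin_bigcap_measurable => // i _.
apply: closed_measurable_rV; apply: closed_comp; last exact: itv_closed.
by move=> v _; exact: coord_continuous.
Qed.

Definition rV_box_volume n (mu : set 'rV[R]_n -> \bar R) :=
  forall a b : 'rV[R]_n, (forall i, a 0 i <= b 0 i) ->
    mu (rV_box a b) = (\prod_i (b 0 i - a 0 i))%:E.

Section step.
Context (n : nat) (m : {sigma_finite_measure set 'rV[R]_n -> \bar R}).
Hypothesis mbox : rV_box_volume m.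

Definition rV_cons_measure : set 'rV[R]_n.+1 -> \bar R :=
  pushforward (lebesgue_measure \x m)%E (@rV_cons n).

Local Notation nu := rV_cons_measure.

Let mcons (A : set 'rV[R]_n.+1) :
  measurable A -> measurable (@rV_cons n @^-1` A).
Proof.
by move=> mA; rewrite -[X in measurable X]setTI; exact: measurable_rV_cons.
Qed.

Let nu0 : nu set0 = 0%E.
Proof. by rewrite /rV_cons_measure /pushforward preimage_set0 measure0. Qed.

Let nu_ge0 A : (0 <= nu A)%E.
Proof. exact: (measure_ge0 (lebesgue_measure \x m)%E). Qed.

Let nu_sigma_additive : semi_sigma_additive nu.
Proof.
move=> F mF tF mUF; rewrite /rV_cons_measure /pushforward preimage_bigcup.
apply: measure_semi_sigma_additive.
- by move=> k; exact: mcons.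
- apply/trivIsetP => /= i j _ _ ij; rewrite -preimage_setI.
  by move/trivIsetP : tF => /(_ _ _ _ _ ij) ->//; rewrite preimage_set0.
- by rewrite -preimage_bigcup; exact: mcons.
Qed.

HB.instance Definition _ := isMeasure.Build _ _ _ nu
  nu0 nu_ge0 nu_sigma_additive.

Let nu_box : rV_box_volume nu.
Proof.
move=> a b ab; rewrite /rV_cons_measure /pushforward.
pose a' := \row_(i < n) a 0 (lift ord0 i).
pose b' := \row_(i < n) b 0 (lift ord0 i).
rewrite (_ : _ @^-1` _ = `[a 0 ord0, b 0 ord0]%classic `*` rV_box a' b').
  rewrite product_measure1E//; last exact: measurable_rV_box.
  rewrite mbox; last by move=> i; rewrite !mxE.
  rewrite /= lebesgue_measure_itv/= lte_fin.
  rewrite big_ord_recl EFinM; congr (_ * _)%E.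
    case: ltgtP (ab ord0) => // -> _.
    by rewrite subrr.
  by congr _%:E; apply: eq_bigr => i _; rewrite !mxE.
apply/seteqP; split=> [[x v] /= H|[x v] /= [xab vab] i].
  split; first by have := H ord0; rewrite in_itv/= rV_cons0.
  by move=> i; have := H (lift ord0 i); rewrite rV_consS !mxE.
have [i' ->|->] := unliftP ord0 i.
  by rewrite rV_consS; have := vab i'; rewrite !mxE.
by rewrite rV_cons0; move: xab; rewrite in_itv.
Qed.

Let nu_sigma_finite : sigma_finite setT nu.
Proof.
exists (fun k => rV_box (const_mx (- k%:R)) (const_mx k%:R)); last first.
  move=> k; split; first exact: measurable_rV_box.
  rewrite nu_box ?ltry// => i; rewrite !mxE.
  by rewrite (@le_trans _ _ 0)// oppr_le0.
apply/esym; rewrite -subTset => v _.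
exists (Num.truncn (mx_norm v)).+1 => // i; rewrite !mxE -ler_norml.
rewrite ltW// (le_lt_trans _ (truncnS_gt _))//.
by rewrite mx_normrE; apply: (le_trans _ (le_bigmax _ _ (0, i))).
Qed.

HB.instance Definition _ := Measure_isSigmaFinite.Build _ _ _ nu
  nu_sigma_finite.

Lemma lebesgue_rV_step :
  exists2 m' : {sigma_finite_measure set 'rV[R]_n.+1 -> \bar R},
    m' = pushforward (lebesgue_measure \x m)%E (@rV_cons n)
      :> (set 'rV[R]_n.+1 -> \bar R) & rV_box_volume m'.
Proof. by exists nu. Qed.

End step.

Let lebesgue_rVP n :
  exists2 m : {sigma_finite_measure set 'rV[R]_n -> \bar R},
    m = @lebesgue_rV n :> (set 'rV[R]_n -> \bar R) & rV_box_volume m.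
Proof.
elim: n => [|n [m mE /lebesgue_rV_step[m' m'E m'box]]].
  exists (\d_(0 : 'rV[R]_0)) => // a b _.
  by rewrite big_ord0 /= diracE mem_set// => -[].
by exists m' => //; rewrite m'E mE.
Qed.

Lemma lebesgue_rV_box n : rV_box_volume (@lebesgue_rV n).
Proof. by have [m <-] := lebesgue_rVP n. Qed.

Let leb0 n : @lebesgue_rV n set0 = 0%E.
Proof. by have [m <- _] := lebesgue_rVP n; exact: measure0. Qed.

Let leb_ge0 n A : (0 <= @lebesgue_rV n A)%E.
Proof. by have [m <- _] := lebesgue_rVP n; exact: measure_ge0. Qed.

Let leb_additive n : semi_sigma_additive (@lebesgue_rV n).
Proof.
by have [m <- _] := lebesgue_rVP n; exact: measure_semi_sigma_additive.
Qed.

HB.instance Definition _ n := isMeasure.Build _ _ _ (@lebesgue_rV n)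
  (@leb0 n) (@leb_ge0 n) (@leb_additive n).

Let leb_sigma_finite n : sigma_finite setT (@lebesgue_rV n).
Proof. by have [m <- _] := lebesgue_rVP n; exact: sigma_finiteT. Qed.

HB.instance Definition _ n := Measure_isSigmaFinite.Build _ _ _ (@lebesgue_rV n)
  (@leb_sigma_finite n).

End lebesgue_rV.

Section euclidean.
Context {R : realType} {n : nat}.
Implicit Types (A : set 'rV[R]_n) (x : 'rV[R]_n).
Local Open Scope ereal_scope.

(* The library norm on ['rV[R]_n] is the sup norm; it induces the same topology. *)
Definition enorm x : R := Num.sqrt (\sum_i (x 0 i ^+ 2)%R)%R.

Definition unit_sphere : set 'rV[R]_n := [set w | enorm w = 1%R].

(* Adding 0 gives the empty set diameter 0. *)
Definition ediam A : \bar R :=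
  ereal_sup (0 |` [set (enorm (x - y)%R)%:E | x in A & y in A]).

(* Unnormalized Hausdorff measure, for integer dimension [0 < s]. *)
Definition hausdorff_content (s : nat) (delta : R) A : \bar R :=
  ereal_inf [set \sum_(k <oo) ediam (E k) ^+ s | E in
    [set E : (set 'rV[R]_n)^nat |
      A `<=` \bigcup_k E k /\ forall k, ediam (E k) <= delta%:E]].

Definition hausdorff_measure (s : nat) A : \bar R :=
  ereal_sup [set hausdorff_content s delta A | delta in [set d | (0 < d)%R]].

End euclidean.

(* Continuous maps from a compact interval [`[lo, hi]] to R^n; the value 0      *)
(* outside the interval makes equality of records the equality of such maps.   *)
Record curve (R : realType) (n : nat) := Curve {
  lo : R;
  hi : R;
  curve_fun :> R -> 'rV[R]_n;
  lo_le_hi : lo <= hi;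
  curve_continuous : {within `[lo, hi], continuous curve_fun};
  curve_out : forall t, t \notin `[lo, hi] -> curve_fun t = 0 }.

Section curves.
Context {R : realType} {n : nat}.
Implicit Types (f : R -> 'rV[R]_n) (c d : curve R n) (x w : 'rV[R]_n).

Lemma curve_eqP c d : lo c = lo d -> hi c = hi d ->
  {in `[lo c, hi c], c =1 d} -> c = d.
Proof.
case: c d => [a b f ab cf of'] [a' b' g ab' cg og] /= aa' bb' fg.
case: _ / aa' ab' cg og => ab' cg og; case: _ / bb' ab' cg og => ab' cg og.
have {}fg : f = g.
  apply/funext => t; have [/fg//|tab] := boolP (t \in `[a, b]).
  by rewrite of'// og.
case: _ / fg cg og => cg og.
by congr Curve; exact: Prop_irrelevance.
Qed.

Let patch_continuous (a b : R) f : {within `[a, b], continuous f} ->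
  {within `[a, b], continuous (patch (fun=> 0) `[a, b] f)}.
Proof.
by apply: subspace_eq_continuous => t tab; rewrite /from_subspace/= patchT.
Qed.

Let patch_out (a b : R) f t :
  t \notin `[a, b] -> patch (fun=> 0) `[a, b]%classic f t = 0.
Proof. by move=> tab; rewrite /patch mem_setE (negbTE tab). Qed.

Definition mk_curve a b f (ab : a <= b)
    (cf : {within `[a, b], continuous f}) : curve R n :=
  Curve ab (patch_continuous cf) (@patch_out a b f).

Lemma mk_curveE a b f (ab : a <= b) (cf : {within `[a, b], continuous f}) :
  {in `[a, b], mk_curve ab cf =1 f}.
Proof. by move=> t tab; rewrite /= patchT// mem_setE. Qed.

Definition trace c : set 'rV[R]_n := c @` `[lo c, hi c].

Definition endpoints c : set 'rV[R]_n := [set c (lo c); c (hi c)].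

Let translate_continuous c x :
  {within `[lo c, hi c], continuous (fun t => c t + x)}.
Proof.
apply: within_continuousD; first exact: curve_continuous.
by apply: continuous_subspaceT => ?; exact: cvg_cst.
Qed.

Definition translate c x : curve R n :=
  mk_curve (lo_le_hi c) (@translate_continuous c x).

Let radial_continuous x w (r : R) :
  {within `[0, r], continuous (fun t : R => x + t *: w)}.
Proof.
apply: continuous_subspaceT => t.
by apply: cvgD; [exact: cvg_cst|exact: scalel_continuous].
Qed.

Definition radial_segment x w (r : R) (r0 : 0 <= r) : curve R n :=
  mk_curve r0 (@radial_continuous x w r).

Let within_comp (A B : set R) f (g : R -> R) : continuous g ->
  (forall t, A t -> B (g t)) -> {within B, continuous f} ->
  {within A, continuous (f \o g)}.
Proof.
move=> cg gAB /subspace_continuousP cf; apply/subspace_continuousP => t At.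
apply: cvg_comp (cf _ (gAB _ At)) => P /= BP.
have tP : nbhs t (g @^-1` [set v | B v -> P v]) := cg t _ BP.
change (nbhs t [set u | A u -> P (g u)]).
by apply: filterS tP => u /= + Au; apply; exact: gAB.
Qed.

Let reverse_continuous c :
  {within `[lo c, hi c], continuous (fun t => c (lo c + hi c - t))}.
Proof.
apply: (@within_comp _ `[lo c, hi c] c (fun t => lo c + hi c - t)).
- by move=> t; apply: cvgB; [exact: cvg_cst|exact: cvg_id].
- by move=> t /=; rewrite !in_itv/= => /andP[? ?]; apply/andP; split; lra.
- exact: curve_continuous.
Qed.

Definition reverse c : curve R n :=
  mk_curve (lo_le_hi c) (@reverse_continuous c).

Let concat_fun c d (t : R) : 'rV[R]_n :=
  if t <= hi c then c t else d (lo d + (t - hi c)).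

Let concat_le c d : lo c <= hi c + (hi d - lo d).
Proof. by have := lo_le_hi c; have := lo_le_hi d; lra. Qed.

Let concat_continuous c d : c (hi c) = d (lo d) ->
  {within `[lo c, hi c + (hi d - lo d)], continuous (concat_fun c d)}.
Proof.
move=> cd; have lc := lo_le_hi c; have ld := lo_le_hi d.
rewrite (_ : `[_, _]%classic =
    `[lo c, hi c] `|` `[hi c, hi c + (hi d - lo d)]); last first.
  apply/seteqP; clear cd; split=> t /=; rewrite !in_itv/=.
    by move=> /andP[t1 t2]; case: (leP t (hi c)) => tc; [left|right];
      apply/andP; split; lra.
  by move=> [] /andP[? ?]; apply/andP; split; lra.
apply: withinU_continuous; [exact: itv_closed|exact: itv_closed| |].
  apply: (@subspace_eq_continuous _ _ _ c); last exact: curve_continuous.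
  move=> t; rewrite inE/= in_itv/= => /andP[_ tc].
  by rewrite /from_subspace /concat_fun tc.
have : {within `[hi c, hi c + (hi d - lo d)],
    continuous (d \o (fun t => lo d + (t - hi c)))}.
  apply: (@within_comp _ `[lo d, hi d]); last exact: curve_continuous.
    move=> t; apply: cvgD; first exact: cvg_cst.
    by apply: cvgB; [exact: cvg_id|exact: cvg_cst].
  by clear cd; move=> t /=; rewrite !in_itv/= => /andP[? ?]; apply/andP; split; lra.
apply: subspace_eq_continuous => t.
rewrite inE/= in_itv/= => /andP[ct _]; rewrite /from_subspace /concat_fun/=.
case: ifPn => // tc; have -> : t = hi c by apply/le_anti/andP.
by rewrite subrr addr0.
Qed.

Definition concat c d (cd : c (hi c) = d (lo d)) : curve R n :=
  mk_curve (concat_le c d) (concat_continuous cd).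

Definition strong_subpath d c :=
  [/\ lo c <= lo d, hi d <= hi c & {in `[lo d, hi d], d =1 c}].

Definition reparametrization d c := exists s : R -> R,
  [/\ {within `[lo d, hi d], continuous s},
      {in `[lo d, hi d] &, {homo s : t u / t <= u}} \/
        {in `[lo d, hi d] &, {homo s : t u /~ t <= u}},
      s @` `[lo d, hi d] = `[lo c, hi c]%classic &
      {in `[lo d, hi d], d =1 c \o s}].

Definition nonconstant c := ~ exists x, trace c = [set x].

Definition length_on f (a b : R) : \bar R :=
  ereal_sup [set (\sum_(0 <= k < size s)
      enorm (f (nth b (a :: s) k.+1) - f (nth b (a :: s) k)))%:E
    | s in itv_partition a b].

Definition length c : \bar R := length_on c (lo c) (hi c).

Definition rectifiable c := (length c < +oo)%E.

(* Arclength parametrization on [`[0, length c]]: the value of [c] at the first *)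
(* time at which the arclength reaches [s].                                    *)
Definition arclength_param c (s : R) : 'rV[R]_n :=
  c (inf [set t | t \in `[lo c, hi c] /\ (s%:E <= length_on c (lo c) t)%E]).

Definition line_integral (rho : 'rV[R]_n -> \bar R) c : \bar R :=
  (\int[lebesgue_measure]_(s in `[0%R, fine (length c)])
    rho (arclength_param c s))%E.

Definition admissible (G : set (curve R n)) (rho : 'rV[R]_n -> \bar R) :=
  [/\ measurable_fun [set: 'rV[R]_n] rho, (forall x, 0 <= rho x)%E &
      forall c, G c -> rectifiable c -> (1 <= line_integral rho c)%E].

(* [ereal_inf set0 = +oo], so the modulus is [+oo] if no [rho] is admissible. *)
Definition modulus (G : set (curve R n)) : \bar R :=
  ereal_inf [set (\int[@lebesgue_rV R n]_x (rho x ^+ n))%E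
    | rho in admissible G].

Definition continuum (A : set 'rV[R]_n) := compact A /\ connected A.

Definition connecting_curves (F1 F2 U : set 'rV[R]_n) : set (curve R n) :=
  [set c | [/\ trace c `<=` closure U, F1 (c (lo c)), F2 (c (hi c)) &
    forall t, t \in `]lo c, hi c[ -> U (c t)]].

Definition family_boundary (F : set (curve R n)) : set 'rV[R]_n :=
  [set x | (exists2 c, F c & endpoints c x) /\
    forall c, F c -> ~ (trace c `\` endpoints c) x].

Record P_family (F : set (curve R n)) : Prop := {
  P_translate : forall c, nonconstant c -> rectifiable c ->
    {ae @lebesgue_rV R n, forall x, F (translate c x)};
  P_radial : forall x (r : R) (r0 : 0 < r),
    hausdorff_measure n.-1
      [set w | unit_sphere w /\ ~ F (radial_segment x w (ltW r0))] = 0%E;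
  P_subpath : forall c d, F c -> strong_subpath d c -> F d;
  P_reparametrization : forall c d, F c -> reparametrization d c -> F d;
  (* Either curve may have to be reversed for the common endpoint to be the end *)
  (* of the first curve and the start of the second.                           *)
  P_concat : forall c1 c2, F c1 -> F c2 ->
    forall d1 d2, d1 = c1 \/ d1 = reverse c1 -> d2 = c2 \/ d2 = reverse c2 ->
    forall e : d1 (hi d1) = d2 (lo d2),
      ~ family_boundary F (d1 (hi d1)) -> F (concat e) }.

End curves.

(* Main.v *)
Require Import Defs.
From mathcomp Require Import all_boot all_order all_algebra.
From mathcomp Require Import all_classical all_reals all_analysis.
From mathcomp Require Import measurable_realfun ring lra.

(** The modulus is monotone in the family of curves, so one inequality is clear.
    For the other one, let [rho] be a density of finite energy that is
    admissible for the connecting curves in the family; it has to be turned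
    into densities of almost the same energy that are admissible for
    connecting curves outside the family as well.

    Suppose first that both continua have more than one point. Replace [rho]
    by its average over cubes of small radius [r]. The energy does not
    increase ([energy_cube_mean_le]), and the line integral of the average
    along a curve [c] is the average of the line integrals of [rho] along the
    translates of [c] by vectors of norm at most [r]
    ([line_integral_cube_mean]). If it is less than some [theta < 1] then, by
    [P_translate], some translate of [c] in the family has line integral of
    [rho] less than [theta] ([exists_good_translate]). This translate need
    not connect the continua any more, but it can be repaired near its two
    ends inside the family at an arbitrarily small cost
    ([connecting_detour]), which contradicts the admissibility of [rho].
    Hence the average divided by [theta] is admissible, at least for those
    connecting curves that stay at a definite distance from the complement of
    [U] and whose endpoints stay at a definite distance from each other
    ([cube_mean_admissible]). Letting [theta] tend to 1 gives the inequality
    for these curves. They exhaust all connecting curves, and the modulus is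
    continuous along increasing unions ([modulus_bigcup_le]); the latter is a
    theorem of Ziemer, based on Clarkson's inequality.

    The repair near an end uses that both the continuum and the translate
    cross an annulus of radius [r]. By a Vitali covering argument, each of
    them contains in this annulus a point [p] such that the energy of [rho]
    on every cube of radius [s <= 2 * r] about [p] is at most a small
    multiple of [s / r] ([good_point]). For such a point, the line integral
    of [rho] along the segment from [p] to [z] is small on average over [z]
    ([segment_mean_bound]), so that a suitable [z] joins the good points of
    the two sets by a broken line with small line integral. By [P_radial],
    both of its segments lie in the family for almost every [z], because a
    null set of directions spans a null cone ([cone_negligible]). They may be
    concatenated by [P_concat], because [z] is interior to a longer radial
    segment of the family ([joining_curve]).

    If one of the continua is a point then both moduli are 0. Indeed the
    curves through a point that leave a neighbourhood of it have zero modulus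
    ([modulus_reaching]): scale invariance gives densities of bounded energy
    that are admissible for these curves and live in arbitrarily small annuli
    around the point, and the mean of two of them with disjoint supports has
    at most half of their energy, since [n >= 2]. *)

Import Order.TTheory GRing.Theory Num.Theory.
Import numFieldNormedType.Exports.

Set Implicit Arguments.
Unset Strict Implicit.
Unset Printing Implicit Defensive.

Local Open Scope classical_set_scope.
Local Open Scope ring_scope.

(** * Affine changes of variables *)

Section lebesgue_affine.
Context {R : realType}.
Local Open Scope ereal_scope.
Implicit Types (f : R -> \bar R).

Lemma measurable_affine (a b : R) :
  measurable_fun [set: measurableTypeR R] (fun x : measurableTypeR R => (a * x + b)%R : measurableTypeR R).
Proof. by apply: measurable_funD => //; exact: measurable_funM. Qed.

Lemma lebesgue_measure_affine_itv (a b c d : R) : (a != 0)%R -> (c < d)%R ->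
  lebesgue_measure ((fun x => a * x + b)%R @^-1` `]c, d]%classic)
  = (`|a|^-1 * (d - c))%:E.
Proof.
case/lt_total/orP => sa cd.
  rewrite (_ : _ @^-1` `]c, d] = `[((d - b) / a)%R, ((c - b) / a)%R[%classic).
    rewrite lebesgue_measure_itv/= lte_fin ltr_ndivrMr// divfK ?ltr0_neq0//.
    rewrite ltrD2r cd -EFinB; congr _%:E.
    by rewrite ltr0_norm//; field; rewrite ltr0_neq0.
  apply/seteqP; split => x /=; rewrite !in_itv/= => /andP[].
    by rewrite ler_ndivrMr// ltr_ndivlMr// => h1 h2; apply/andP; split; lra.
  by rewrite ler_ndivrMr// ltr_ndivlMr// => h1 h2; apply/andP; split; lra.
rewrite (_ : _ @^-1` `]c, d] = `]((c - b) / a)%R, ((d - b) / a)%R]%classic).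
  rewrite lebesgue_measure_itv/= lte_fin ltr_pdivrMr// divfK ?lt0r_neq0//.
  rewrite ltrD2r cd -EFinB; congr _%:E.
  by rewrite gtr0_norm//; field; rewrite lt0r_neq0.
apply/seteqP; split => x /=; rewrite !in_itv/= => /andP[].
  by rewrite ler_pdivlMr// ltr_pdivrMr// => h1 h2; apply/andP; split; lra.
by rewrite ler_pdivlMr// ltr_pdivrMr// => h1 h2; apply/andP; split; lra.
Qed.

(** Lebesgue measure is the only measure giving each interval its length, so it
    coincides with [`|a|] times its own image under the affine map. *)
Lemma integral_affine (a b : R) f : (a != 0)%R ->
  measurable_fun setT f -> (forall x, 0 <= f x) ->
  \int[lebesgue_measure]_x f (a * x + b)%R = `|a|^-1%:E * \int[lebesgue_measure]_x f x.
Proof.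
move=> a0 mf f0.
have na0 : (0 < `|a|)%R by rewrite normr_gt0.
pose T := fun x : measurableTypeR R => (a * x + b)%R : measurableTypeR R.
pose mu' := mscale (NngNum (ltW na0)) (pushforward lebesgue_measure T).
pose mu := mu' (measurable_affine a b).
have muE A : measurable A -> lebesgue_measure A = mu A.
  apply: lebesgue_measure_unique => _ [[c d] _ <-] /=.
  rewrite /mu/= /mscale/= /pushforward.
  have [cd|dc] := ltP c d; last first.
    by rewrite set_itv_ge ?bnd_simp -?leNgt// preimage_set0 !measure0 mule0.
  rewrite lebesgue_measure_affine_itv//.
  rewrite lebesgue_measure_itv/= lte_fin cd -EFinM mulrA divff ?mul1r//.
  by rewrite normr_eq0.
rewrite [in RHS](eq_measure_integral mu); last by move=> A mA _; exact: muE.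
rewrite ge0_integral_mscale//= ge0_integral_pushforward//.
  by rewrite muleA -EFinM mulVf ?normr_eq0// mul1e preimage_setT.
exact: measurable_affine.
Qed.
End lebesgue_affine.

Section measurable_rV.
Context {R : realType}.

Lemma measurable_coord_rV n (i : 'I_n) :
  measurable_fun [set: 'rV[R]_n] (fun v : 'rV[R]_n => v 0 i).
Proof.
apply: (measurability _ (RGenOpens.measurableE R)) => //.
move=> _ [_ [a [b ->]] <-]; rewrite setTI; apply: open_measurable_rV.
apply: open_comp; last exact: interval_open.
by move=> v _; exact: coord_continuous.
Qed.

(** The Borel sets of row vectors are generated by the open sets, not by the
    coordinates; the map is therefore rebuilt one coordinate at a time
    through the measurable map [rV_cons]. *)
Lemma measurable_fun_rV d (T : measurableType d) n (f : T -> 'rV[R]_n) :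
  (forall i, measurable_fun setT (fun t => f t 0 i)) -> measurable_fun setT f.
Proof.
elim: n f => [|n IH] f mf.
  by rewrite (_ : f = cst 0)//; apply/funext => t; apply/rowP => -[].
rewrite (_ : f = @rV_cons R n \o
    (fun t => (f t 0 ord0, \row_i f t 0 (lift ord0 i)))).
  apply: measurableT_comp; first exact: measurable_rV_cons.
  apply: measurable_fun_pair; first exact: mf.
  apply: IH => i; rewrite (_ : (fun t => _) = (fun t => f t 0 (lift ord0 i)))//.
  by apply/funext => t; rewrite mxE.
apply/funext => t; apply/rowP => j.
by have [i ->|->] := unliftP ord0 j; rewrite ?rV_consS ?rV_cons0 ?mxE.
Qed.

Lemma measurable_addrV n d (T : measurableType d) (f g : T -> 'rV[R]_n) :
  measurable_fun setT f -> measurable_fun setT g ->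
  measurable_fun setT (fun t => f t + g t).
Proof.
move=> mf mg; apply: measurable_fun_rV => i.
rewrite (_ : (fun t => _) = (fun t => f t 0 i + g t 0 i)); last first.
  by apply/funext => t; rewrite mxE.
by apply: measurable_funD; apply: measurableT_comp (measurable_coord_rV i) _.
Qed.

Lemma measurable_scalerV n d (T : measurableType d) (k : T -> R) (f : T -> 'rV[R]_n) :
  measurable_fun setT k -> measurable_fun setT f ->
  measurable_fun setT (fun t => k t *: f t).
Proof.
move=> mk mf; apply: measurable_fun_rV => i.
rewrite (_ : (fun t => _) = (fun t => k t * f t 0 i)); last first.
  by apply/funext => t; rewrite mxE.
by apply: measurable_funM => //; apply: measurableT_comp (measurable_coord_rV i) _.
Qed.

Lemma measurable_enorm n : measurable_fun [set: 'rV[R]_n] enorm.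
Proof.
rewrite /enorm; apply: measurableT_comp.
  by apply: continuous_measurable_fun; exact: sqrt_continuous.
apply: measurable_sum => i; apply: measurable_funX; exact: measurable_coord_rV.
Qed.

Local Open Scope ereal_scope.

Lemma measurable_funXe d (T : measurableType d) (D : set T) (f : T -> \bar R) m :
  measurable_fun D f -> measurable_fun D (fun x => f x ^+ m).
Proof.
move=> mf; elim: m => [|m IH]; first exact: measurable_cst.
rewrite (_ : (fun x => _) = (fun x => f x * f x ^+ m)).
  exact: emeasurable_funM.
by apply/funext => x; rewrite expeS.
Qed.

Lemma integral_rV_cons n (f : 'rV[R]_n.+1 -> \bar R) :
  measurable_fun setT f -> (forall x, 0 <= f x) ->
  \int[@lebesgue_rV R n.+1]_z f z =
  \int[lebesgue_measure]_x \int[@lebesgue_rV R n]_v f (rV_cons (x, v)).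
Proof.
move=> mf f0.
have mc : measurable_fun setT (f \o @rV_cons R n).
  by apply: measurableT_comp => //; exact: measurable_rV_cons.
transitivity (\int[(lebesgue_measure \x @lebesgue_rV R n)%E]_z (f \o @rV_cons R n) z); last first.
  exact: (@fubini_tonelli1 _ _ _ _ R lebesgue_measure (@lebesgue_rV R n) _ mc
    (fun z => f0 (rV_cons z))).
transitivity (\int[pushforward (lebesgue_measure \x @lebesgue_rV R n)%E
  (@rV_cons R n)]_z f z) => //.
have mcons : measurable_fun [set: (measurableTypeR R * 'rV[R]_n)%type]
  (@rV_cons R n) by exact: measurable_rV_cons.
have := ge0_integral_pushforward mcons
  (lebesgue_measure \x @lebesgue_rV R n)%E measurableT mf (fun y _ => f0 y).
by rewrite preimage_setT.
Qed.

(** Induction on the dimension: the first coordinate and the remaining ones are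
    rescaled separately by Tonelli's theorem. *)
Lemma integral_rV_affine n (p : 'rV[R]_n) (k : R) (f : 'rV[R]_n -> \bar R) :
  (0 < k)%R -> measurable_fun setT f -> (forall x, 0 <= f x) ->
  \int[@lebesgue_rV R n]_z f (p + k *: z)%R =
  (k ^- n)%:E * \int[@lebesgue_rV R n]_z f z.
Proof.
move=> k0; elim: n p f => [|n IH] p f mf f0.
  rewrite expr0 invr1 mul1e; apply: eq_integral => z _; congr f.
  by apply/rowP => -[].
have maff m (q : 'rV[R]_m) : measurable_fun setT (fun z : 'rV[R]_m => q + k *: z)%R.
  apply: measurable_addrV; first exact: measurable_cst.
  by apply: measurable_scalerV; [exact: measurable_cst|exact: measurable_id].
rewrite integral_rV_cons//; last first.
  exact: (measurableT_comp mf (maff _ p)).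
rewrite integral_rV_cons//.
pose g (x : R) := \int[@lebesgue_rV R n]_v f (rV_cons (x, v)).
have mcons : measurable_fun setT (f \o @rV_cons R n).
  by apply: measurableT_comp => //; exact: measurable_rV_cons.
pose p' := \row_(i < n) p 0%R (lift ord0 i).
transitivity (\int[lebesgue_measure]_x ((k ^- n)%:E * g (k * x + p 0 0)%R)).
  apply: eq_integral => x _.
  rewrite -(IH p' (fun v => f (rV_cons ((k * x + p 0 0)%R, v))))//.
    apply: eq_integral => v _; congr f; apply/rowP => j.
    have [i ->|->] := unliftP ord0 j.
        by rewrite rV_consS ![in RHS]mxE mxE [X in (_ + X)%R = _]mxE rV_consS.
    by rewrite rV_cons0 mxE [X in (_ + X)%R = _]mxE rV_cons0/= addrC.
  apply: (measurableT_comp mcons).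
  by apply: measurable_fun_pair; [exact: measurable_cst|exact: measurable_id].
have mg : measurable_fun setT g.
  exact: (@measurable_fun_fubini_tonelli_F _ _ _ _ R (@lebesgue_rV R n) _ mcons
    (fun z => f0 (rV_cons z))).
have g0 x : 0 <= g x by apply: integral_ge0.
rewrite -[X in _ = _ * X]/(\int[lebesgue_measure]_x g x).
move: g mg g0 => g mg g0.
rewrite ge0_integralZl_EFin//; last 2 first.
- by apply: (measurableT_comp mg); exact: measurable_affine.
- by rewrite invr_ge0 exprn_ge0// ltW.
rewrite (integral_affine _ _ mg)// ?gt_eqF// muleA -EFinM gtr0_norm//.
by rewrite exprS invfM mulrC.
Qed.

End measurable_rV.

(** * Euclidean norm and length *)

Section enorm.
Context {R : realType} {n : nat}.
Implicit Types x y : 'rV[R]_n.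

Lemma enorm_ge0 x : 0 <= enorm x.
Proof. exact: sqrtr_ge0. Qed.

Lemma enorm_sqr x : enorm x ^+ 2 = \sum_i x 0 i ^+ 2.
Proof. by rewrite sqr_sqrtr//; apply: sumr_ge0 => i _; exact: sqr_ge0. Qed.

Lemma enorm0 : enorm (0 : 'rV[R]_n) = 0.
Proof.
by rewrite /enorm big1 ?sqrtr0// => i _; rewrite mxE expr0n.
Qed.

Lemma enormZ (k : R) x : enorm (k *: x) = `|k| * enorm x.
Proof.
rewrite /enorm (eq_bigr (fun i => k ^+ 2 * x 0 i ^+ 2)); last first.
  by move=> i _; rewrite mxE exprMn.
by rewrite -mulr_sumr sqrtrM ?sqr_ge0// sqrtr_sqr.
Qed.

Lemma enormN x : enorm (- x) = enorm x.
Proof. by rewrite -scaleN1r enormZ normrN1 mul1r. Qed.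

Lemma enorm_eq0 x : enorm x = 0 -> x = 0.
Proof.
move=> x0; apply/rowP => i; rewrite mxE; apply/eqP.
have := enorm_sqr x; rewrite x0 expr0n => /esym/eqP.
rewrite psumr_eq0; last by move=> j _; exact: sqr_ge0.
by move=> /allP /(_ i); rewrite mem_index_enum sqrf_eq0 => /(_ isT).
Qed.

Lemma norm_le_enorm x : `|x| <= enorm x.
Proof.
rewrite -[`|x|]/(mx_norm x) mx_normrE.
apply: bigmax_le => [|[i j] _ /=]; first exact: enorm_ge0.
rewrite ord1 -sqrtr_sqr /enorm ler_sqrt; last first.
  by apply: sumr_ge0 => ? _; exact: sqr_ge0.
by rewrite (bigD1 j)//= lerDl; apply: sumr_ge0 => ? _; exact: sqr_ge0.
Qed.

Lemma coord_le_norm x i : `|x 0 i| <= `|x|.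
Proof.
by rewrite -[X in _ <= X]/(mx_norm x) mx_normrE (le_trans _ (le_bigmax _ _ (0, i))).
Qed.

Lemma norm_rV_le x (r : R) : 0 <= r ->
  (`|x| <= r) = [forall i, `|x 0 i| <= r].
Proof.
move=> r0; apply/idP/forallP => [xr i|H].
  exact: le_trans (coord_le_norm _ _) xr.
rewrite -[X in X <= _]/(mx_norm x) mx_normrE.
by apply: bigmax_le => // -[i j] _ /=; rewrite ord1.
Qed.

Lemma enorm_le_norm x : enorm x <= n%:R * `|x|.
Proof.
have -> : n%:R * `|x| = Num.sqrt ((n%:R * `|x|) ^+ 2).
  by rewrite sqrtr_sqr ger0_norm// mulr_ge0.
rewrite /enorm ler_sqrt ?sqr_ge0//.
apply: (@le_trans _ _ (\sum_(i < n) `|x| ^+ 2)).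
  by apply: ler_sum => i _; rewrite -[leLHS]real_normK ?num_real// ler_sqr ?nnegrE// coord_le_norm.
rewrite sumr_const card_ord -[leLHS]mulr_natl exprMn ler_wpM2r ?sqr_ge0//.
by rewrite -natrX ler_nat -mulnn; case: (n) => // m; exact: leq_pmulr.
Qed.

Lemma enorm_dot x y : \sum_i x 0 i * y 0 i <= enorm x * enorm y.
Proof.
have [x0|x0] := eqVneq (enorm x) 0.
  by rewrite (enorm_eq0 x0) big1 ?enorm0 ?mul0r// => i _; rewrite mxE mul0r.
have [y0|y0] := eqVneq (enorm y) 0.
  by rewrite (enorm_eq0 y0) big1 ?enorm0 ?mulr0// => i _; rewrite mxE mulr0.
have a0 : 0 < enorm x by rewrite lt0r x0 enorm_ge0.
have b0 : 0 < enorm y by rewrite lt0r y0 enorm_ge0.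
set a := enorm x in a0 x0 *; set b := enorm y in b0 y0 *.
have ab0 : 0 < 2 * a * b by rewrite !mulr_gt0.
rewrite -(ler_pM2l ab0) mulr_sumr.
apply: (@le_trans _ _ (\sum_i (b ^+ 2 * x 0 i ^+ 2 + a ^+ 2 * y 0 i ^+ 2))).
  by apply: ler_sum => i _; have := sqr_ge0 (b * x 0 i - a * y 0 i); nra.
rewrite big_split/= -!mulr_sumr -!enorm_sqr -/a -/b; nra.
Qed.

Lemma enormD x y : enorm (x + y) <= enorm x + enorm y.
Proof.
rewrite -ler_sqr ?nnegrE ?addr_ge0 ?enorm_ge0// enorm_sqr.
rewrite (eq_bigr (fun i => x 0 i ^+ 2 + 2 * (x 0 i * y 0 i) + y 0 i ^+ 2)); last first.
  by move=> i _; rewrite mxE; ring.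
rewrite !big_split/= -mulr_sumr -!enorm_sqr.
by have := enorm_dot x y; rewrite sqrrD; lra.
Qed.

End enorm.

Section length.
Context {R : realType} {n : nat}.
Implicit Types (f g : R -> 'rV[R]_n) (a b : R) (s : seq R).

(** Structural recursion on the partition, in place of the indexed sum in
    [length_on], is what makes the inductions on partitions below possible. *)
Fixpoint polyline f a s : R :=
  if s is x :: s' then enorm (f x - f a) + polyline f x s' else 0.

Lemma polylineE f b a s :
  \sum_(0 <= k < size s) enorm (f (nth b (a :: s) k.+1) - f (nth b (a :: s) k))
  = polyline f a s.
Proof.
elim: s a => [|x s IH] a; first by rewrite big_nil.
by rewrite big_nat_recl//= -IH.
Qed.

Lemma length_onE f a b :
  length_on f a b = ereal_sup [set (polyline f a s)%:E | s in itv_partition a b].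
Proof.
rewrite /length_on; congr ereal_sup.
by apply/seteqP; split=> _ [s ps <-]; exists s; rewrite // polylineE.
Qed.

Lemma polyline_le_length f a b s :
  itv_partition a b s -> ((polyline f a s)%:E <= length_on f a b)%E.
Proof. by move=> ps; rewrite length_onE; apply: ereal_sup_ubound; exists s. Qed.

Lemma itv_partition_cons a b x s :
  a < x -> itv_partition x b s -> itv_partition a b (x :: s).
Proof. by move=> ax [ps ls]; split => //=; rewrite ax. Qed.

Lemma itv_partition_consP a b x s :
  itv_partition a b (x :: s) -> a < x /\ itv_partition x b s.
Proof. by move=> [/= /andP[ax ps] ls]. Qed.

Lemma itv_partition_le a b s : itv_partition a b s -> a <= b.
Proof.
elim: s a => [a [_ /= /eqP->]//|x s IH a /itv_partition_consP[ax /IH xb]].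
exact: le_trans (ltW ax) xb.
Qed.

Lemma enorm_le_length f a b :
  a <= b -> ((enorm (f b - f a))%:E <= length_on f a b)%E.
Proof.
rewrite le_eqVlt => /predU1P[<-|ab].
  rewrite subrr enorm0; apply: (@le_trans _ _ (polyline f a [::])%:E) => //.
  exact: polyline_le_length.
apply: (le_trans _ (@polyline_le_length _ _ _ [:: b] _)).
  by rewrite /= addr0.
by split => //=; rewrite ab.
Qed.

Lemma length_on_ge0 f a b : a <= b -> (0 <= length_on f a b)%E.
Proof.
by move=> ab; apply: le_trans (enorm_le_length f ab); rewrite lee_fin enorm_ge0.
Qed.

Lemma length_on_point f a : length_on f a a = 0%E.
Proof.
apply/le_anti; rewrite length_on_ge0// andbT length_onE.
apply: ge_ereal_sup => _ [[|x s] ps <-] //=.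
by have [ax /itv_partition_le] := itv_partition_consP ps; rewrite leNgt ax.
Qed.

Lemma itv_partition_cat f a b c s1 s2 :
  itv_partition a b s1 -> itv_partition b c s2 ->
  itv_partition a c (s1 ++ s2) /\
  polyline f a (s1 ++ s2) = polyline f a s1 + polyline f b s2.
Proof.
elim: s1 a => [|x s1 IH] a.
  by move=> [_ /= /eqP->] p2; rewrite add0r.
move=> /itv_partition_consP[ax p1] p2; have [p12 e] := IH _ p1 p2.
by rewrite cat_cons; split; [exact: itv_partition_cons|rewrite /= e addrA].
Qed.

(** Inserting a vertex can only lengthen a polygonal line, by the triangle
    inequality. *)
Lemma itv_partition_split f a b c s : a <= b -> b <= c -> itv_partition a c s ->
  exists s1 s2, [/\ itv_partition a b s1, itv_partition b c s2 &
    polyline f a s <= polyline f a s1 + polyline f b s2].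
Proof.
elim: s a => [|x s IH] a ab bc.
  move=> [_ /= /eqP ac]; exists [::], [::].
  have -> : b = a by apply/le_anti; rewrite ab ac bc.
  by split; [by split => /=|split; rewrite /= ?ac|rewrite /= addr0].
move=> pxs; have [ax ps] := itv_partition_consP pxs.
have [xb|bx] := leP x b.
  have [s1 [s2 [p1 p2 le12]]] := IH _ xb bc ps.
  exists (x :: s1), s2; split => //; first exact: itv_partition_cons.
  by rewrite /= -addrA lerD2l.
move: ab; rewrite le_eqVlt => /predU1P[<-|ab].
  by exists [::], (x :: s); split; rewrite //= add0r.
exists [:: b], (x :: s); split => //.
- by split => //=; rewrite ab.
- exact: itv_partition_cons.
- rewrite /= addr0 addrA lerD2r.
  have -> : f x - f a = (f b - f a) + (f x - f b) by rewrite [RHS]addrC subrKA.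
  exact: enormD.
Qed.

Lemma length_on_add f a b c : a <= b -> b <= c ->
  length_on f a c = (length_on f a b + length_on f b c)%E.
Proof.
move=> ab bc; apply/le_anti/andP; split.
  rewrite [leLHS]length_onE; apply: ge_ereal_sup => _ [s ps <-].
  have [s1 [s2 [p1 p2 le12]]] := itv_partition_split f ab bc ps.
  apply: (@le_trans _ _ ((polyline f a s1)%:E + (polyline f b s2)%:E)%E).
    by rewrite -EFinD lee_fin.
  by apply: leeD; exact: polyline_le_length.
have H s1 s2 : itv_partition a b s1 -> itv_partition b c s2 ->
    ((polyline f a s1)%:E + (polyline f b s2)%:E <= length_on f a c)%E.
  move=> p1 p2; have [p12 e] := itv_partition_cat f p1 p2.
  by rewrite -EFinD -e; exact: polyline_le_length.
have [->|acoo] := eqVneq (length_on f a c) +oo%E; first by rewrite leey.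
have acfin : length_on f a c \is a fin_num.
  by rewrite ge0_fin_numE ?length_on_ge0 ?(le_trans ab)// ltey.
have H1 s2 : itv_partition b c s2 ->
    (length_on f a b <= length_on f a c - (polyline f b s2)%:E)%E.
  move=> p2; rewrite [leLHS]length_onE; apply: ge_ereal_sup => _ [s1 p1 <-].
  by rewrite leeBrDr//; exact: H.
have [s2 p2] : exists s, itv_partition b c s.
  move: bc; rewrite le_eqVlt => /predU1P[->|bc]; first by exists [::].
  by exists [:: c]; split => //=; rewrite bc.
have abfin : length_on f a b \is a fin_num.
  rewrite ge0_fin_numE ?length_on_ge0//; apply: le_lt_trans (H1 _ p2) _.
  by rewrite -(fineK acfin) -EFinB ltry.
rewrite addeC -leeBrDr// [leLHS]length_onE; apply: ge_ereal_sup => _ [t pt <-].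
by rewrite leeBrDr// addeC -leeBrDr//; exact: H1.
Qed.

Lemma eq_length_on f g a b : {in `[a, b], f =1 g} -> length_on f a b = length_on g a b.
Proof.
move=> fg; rewrite !length_onE.
have H s : itv_partition a b s -> polyline f a s = polyline g a s.
  elim: s a fg => //= x s IH a fg /itv_partition_consP[ax ps].
  have xb := itv_partition_le ps.
  rewrite IH//; last first.
    by move=> t; rewrite in_itv/= => /andP[? ?]; apply: fg; rewrite in_itv/=; apply/andP; split; lra.
  by rewrite !fg// in_itv/=; apply/andP; split; lra.
by congr ereal_sup; apply/seteqP; split=> _ [s ps <-]; exists s => //; rewrite H.
Qed.

Lemma length_on_shift f (h a b : R) :
  length_on (fun t => f (t + h)) a b = length_on f (a + h) (b + h).
Proof.
rewrite !length_onE.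
have H s : polyline (fun t => f (t + h)) a s = polyline f (a + h) (map (+%R^~ h) s).
  by elim: s a => //= x s IH a; rewrite IH.
have Hp s : itv_partition a b s -> itv_partition (a + h) (b + h) (map (+%R^~ h) s).
  elim: s a {H} => [a [_ /= /eqP ->]|x s IH a /itv_partition_consP[ax /IH ps]]; first by split => /=.
  by apply: itv_partition_cons => //; rewrite ltrD2r.
have Hm s : itv_partition (a + h) (b + h) s -> itv_partition a b (map (+%R^~ (- h)) s).
  have e t : t = t + h - h by rewrite addrK.
  move=> ps; rewrite (e a) (e b); elim: s (a + h) ps {H Hp} => [u [_ /= /eqP ->]|x s IH u /itv_partition_consP[ux /IH ps]]; first by split => /=.
  by apply: itv_partition_cons => //; rewrite ltrD2r.
congr ereal_sup; apply/seteqP; split=> _ [s ps <-].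
  by exists (map (+%R^~ h) s); [exact: Hp|rewrite H].
exists (map (+%R^~ (- h)) s); first exact: Hm.
rewrite H -map_comp map_id_in// => t _ /=; exact: subrK.
Qed.

Lemma length_on_arc f a b : a <= b ->
  (forall t u, a <= t -> t <= u -> u <= b -> enorm (f u - f t) = u - t) ->
  length_on f a b = (b - a)%:E.
Proof.
move=> ab fE; rewrite length_onE.
have H s : itv_partition a b s -> polyline f a s = b - a.
  elim: s a ab fE => [a _ _ [_ /= /eqP->]|x s IH a ab fE /itv_partition_consP[ax ps]] /=; first by rewrite subrr.
  have xb := itv_partition_le ps.
  rewrite IH// ?fE//; [lra|exact: ltW|].
  by move=> t u xt; apply: fE; rewrite (le_trans (ltW ax)).
apply/le_anti/andP; split.
  by apply: ge_ereal_sup => _ [s ps <-]; rewrite H.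
have [->|ab'] := eqVneq a b.
  apply: ereal_sup_ubound; exists [::]; [by split => /=|by rewrite /= subrr].
have ps : itv_partition a b [:: b] by split => //=; rewrite lt_neqAle ab' ab.
by apply: ereal_sup_ubound; exists [:: b] => //; rewrite H.
Qed.

End length.

(** * Arclength parametrization *)

Section arclength.
Context {R : realType} {n : nat}.
Implicit Types (c d : curve R n) (s t : R).

Definition arclength c t : \bar R := length_on c (lo c) t.

Definition arctimes c s : set R :=
  [set t | t \in `[lo c, hi c] /\ (s%:E <= arclength c t)%E].

Lemma arclength_paramE c s : arclength_param c s = c (inf (arctimes c s)).
Proof. by []. Qed.

Lemma arclength_homo c t u : lo c <= t -> t <= u ->
  (arclength c t <= arclength c u)%E.
Proof.
move=> ct tu; rewrite /arclength (length_on_add _ ct tu) leeDl//.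
exact: length_on_ge0.
Qed.

Lemma arclength_ge0 c t : lo c <= t -> (0 <= arclength c t)%E.
Proof. exact: length_on_ge0. Qed.

Lemma arclength_fin c t : rectifiable c -> lo c <= t -> t <= hi c ->
  arclength c t \is a fin_num.
Proof.
move=> rc ct tc; rewrite ge0_fin_numE ?arclength_ge0//.
exact: le_lt_trans (arclength_homo ct tc) rc.
Qed.

Lemma has_lbound_arctimes c s : has_lbound (arctimes c s).
Proof. by exists (lo c) => t [/= /itvP ->]. Qed.

Lemma arctimes_hi c s : (s%:E <= length c)%E -> arctimes c s (hi c).
Proof. by move=> sc; split=> //; rewrite in_itv/= lexx lo_le_hi. Qed.

Lemma inf_arctimes_itv c s : (s%:E <= length c)%E ->
  lo c <= inf (arctimes c s) <= hi c.
Proof.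
move=> /arctimes_hi h; apply/andP; split.
  by apply: lb_le_inf; [exists (hi c)|move=> t [/= /itvP ->]].
exact: ge_inf (has_lbound_arctimes c s) _ h.
Qed.

Lemma inf_arctimes_le c s t : lo c <= t <= hi c -> (s%:E <= arclength c t)%E ->
  inf (arctimes c s) <= t.
Proof. by move=> tc st; apply: ge_inf (has_lbound_arctimes c s) _ _. Qed.

Lemma inf_arctimes_homo c s1 s2 : s1 <= s2 -> (s2%:E <= length c)%E ->
  inf (arctimes c s1) <= inf (arctimes c s2).
Proof.
move=> s12 s2c; apply: lb_le_inf; first by exists (hi c); exact: arctimes_hi.
move=> t [/= tc s2t]; apply: inf_arctimes_le => //.
by rewrite (le_trans _ s2t)// lee_fin.
Qed.

Lemma fine_length_ge s c : rectifiable c -> s <= fine (length c) ->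
  (s%:E <= length c)%E.
Proof.
move=> rc sc; have fc : length c \is a fin_num.
  exact: arclength_fin rc (lo_le_hi c) (lexx _).
by rewrite -(fineK fc) lee_fin.
Qed.

Lemma fine_length_ge0 c : 0 <= fine (length c).
Proof. by apply: fine_ge0; apply: length_on_ge0; exact: lo_le_hi. Qed.

Definition clamp (a b t : R) : R := Num.min (Num.max a t) b.

Lemma clamp_itv a b t : a <= b -> a <= clamp a b t <= b.
Proof.
by move=> ab; rewrite /clamp; case: (leP a t) => ?;
  [case: (leP t b)|case: (leP a b)] => ?; apply/andP; split; lra.
Qed.

Lemma clamp_id a b t : a <= t <= b -> clamp a b t = t.
Proof. by move=> /andP[? ?]; rewrite /clamp max_r// min_l. Qed.

Lemma clamp_homo a b t u : t <= u -> clamp a b t <= clamp a b u.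
Proof.
move=> tu; rewrite /clamp.
by case: (leP a t) => ?; case: (leP a u) => ?; case: (leP t b) => ?;
  case: (leP u b) => ?; case: (leP a b) => ?; lra.
Qed.

Lemma clamp_dist a b t u : a <= b -> `|clamp a b t - clamp a b u| <= `|t - u|.
Proof.
move=> ab; wlog tu : t u / t <= u.
  move=> H; case: (leP t u) => [/H//|/ltW/H]; by rewrite distrC (distrC u).
rewrite !ler0_norm ?subr_le0 ?clamp_homo// /clamp.
by case: (leP a t) => ?; case: (leP a u) => ?; case: (leP t b) => ?;
  case: (leP u b) => ?; case: (leP a b) => ?; lra.
Qed.

Lemma clamp_continuous a b : a <= b -> continuous (clamp a b).
Proof.
move=> ab t; apply/cvgrPdist_le => e e0; near=> u.
apply: le_trans (clamp_dist _ _ ab) _.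
by near: u; apply: cvgr_dist_le.
Unshelve. all: by end_near. Qed.

Definition extend_curve c t := c (clamp (lo c) (hi c) t).

Lemma extend_curveE c t : lo c <= t <= hi c -> extend_curve c t = c t.
Proof. by move=> tc; rewrite /extend_curve clamp_id. Qed.

Lemma extend_curve_continuous c : continuous (extend_curve c).
Proof.
have := @curve_continuous _ _ c => /subspace_continuousP cc t.
have ic : `[lo c, hi c]%classic (clamp (lo c) (hi c) t).
  by rewrite /= in_itv/= clamp_itv// lo_le_hi.
apply: cvg_comp (cc _ ic) => P /= BP.
have tP : nbhs t (clamp (lo c) (hi c) @^-1` [set v | `[lo c, hi c]%classic v -> P v]).
  exact: clamp_continuous (lo_le_hi c) _ _ BP.
change (nbhs t [set u | P (clamp (lo c) (hi c) u)]).
apply: filterS tP => u /=; apply.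
by rewrite in_itv/= clamp_itv// lo_le_hi.
Qed.

Lemma measurable_continuous_rV (f : R -> 'rV[R]_n) :
  continuous f -> measurable_fun setT f.
Proof.
move=> cf; apply: (@measurability _ _ _ _ _ _ (@open 'rV[R]_n)) => //.
move=> _ [U oU <-]; rewrite setTI; apply: open_measurable.
by apply: open_comp => // x _; exact: cf.
Qed.

(** The time at which a given arclength is first reached is monotone in that
    arclength, hence Borel. Clamping both the arclength and the time gives a
    Borel map on the whole line that agrees with the arclength
    parametrization on its domain, so that Tonelli's theorem applies to line
    integrals. *)
Definition arclength_path c s : 'rV[R]_n :=
  extend_curve c (inf (arctimes c (clamp 0 (fine (length c)) s))).

Lemma arclength_pathE c s : rectifiable c -> 0 <= s <= fine (length c) ->
  arclength_path c s = arclength_param c s.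
Proof.
move=> rc sc; rewrite /arclength_path clamp_id// extend_curveE//.
by apply: inf_arctimes_itv; apply: fine_length_ge => //; case/andP: sc.
Qed.

Lemma measurable_arclength_path c : rectifiable c ->
  measurable_fun setT (arclength_path c).
Proof.
move=> rc.
rewrite (_ : arclength_path c = extend_curve c \o
  (fun s => inf (arctimes c (clamp 0 (fine (length c)) s))))//.
apply: measurableT_comp.
  by apply: measurable_continuous_rV; exact: extend_curve_continuous.
apply: nondecreasing_measurable => // s1 s2 s12.
apply: inf_arctimes_homo; first exact: clamp_homo.
apply: fine_length_ge => //.
by have /andP[] := clamp_itv s2 (fine_length_ge0 c).
Qed.

Lemma line_integralE (rho : 'rV[R]_n -> \bar R) c : rectifiable c ->
  line_integral rho c =
  (\int[lebesgue_measure]_(s in `[0%R, fine (length c)]) rho (arclength_path c s))%E.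
Proof.
move=> rc; apply: eq_integral => s; rewrite inE/= in_itv/= => sc.
by rewrite arclength_pathE.
Qed.

End arclength.

Section subpath.
Context {R : realType} {n : nat}.
Variables (c d : curve R n) (h : R).
Hypotheses (rc : rectifiable c) (hlo : lo c <= lo d + h) (hhi : hi d + h <= hi c).
Hypothesis dc : forall t, lo d <= t <= hi d -> d t = c (t + h).

Let ld : lo d <= hi d := lo_le_hi d.
Let hlo' : lo c <= hi d + h. Proof. by rewrite (le_trans hlo)// lerD2r. Qed.
Let hhi' : lo d + h <= hi c. Proof. by rewrite (le_trans _ hhi)// lerD2r. Qed.
Let S0 := fine (arclength c (lo d + h)).

Lemma subpath_arclength t : lo d <= t <= hi d ->
  (arclength c (t + h) = S0%:E + arclength d t)%E.
Proof.
move=> /andP[t1 t2]; rewrite fineK; last first.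
  exact: arclength_fin.
rewrite /arclength (@length_on_add _ _ _ _ (lo d + h)) ?lerD2r//.
congr (_ + _)%E; rewrite -length_on_shift; apply: eq_length_on => u.
by rewrite in_itv/= => /andP[? ?]; rewrite -dc//; apply/andP; split; lra.
Qed.

Lemma subpath_rectifiable : rectifiable d.
Proof.
have hd : lo d <= hi d <= hi d by rewrite ld lexx.
have := subpath_arclength hd.
have : arclength c (hi d + h) \is a fin_num.
  exact: arclength_fin.
rewrite /rectifiable /length -/(arclength d (hi d)).
by case: (arclength d (hi d)) => [r _ _|/[swap] ->|_ _]; rewrite ?ltry// ltNyr.
Qed.

Lemma subpath_length :
  fine (arclength c (hi d + h)) = S0 + fine (length d).
Proof.
have hd : lo d <= hi d <= hi d by rewrite ld lexx.
rewrite subpath_arclength// fineD//.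
exact: (arclength_fin subpath_rectifiable ld (lexx _)).
Qed.

(** First times along the subpath are first times along [c], shifted. At [s = 0]
    they can differ, when [c] is stationary just before the subpath starts;
    hence the half-open interval here and in [line_integral_subpath]. *)
Lemma subpath_param s : 0 < s <= fine (length d) ->
  arclength_param d s = arclength_param c (s + S0).
Proof.
move=> /andP[s0 sl]; have sd := fine_length_ge subpath_rectifiable sl.
have S0E : S0%:E = arclength c (lo d + h).
  by rewrite fineK//; exact: arclength_fin.
have sc : ((s + S0)%:E <= length c)%E.
  apply: fine_length_ge => //; apply: (@le_trans _ _ (fine (arclength c (hi d + h)))).
    by rewrite subpath_length addrC lerD2l.
  apply: fine_le; [exact: arclength_fin|exact: arclength_fin (lo_le_hi c) _|].
  exact: arclength_homo.
rewrite !arclength_paramE dc; last exact: inf_arctimes_itv.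
congr (c _); apply/esym/le_anti/andP; split.
  rewrite -lerBlDr; apply: lb_le_inf; first by exists (hi d); exact: arctimes_hi.
  move=> t [/=]; rewrite in_itv/= => td st; rewrite lerBlDr.
  apply: inf_arctimes_le; first case/andP: td => t1 t2.
    by rewrite (le_trans hlo) ?lerD2r// (le_trans _ hhi)// lerD2r.
  by rewrite subpath_arclength// EFinD addeC leeD2l.
apply: lb_le_inf; first by exists (hi c); exact: arctimes_hi.
move=> t [/=]; rewrite in_itv/= => /andP[t1 t2] st.
have lt : lo d + h < t.
  rewrite ltNge; apply/negP => tl; have := le_trans st (arclength_homo t1 tl).
  by rewrite -S0E lee_fin; lra.
rewrite -lerBrDr; have [td|dt] := leP t (hi d + h).
  have td' : lo d <= t - h <= hi d by apply/andP; split; lra.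
  apply: inf_arctimes_le => //.
  have := st; rewrite -{1}(subrK h t) subpath_arclength// addrC EFinD.
  by rewrite leeD2lE.
have /andP[_] := inf_arctimes_itv sd; lra.
Qed.

Lemma line_integral_subpath (rho : 'rV[R]_n -> \bar R) :
  measurable_fun setT rho -> (forall x, 0 <= rho x)%E ->
  line_integral rho d = (\int[lebesgue_measure]_(s in
    `]S0, fine (arclength c (hi d + h))]) rho (arclength_path c s))%E.
Proof.
move=> mrho rho0.
have mc : measurable_fun setT (fun s => rho (arclength_path c s)).
  exact: measurableT_comp (measurable_arclength_path rc).
have md : measurable_fun setT (fun s => rho (arclength_path d s)).
  exact: measurableT_comp (measurable_arclength_path subpath_rectifiable).
rewrite line_integralE; last exact: subpath_rectifiable.
rewrite -integral_itv_obnd_cbnd; last exact: measurable_funTS.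
rewrite [RHS]integral_mkcond subpath_length.
set g := (_ \_ _).
have mg : measurable_fun setT g.
  by apply/(measurable_restrictT _ (measurable_itv _)); exact: measurable_funTS.
have g0 x : (0 <= g x)%E by apply: erestrict_ge0.
have := integral_affine S0 (oner_neq0 R) mg g0.
rewrite normr1 invr1 mul1e => <-.
rewrite integral_mkcond; apply: eq_integral => s _.
rewrite /g !patchE !mem_setE !in_itv/= mul1r ltrDr addrC lerD2l.
case: ifPn => // /andP[s0 sl].
rewrite arclength_pathE ?subpath_rectifiable ?(ltW s0)//.
rewrite subpath_param ?s0// addrC arclength_pathE// addr_ge0 ?(ltW s0)//=.
  rewrite (@le_trans _ _ (fine (arclength c (hi d + h))))//.
    by rewrite subpath_length addrC lerD2l.
  apply: fine_le; [exact: arclength_fin|exact: arclength_fin (lo_le_hi c) _|].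
  exact: arclength_homo.
by apply: fine_ge0; exact: arclength_ge0.
Qed.

End subpath.

(** * Line integrals along translates, concatenations and subcurves *)

Section curve_operations.
Context {R : realType} {n : nat}.
Implicit Types (c d e : curve R n) (rho : 'rV[R]_n -> \bar R) (x w : 'rV[R]_n).

Lemma trace_lo c : trace c (c (lo c)).
Proof. by exists (lo c) => //=; rewrite in_itv/= lexx lo_le_hi. Qed.

Lemma trace_hi c : trace c (c (hi c)).
Proof. by exists (hi c) => //=; rewrite in_itv/= lexx lo_le_hi. Qed.

Lemma arclength_path_trace c s : trace c (arclength_path c s).
Proof.
exists (clamp (lo c) (hi c) (inf (arctimes c (clamp 0 (fine (length c)) s)))) => //.
by rewrite /= in_itv/= clamp_itv// lo_le_hi.
Qed.

Lemma translateE c x t : lo c <= t <= hi c -> translate c x t = c t + x.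
Proof. by move=> tc; rewrite mk_curveE// in_itv. Qed.

Lemma arclength_translate c x t : t <= hi c ->
  arclength (translate c x) t = arclength c t.
Proof.
move=> tc; rewrite /arclength.
rewrite (@eq_length_on _ _ _ (fun t => c t + x)); last first.
  move=> u ut; have /andP[u1 u2] : lo c <= u <= t by move: ut; rewrite in_itv.
  by rewrite translateE// u1 (le_trans u2).
rewrite !length_onE; congr ereal_sup.
suff H s a : polyline (fun t => c t + x) a s = polyline c a s.
  by apply/seteqP; split=> _ [s ps <-]; exists s => //; rewrite H.
by elim: s a => //= y s IH a; rewrite IH opprD addrACA subrr addr0.
Qed.

Lemma length_translate c x : length (translate c x) = length c.
Proof. exact: (arclength_translate _ (lexx _)). Qed.

Lemma rectifiable_translate c x : rectifiable c -> rectifiable (translate c x).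
Proof. by rewrite /rectifiable length_translate. Qed.

Lemma line_integral_translate rho c x : rectifiable c ->
  line_integral rho (translate c x) =
  (\int[lebesgue_measure]_(s in `[0%R, fine (length c)])
    rho (arclength_path c s + x)%R)%E.
Proof.
move=> rc; rewrite /line_integral length_translate.
apply: eq_integral => s sc'.
have sc : 0 <= s <= fine (length c) by move: sc'; rewrite inE/= in_itv.
rewrite arclength_pathE// !arclength_paramE.
have -> : arctimes (translate c x) s = arctimes c s.
  apply/seteqP; split=> t [tc st]; split=> //; move: tc st;
    by rewrite in_itv/= => /andP[_ tc]; rewrite arclength_translate.
rewrite translateE//; apply: inf_arctimes_itv; apply: fine_length_ge => //.
by case/andP: sc.
Qed.

Lemma concatE1 c d (cd : c (hi c) = d (lo d)) t : lo c <= t <= hi c ->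
  concat cd t = c t.
Proof.
move=> /andP[t1 t2]; rewrite mk_curveE ?t2// in_itv/= t1 (le_trans t2)//.
by rewrite lerDl subr_ge0 lo_le_hi.
Qed.

Lemma concatE2 c d (cd : c (hi c) = d (lo d)) t : lo d <= t <= hi d ->
  concat cd (t + (hi c - lo d)) = d t.
Proof.
move=> /andP[t1 t2]; rewrite mk_curveE; last first.
  have := lo_le_hi c; rewrite in_itv/= => ?.
  by clear cd; apply/andP; split; lra.
case: ifPn => [t3|_]; last by congr (_ _); ring.
have -> : t = lo d by clear cd; lra.
by rewrite -cd; congr (_ _); ring.
Qed.

Lemma length_concat c d (cd : c (hi c) = d (lo d)) :
  length (concat cd) = (length c + length d)%E.
Proof.
have ld := lo_le_hi d.
rewrite /length (@length_on_add _ _ _ _ (hi c)) ; last 2 first.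
- exact: lo_le_hi c.
- by rewrite /= lerDl subr_ge0.
congr (_ + _)%E.
  by apply: eq_length_on => t tc; apply: concatE1; move: tc; rewrite in_itv.
transitivity (length_on (fun t => concat cd (t + (hi c - lo d))) (lo d) (hi d)).
  by rewrite length_on_shift; congr length_on => /=; ring.
by apply: eq_length_on => t tc; apply: concatE2; move: tc; rewrite in_itv.
Qed.

Lemma rectifiable_concat c d (cd : c (hi c) = d (lo d)) :
  rectifiable c -> rectifiable d -> rectifiable (concat cd).
Proof. by move=> rc rd; rewrite /rectifiable length_concat lte_add_pinfty. Qed.

Lemma ge0_integral_itv_cat (f : R -> \bar R) (a b c : R) : a <= b -> b <= c ->
  measurable_fun setT f -> (forall s, 0 <= f s)%E ->
  (\int[lebesgue_measure]_(s in `]a, c]) f s =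
   \int[lebesgue_measure]_(s in `]a, b]) f s +
   \int[lebesgue_measure]_(s in `]b, c]) f s)%E.
Proof.
move=> ab bc mf f0; rewrite -(ge0_integral_setU lebesgue_measure)//.
- by rewrite -itv_bndbnd_setU.
- exact: measurable_funTS.
- apply/disj_setPS => x [/=]; rewrite !in_itv/= => /andP[_ xb] /andP[bx _].
  by move: bx; rewrite ltNge xb.
Qed.

Lemma line_integral_concat rho c d (cd : c (hi c) = d (lo d)) :
  measurable_fun setT rho -> (forall x, 0 <= rho x)%E ->
  rectifiable c -> rectifiable d ->
  line_integral rho (concat cd) = (line_integral rho c + line_integral rho d)%E.
Proof.
move=> mrho rho0 rc rd; have re := rectifiable_concat cd rc rd.
set e := concat cd.
have ld := lo_le_hi d; have lc := lo_le_hi c.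
have e1 : hi e = hi d + (hi c - lo d) by rewrite /=; ring.
have e2 : hi c = lo d + (hi c - lo d) by ring.
have h1 : hi c <= hi e by rewrite /= lerDl subr_ge0.
have mf : measurable_fun setT (fun s => rho (arclength_path e s)).
  exact: measurableT_comp (measurable_arclength_path re).
rewrite (@line_integral_subpath _ _ e c 0 re)//; [|by rewrite addr0..|]; last first.
  by move=> t tc; rewrite addr0 concatE1.
rewrite (@line_integral_subpath _ _ e d (hi c - lo d) re)//; first last.
- by move=> t td; rewrite concatE2.
- by rewrite -e1.
- by rewrite -e2.
rewrite -e2 -e1 !addr0 -ge0_integral_itv_cat//; first last.
- apply: fine_le; [exact: arclength_fin|exact: arclength_fin re (lo_le_hi e) _|].
  exact: arclength_homo.
- apply: fine_le; [exact: arclength_fin re _ (lo_le_hi e)|exact: arclength_fin|].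
  exact: arclength_homo.
rewrite line_integralE// -integral_itv_obnd_cbnd; last exact: measurable_funTS.
have a0 : arclength e (lo c) = 0%E by exact: length_on_point.
by rewrite a0.
Qed.

Section unit_speed.
Variables (e : curve R n) (x w : 'rV[R]_n).
Hypotheses (e0 : lo e = 0) (w1 : enorm w = 1).
Hypothesis eE : forall t, 0 <= t <= hi e -> e t = x + t *: w.

Lemma arclength_unit_speed t : 0 <= t <= hi e -> arclength e t = t%:E.
Proof.
move=> /andP[t0 te]; rewrite /arclength e0 length_on_arc ?subr0//.
move=> u v u0 uv vt; rewrite !eE ?u0 ?(le_trans u0)// ?(le_trans vt)//; last first.
  by rewrite (le_trans uv)// (le_trans vt).
by rewrite opprD addrACA subrr add0r -scalerBl enormZ w1 mulr1 ger0_norm// subr_ge0.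
Qed.

Let hi0 : 0 <= hi e. Proof. by rewrite -e0 lo_le_hi. Qed.

Lemma length_unit_speed : length e = (hi e)%:E.
Proof. by apply: arclength_unit_speed; rewrite hi0 lexx. Qed.

Lemma rectifiable_unit_speed : rectifiable e.
Proof. by rewrite /rectifiable length_unit_speed ltry. Qed.

Lemma line_integral_unit_speed rho : line_integral rho e =
  (\int[lebesgue_measure]_(s in `[0%R, hi e]) rho (x + s *: w)%R)%E.
Proof.
rewrite /line_integral length_unit_speed/=.
apply: eq_integral => s; rewrite inE/= in_itv/= => sh.
rewrite arclength_paramE eE; last first.
  by rewrite -e0; apply: inf_arctimes_itv; rewrite length_unit_speed lee_fin; case/andP: sh.
congr (rho (_ + _ *: _)%R); apply/le_anti/andP; split.
  by apply: inf_arctimes_le; rewrite ?e0// arclength_unit_speed.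
apply: lb_le_inf; first by exists (hi e); apply: arctimes_hi; rewrite length_unit_speed lee_fin; case/andP: sh.
by move=> t [/=]; rewrite in_itv/= e0 => te; rewrite arclength_unit_speed// lee_fin.
Qed.

End unit_speed.

Lemma subcurve_continuous c a b : lo c <= a -> b <= hi c ->
  {within `[a, b], continuous c}.
Proof.
move=> ca bc; apply: continuous_subspaceW (@curve_continuous _ _ c).
by move=> t /=; rewrite !in_itv/= => /andP[? ?]; apply/andP; split; lra.
Qed.

Definition subcurve c a b (ab : a <= b) (ca : lo c <= a) (bc : b <= hi c) :=
  mk_curve ab (subcurve_continuous ca bc).

Lemma subcurveE c a b (ab : a <= b) (ca : lo c <= a) (bc : b <= hi c) t :
  a <= t <= b -> subcurve ab ca bc t = c t.
Proof. by move=> tab; rewrite mk_curveE// in_itv. Qed.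

Lemma rectifiable_subcurve c a b (ab : a <= b) (ca : lo c <= a) (bc : b <= hi c) :
  rectifiable c -> rectifiable (subcurve ab ca bc).
Proof.
move=> rc; apply: (@subpath_rectifiable _ _ c _ 0 rc); rewrite ?addr0//.
by move=> t tab; rewrite subcurveE// addr0.
Qed.

Lemma line_integral_subcurve_le rho c a b (ab : a <= b) (ca : lo c <= a) (bc : b <= hi c) :
  measurable_fun setT rho -> (forall x, 0 <= rho x)%E -> rectifiable c ->
  (line_integral rho (subcurve ab ca bc) <= line_integral rho c)%E.
Proof.
move=> mrho rho0 rc.
have mf : measurable_fun setT (fun s => rho (arclength_path c s)).
  exact: measurableT_comp (measurable_arclength_path rc).
rewrite (@line_integral_subpath _ _ c _ 0 rc) ?addr0//; last first.
  by move=> t tab; rewrite subcurveE// addr0.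
have s0 : 0 <= fine (arclength c a) by apply: fine_ge0; exact: arclength_ge0.
have s1 : fine (arclength c b) <= fine (length c).
  apply: fine_le.
  - by apply: arclength_fin => //; rewrite (le_trans ca).
  - exact: arclength_fin rc (lo_le_hi c) _.
  - by apply: arclength_homo => //; rewrite (le_trans ca).
rewrite [leRHS](line_integralE rho rc).
move: (fine (arclength c a)) (fine (arclength c b)) (fine (length c)) s0 s1.
move=> u v l u0 vl; apply: ge0_subset_integral; [exact: measurable_itv|exact: measurable_itv| | |].
- exact: measurable_funTS.
- by [].
- by move=> s /=; rewrite !in_itv/= => /andP[s1 s2]; apply/andP; split; lra.
Qed.

(** A piece of curve is at least as long as its chord. *)
Lemma line_integral_ge rho c a b (M : R) :
  measurable_fun setT rho -> (forall x, 0 <= rho x)%E -> rectifiable c ->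
  lo c <= a -> a <= b -> b <= hi c -> 0 <= M ->
  (forall t, a <= t <= b -> (M%:E <= rho (c t))%E) ->
  ((M * enorm (c b - c a))%:E <= line_integral rho c)%E.
Proof.
move=> mrho rho0 rc ca ab bc M0 MP.
apply: le_trans (line_integral_subcurve_le ab ca bc mrho rho0 rc).
set d := subcurve ab ca bc.
have rd : rectifiable d by exact: rectifiable_subcurve.
have fd : length d \is a fin_num by exact: arclength_fin rd (lo_le_hi d) (lexx _).
rewrite line_integralE//.
apply: (@le_trans _ _ (\int[lebesgue_measure]_(s in `[0%R, fine (length d)]) (cst M%:E s))%E).
  rewrite integral_cst//= lebesgue_measure_itv/= lte_fin.
  have -> : (if 0 < fine (length d) then (fine (length d))%:E + (- 0)%:E
      else 0%E)%R = length d.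
    rewrite -[RHS]fineK// -EFinD oppr0 addr0; case: ltP => // d1; congr EFin.
    by apply/esym/le_anti; rewrite d1 fine_length_ge0.
  rewrite EFinM; apply: lee_wpmul2l; first by rewrite lee_fin.
  apply: le_trans (enorm_le_length d (lo_le_hi d)).
  by rewrite !subcurveE ?lexx ?ab.
apply: ge0_le_integral => //.
- by apply: measurable_funTS; exact: measurableT_comp (measurable_arclength_path rd).
- move=> s _; have [t td <-] := arclength_path_trace d s.
  have tab : a <= t <= b by move: td; rewrite /= in_itv.
  by rewrite (subcurveE ab ca bc tab); exact: MP.
Qed.

End curve_operations.

(** * Power inequalities on the extended half-line *)

Section ereal_powers.
Context {R : realType}.
Local Open Scope ereal_scope.
Implicit Types (x y : \bar R) (a b u v : R).

Lemma lee_expe x y m : 0 <= x -> x <= y -> x ^+ m <= y ^+ m.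
Proof.
move=> x0 xy; elim: m => // m IH; rewrite !expeS.
by apply: lee_pmul => //; exact: expe_ge0.
Qed.

Lemma exp0e m : (0 : \bar R) ^+ m.+1 = 0.
Proof. by rewrite expeS mul0e. Qed.

Lemma expye m : (+oo : \bar R) ^+ m.+1 = +oo.
Proof. by elim: m => [|m IH]; rewrite expeS ?IH ?mulyy// expe0 mule1. Qed.

Lemma expeM x y m : (x * y) ^+ m = x ^+ m * y ^+ m.
Proof. by elim: m => [|m IH]; rewrite ?mule1// !expeS IH muleACA. Qed.

Lemma gt0_mulEy (k : R) : (0 < k)%R -> k%:E * +oo = +oo :> \bar R.
Proof. by move=> k0; rewrite mulry gtr0_sg// mul1e. Qed.

Lemma ge0_addye x : 0 <= x -> +oo + x = +oo.
Proof. by case: x. Qed.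

Lemma ge0_addey x : 0 <= x -> x + +oo = +oo.
Proof. by case: x. Qed.

Definition rootn m x : \bar R := x `^ (m%:R^-1).

Lemma rootn_ge0 m x : 0 <= rootn m x.
Proof. exact: poweR_ge0. Qed.

Lemma rootnK m x : (0 < m)%N -> 0 <= x -> (rootn m x) ^+ m = x.
Proof.
move=> m0; rewrite /rootn; case: x => [r|_|]//; last first.
  by case: m m0 => // m _; rewrite poweRyr ?expye// invr_eq0 pnatr_eq0.
rewrite lee_fin poweR_EFin -EFin_expe => r0.
rewrite -powR_mulrn ?powR_ge0// -powRrM mulVf ?powRr1//.
by rewrite pnatr_eq0 -lt0n.
Qed.

Lemma le_rootn m x y : (0 < m)%N -> 0 <= x -> 0 <= y -> x ^+ m <= y -> x <= rootn m y.
Proof.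
move=> m0 x0 y0; rewrite -[in X in X -> _](rootnK m0 y0).
have := rootn_ge0 m y; move: (rootn m y) => z.
move: x0; case: x => [r||]//; case: z => [s||]//; rewrite ?leey//.
  rewrite !lee_fin => r0 s0; rewrite -!EFin_expe lee_fin.
  by rewrite ler_pXn2r.
by case: m m0 => // m _ _ _; rewrite expye -EFin_expe leye_eq.
Qed.

(** Induction on the exponent, starting from the parallelogram identity. *)
Lemma powerD_clarkson u v m : (0 <= v -> v <= u ->
  2 * (u ^+ m.+2 + v ^+ m.+2) <= (u + v) ^+ m.+2 + (u - v) ^+ m.+2)%R.
Proof.
move=> v0 vu; elim: m => [|m IH]; first by rewrite !expr2; nra.
rewrite !(exprS _ m.+2).
set A := ((u + v) ^+ m.+2)%R in IH *; set B := ((u - v) ^+ m.+2)%R in IH *.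
have AB : (B <= A)%R by rewrite lerXn2r ?nnegrE; lra.
set U := (u ^+ m.+2)%R in IH *; set V := (v ^+ m.+2)%R in IH *.
have V0 : (0 <= V)%R by exact: exprn_ge0.
nra.
Qed.

Lemma clarkson m x y : 0 <= x -> 0 <= y ->
  (2^-1%:E * (x + y)) ^+ m.+2 + (2^-1%:E * `|x - y|) ^+ m.+2 <=
  2^-1%:E * (x ^+ m.+2 + y ^+ m.+2).
Proof.
case: x => [a||]// x0; last first.
  by move=> y0; rewrite expye (ge0_addye (expe_ge0 _ y0)) [leRHS]gt0_mulEy ?leey.
case: y => [b||]// y0; last first.
  by rewrite expye (ge0_addey (expe_ge0 _ x0)) [leRHS]gt0_mulEy ?leey.
rewrite -EFinB abse_EFin -EFinD -!EFinM -!EFin_expe -!EFinD -EFinM.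
move: x0 y0; rewrite !lee_fin => a0 b0.
wlog ba : a b a0 b0 / (b <= a)%R.
  move=> H; case: (leP b a) => [|/ltW]; first exact: H.
  move=> ab; have := H _ _ b0 a0 ab.
  by rewrite (addrC b) (distrC b) (addrC (b ^+ _)%R).
rewrite ger0_norm ?subr_ge0//.
have := @powerD_clarkson (2^-1 * (a + b))%R (2^-1 * (a - b))%R m.
have -> : (2^-1 * (a + b) + 2^-1 * (a - b) = a)%R by field.
have -> : (2^-1 * (a + b) - 2^-1 * (a - b) = b)%R by field.
have h1 : (0 <= 2^-1 * (a - b))%R by lra.
have h2 : (2^-1 * (a - b) <= 2^-1 * (a + b))%R by lra.
by move=> /(_ h1 h2); lra.
Qed.

(** Convexity of the power function applied to the convex combination
    [(1 - l) * (a / (1 - l)) + l * (b / l)] of [a / (1 - l)] and [b / l]. A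
    weight [l] close to 0 keeps the coefficient of [a ^+ m.+1] close to 1. *)
Lemma power_convex (l a b : R) m : (0 < l < 1 -> 0 <= a -> 0 <= b ->
  (a + b) ^+ m.+1 <= (1 - l) ^- m * a ^+ m.+1 + l ^- m * b ^+ m.+1)%R.
Proof.
move=> /andP[l0 l1] a0 b0.
have k0 : (0 < 1 - l)%R by lra.
pose s := (a / (1 - l))%R; pose t := (b / l)%R.
have s0 : (0 <= s)%R by rewrite divr_ge0// ltW.
have t0 : (0 <= t)%R by rewrite divr_ge0// ltW.
have aE : (a = (1 - l) * s)%R by rewrite /s mulrC divfK// gt_eqF.
have bE : (b = l * t)%R by rewrite /t mulrC divfK// gt_eqF.
have H : ((a + b) ^+ m.+1 <= (1 - l) * s ^+ m.+1 + l * t ^+ m.+1)%R.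
  rewrite aE bE; elim: m => [|m IH]; first by rewrite !expr1.
  rewrite exprS.
  apply: (@le_trans _ _ (((1 - l) * s + l * t) * ((1 - l) * s ^+ m.+1 + l * t ^+ m.+1))%R).
    by rewrite ler_wpM2l// addr_ge0// mulr_ge0// ltW.
  rewrite !(exprS _ m.+1).
  set S := (s ^+ m.+1)%R; set T := (t ^+ m.+1)%R.
  have st : (0 <= (s - t) * (S - T))%R.
    case: (leP s t) => st.
      by rewrite mulr_le0// subr_le0// lerXn2r.
    by rewrite mulr_ge0// subr_ge0 ?(ltW st)// lerXn2r// ltW.
  have ll : (0 <= l * (1 - l))%R by rewrite mulr_ge0// ltW.
  have := mulr_ge0 ll st; lra.
apply: le_trans H _; rewrite le_eqVlt; apply/orP; left; apply/eqP.
rewrite [in RHS]aE [in RHS]bE !exprMn [((1 - l) ^+ m.+1)%R]exprSr.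
by rewrite [(l ^+ m.+1)%R]exprSr !mulrA !mulVf ?mul1r// expf_neq0// gt_eqF.
Qed.

Lemma power_convexe (l : R) x y m : (0 < l < 1)%R -> 0 <= x -> 0 <= y ->
  (x + y) ^+ m.+1 <=
  ((1 - l) ^- m)%:E * x ^+ m.+1 + (l ^- m)%:E * y ^+ m.+1.
Proof.
move=> l01; have [l0 l1] := andP l01.
have k0 : (0 < (1 - l) ^- m)%R by rewrite invr_gt0 exprn_gt0// subr_gt0.
have h0 : (0 < l ^- m)%R by rewrite invr_gt0 exprn_gt0.
case: x => [a||]// x0; last first.
  move=> y0; rewrite expye gt0_mulEy// [leRHS]ge0_addye ?leey//.
  by rewrite mule_ge0 ?expe_ge0// lee_fin ltW.
case: y => [b||]// y0; last first.
  rewrite expye gt0_mulEy// [leRHS]ge0_addey ?leey//.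
  by rewrite mule_ge0 ?expe_ge0// lee_fin ltW.
rewrite -EFinD -!EFin_expe -!EFinM -EFinD lee_fin; exact: power_convex.
Qed.

(** Obtained from [power_convex] by splitting off one term after another with
    weight 1/2. The coefficients grow geometrically, which is harmless for
    terms that decay fast enough. *)
Lemma power_sum_le (t : nat -> \bar R) m k i : (forall j, 0 <= t j) ->
  (\sum_(i <= j < i + k) t j) ^+ m.+1 <=
  \sum_(i <= j < i + k) (2 ^+ (m * (j - i).+1))%:E * t j ^+ m.+1.
Proof.
move=> t0; elim: k i => [|k IH] i.
  by rewrite addn0 !big_geq// exp0e.
have ik : (i < i + k.+1)%N by rewrite addnS ltnS leq_addr.
rewrite (big_ltn ik) (big_ltn ik) -addSnnS.
have S0 : 0 <= \sum_(i.+1 <= j < i.+1 + k) t j by apply: sume_ge0.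
have half : (0 < (2^-1 : R) < 1)%R by apply/andP; split; lra.
apply: le_trans (power_convexe m half (t0 i) S0) _.
have e2 : (1 - 2^-1 = 2^-1 :> R)%R by field.
rewrite e2 subnn muln1 exprVn invrK; apply: leeD2l.
apply: (@le_trans _ _ ((2 ^+ m)%:E * \sum_(i.+1 <= j < i.+1 + k)
    (2 ^+ (m * (j - i.+1).+1))%:E * t j ^+ m.+1)).
  by apply: lee_wpmul2l; [rewrite lee_fin exprn_ge0|exact: IH].
rewrite ge0_sume_distrr; last first.
  by move=> j _; rewrite mule_ge0// ?expe_ge0// lee_fin exprn_ge0.
rewrite le_eqVlt; apply/orP; left; apply/eqP.
apply: eq_big_nat => j /andP[ij _]; rewrite muleA -EFinM -exprD -mulnS.
by rewrite -subSn// subSS.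
Qed.

End ereal_powers.

(** * Modulus and energy *)

Section modulus.
Context {R : realType} {n : nat}.
Local Open Scope ereal_scope.
Implicit Types (G H : set (curve R n)) (rho : 'rV[R]_n -> \bar R).

Definition energy rho : \bar R := \int[@lebesgue_rV R n]_x (rho x ^+ n).

Lemma modulus_le_energy G rho : admissible G rho -> modulus G <= energy rho.
Proof. by move=> Gr; apply: ereal_inf_lbound; exists rho. Qed.

Lemma modulus_ge0 G : 0 <= modulus G.
Proof.
apply: le_ereal_inf_tmp => _ [rho [_ rho0 _] <-].
by apply: integral_ge0 => x _; exact: expe_ge0.
Qed.

Lemma admissible_sub G H rho : G `<=` H -> admissible H rho -> admissible G rho.
Proof. by move=> GH [mr r0 Hr]; split=> // c Gc; apply: Hr; exact: GH. Qed.

Lemma modulus_sub G H : G `<=` H -> modulus G <= modulus H.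
Proof.
move=> GH; apply: le_ereal_inf => _ [rho Hr <-].
by exists rho => //; exact: admissible_sub GH Hr.
Qed.

Lemma modulus_lt G (M : R) : modulus G < M%:E ->
  exists2 rho, admissible G rho & energy rho < M%:E.
Proof. by move=> /ereal_inf_lt[_ [rho Gr <-] rM]; exists rho. Qed.

Lemma line_integral_le rho1 rho2 c : rectifiable c ->
  measurable_fun setT rho1 -> measurable_fun setT rho2 ->
  (forall x, 0 <= rho1 x) -> (forall x, rho1 x <= rho2 x) ->
  line_integral rho1 c <= line_integral rho2 c.
Proof.
move=> rc m1 m2 r0 r12; rewrite [leLHS]line_integralE// [leRHS]line_integralE//.
by apply: ge0_le_integral => //; apply: measurable_funTS;
  exact: measurableT_comp (measurable_arclength_path rc).
Qed.

Lemma line_integralD rho1 rho2 c : rectifiable c ->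
  measurable_fun setT rho1 -> measurable_fun setT rho2 ->
  (forall x, 0 <= rho1 x) -> (forall x, 0 <= rho2 x) ->
  line_integral (fun x => rho1 x + rho2 x) c = line_integral rho1 c + line_integral rho2 c.
Proof.
move=> rc m1 m2 r1 r2; rewrite [LHS]line_integralE// [X in _ = X + _]line_integralE//.
rewrite [X in _ = _ + X]line_integralE//.
by rewrite ge0_integralD//; apply: measurable_funTS;
  exact: measurableT_comp (measurable_arclength_path rc).
Qed.

Lemma line_integralZl (k : R) rho c : rectifiable c -> (0 <= k)%R ->
  measurable_fun setT rho -> (forall x, 0 <= rho x) ->
  line_integral (fun x => k%:E * rho x) c = k%:E * line_integral rho c.
Proof.
move=> rc k0 mr r0; rewrite [LHS]line_integralE// [X in _ = _ * X]line_integralE//.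
rewrite ge0_integralZl_EFin//; apply: measurable_funTS.
exact: measurableT_comp (measurable_arclength_path rc).
Qed.

Lemma admissible_mean G H rho1 rho2 : admissible G rho1 -> admissible H rho2 ->
  admissible (G `&` H) (fun x => 2^-1%:E * (rho1 x + rho2 x)).
Proof.
move=> [m1 r1 G1] [m2 r2 G2]; split.
- by apply: emeasurable_funM => //; exact: emeasurable_funD.
- by move=> x; rewrite mule_ge0 ?adde_ge0// lee_fin.
move=> c [Gc Hc] rc; rewrite line_integralZl//; last first.
- by move=> x; rewrite adde_ge0.
- exact: emeasurable_funD.
rewrite line_integralD//.
apply: (@le_trans _ _ (2^-1%:E * (1 + 1))).
  by rewrite -EFinD -EFinM lee_fin; lra.
by apply: lee_wpmul2l; [rewrite lee_fin|apply: leeD; [exact: G1|exact: G2]].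
Qed.

Lemma measurable_absB rho1 rho2 : measurable_fun setT rho1 ->
  measurable_fun setT rho2 -> measurable_fun setT (fun x => `|rho1 x - rho2 x|).
Proof.
by move=> m1 m2; apply: measurableT_comp => //; exact: emeasurable_funB.
Qed.

Lemma energyZl (k : R) rho : (0 <= k)%R -> measurable_fun setT rho ->
  (forall x, 0 <= rho x) -> energy (fun x => k%:E * rho x) = (k ^+ n)%:E * energy rho.
Proof.
move=> k0 mr r0; rewrite /energy.
under eq_integral do rewrite expeM -EFin_expe.
rewrite ge0_integralZl_EFin ?exprn_ge0//.
- by move=> x _; exact: expe_ge0.
- exact: measurable_funXe.
Qed.

(** Uniform convexity: two densities whose mean has almost the same energy as
    each of them are close to each other in L^n. *)
Lemma energy_clarkson rho1 rho2 : (2 <= n)%N ->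
  measurable_fun setT rho1 -> measurable_fun setT rho2 ->
  (forall x, 0 <= rho1 x) -> (forall x, 0 <= rho2 x) ->
  energy (fun x => 2^-1%:E * (rho1 x + rho2 x)) +
  energy (fun x => 2^-1%:E * `|rho1 x - rho2 x|) <=
  2^-1%:E * (energy rho1 + energy rho2).
Proof.
move=> n2 m1 m2 r1 r2; rewrite /energy.
have mX f : measurable_fun setT f ->
    measurable_fun setT (fun x : 'rV[R]_n => f x ^+ n :> \bar R).
  exact: measurable_funXe.
have mh1 : measurable_fun setT (fun x => 2^-1%:E * (rho1 x + rho2 x)).
  by apply: emeasurable_funM => //; exact: emeasurable_funD.
have mh2 : measurable_fun setT (fun x => 2^-1%:E * `|rho1 x - rho2 x|).
  by apply: emeasurable_funM => //; exact: measurable_absB.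
have h10 x : 0 <= 2^-1%:E * (rho1 x + rho2 x) by rewrite mule_ge0 ?adde_ge0// lee_fin.
have h20 x : 0 <= 2^-1%:E * `|rho1 x - rho2 x| by rewrite mule_ge0// lee_fin.
rewrite -ge0_integralD//; [|by move=> x _; exact: expe_ge0|exact: mX|
  by move=> x _; exact: expe_ge0|exact: mX].
rewrite -ge0_integralD//; [|by move=> x _; exact: expe_ge0|exact: mX|
  by move=> x _; exact: expe_ge0|exact: mX].
rewrite -ge0_integralZl_EFin//; last first.
- by apply: emeasurable_funD; exact: mX.
- by move=> x _; rewrite adde_ge0// expe_ge0.
apply: ge0_le_integral => //.
- by move=> x _; rewrite adde_ge0// expe_ge0.
- by apply: emeasurable_funD; exact: mX.
- by apply: emeasurable_funM => //; apply: emeasurable_funD; exact: mX.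
- by move=> x _; case: (n) n2 => [|[|m]]// _; exact: clarkson.
Qed.

End modulus.

(** * Modulus of an increasing union of families *)

Section exhaustion.
Context {R : realType} {n : nat}.
Local Open Scope ereal_scope.

Lemma sum_geometric_le (e : R) (a : nat -> \bar R) : (0 <= e)%R ->
  (forall k, a k <= (e / 2 ^+ k.+1)%:E) -> (forall k, 0 <= a k) ->
  \sum_(k <oo) a k <= e%:E.
Proof.
move=> e0 ae a0.
apply: (@le_trans _ _ (\sum_(k <oo) (0 + (e / (2 ^ k.+1)%:R)%:E))).
  by apply: lee_nneseries => k _; rewrite ?a0// add0e natrX; exact: ae.
apply: le_trans (epsilon_trick xpredT _ e0) _ => //.
by rewrite eseries0// add0e.
Qed.

Variables (G : nat -> set (curve R n)) (M : R).
Hypothesis n2 : (2 <= n)%N.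
Hypothesis Ginc : forall i j, (i <= j)%N -> G i `<=` G j.
Hypothesis GM : forall i, modulus (G i) <= M%:E.

(** Let the moduli approach their supremum along the indices [j k], and choose
    [f k] almost extremal. The mean of [f k] and [f k.+1] is admissible for
    the smaller of the two families, so its energy is almost that supremum,
    and Clarkson's inequality bounds the distance of [f k] to [f k.+1]. *)
Lemma almost_extremal_sequence (eps : nat -> R) : (forall k, 0 < eps k)%R ->
  (forall k, eps k.+1 <= eps k)%R ->
  exists (j : nat -> nat) (f : nat -> 'rV[R]_n -> \bar R),
  [/\ forall k, (k <= j k <= j k.+1)%N, forall k, admissible (G (j k)) (f k),
      forall k, energy (f k) <= M%:E + (eps k)%:E &
      forall k, energy (fun x => 2^-1%:E * `|f k x - f k.+1 x|)
        <= (2 * eps k)%:E].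
Proof.
move=> eps0 eps_dec.
pose s := ereal_sup [set modulus (G i) | i in [set: nat]].
have sM : s <= M%:E by apply: ge_ereal_sup => _ [i _ <-].
have s0 : 0 <= s.
  by apply: le_trans (modulus_ge0 (G 0)) _; apply: ereal_sup_ubound; exists 0%N.
have sfin : s \is a fin_num by rewrite ge0_fin_numE// (le_lt_trans sM)// ltry.
have si k : exists i, s - (eps k)%:E < modulus (G i).
  have : s - (eps k)%:E < s by rewrite lte_subel_addl// lteDr// lte_fin.
  by move=> /ereal_sup_gt[_ [i _ <-] ?]; exists i.
have [i iP] := choice si.
pose j k := (k + \sum_(l < k.+1) i l)%N.
have jk k : (k <= j k <= j k.+1)%N.
  apply/andP; split; first exact: leq_addr.
  by rewrite /j [X in (_ <= _ + X)%N]big_ord_recr/= leq_add// leq_addr.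
have jP k : s - (eps k)%:E < modulus (G (j k)).
  apply: lt_le_trans (iP k) _; apply: modulus_sub; apply: Ginc.
  by rewrite /j big_ord_recr/= addnA leq_addl.
have js k : modulus (G (j k)) <= s by apply: ereal_sup_ubound; exists (j k).
have fk k : exists f, admissible (G (j k)) f /\ energy f < s + (eps k)%:E.
  have : modulus (G (j k)) < (fine s + eps k)%:E.
    by rewrite EFinD fineK//; apply: (le_lt_trans (js k)); rewrite lteDl// lte_fin.
  by move=> /modulus_lt[f fa fe]; exists f; rewrite -(fineK sfin) -EFinD.
have [f fP] := choice fk.
exists j, f; split => //.
- by move=> k; have [] := fP k.
- by move=> k; have [_ /ltW/le_trans] := fP k; apply; rewrite leeD2r.
move=> k; have [[m1 r1 a1] e1] := fP k; have [[m2 r2 a2] e2] := fP k.+1.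
have jkk : G (j k) `<=` G (j k.+1) by apply: Ginc; case/andP: (jk k).
have adm : admissible (G (j k)) (fun x => 2^-1%:E * (f k x + f k.+1 x)).
  apply: (admissible_sub (H := G (j k) `&` G (j k.+1))).
    by move=> c Gc; split => //; exact: jkk.
  by apply: admissible_mean; split.
have := energy_clarkson n2 m1 m2 r1 r2.
have /le_trans/(_ (modulus_le_energy adm)) := ltW (jP k).
have h0 : 0 <= energy (fun x => 2^-1%:E * `|f k x - f k.+1 x|).
  by apply: integral_ge0 => x _; rewrite expe_ge0// mule_ge0// lee_fin.
have h1 : 0 <= energy (fun x => 2^-1%:E * (f k x + f k.+1 x)).
  by apply: integral_ge0 => x _; rewrite expe_ge0// mule_ge0 ?lee_fin// adde_ge0.
have h2 : 0 <= energy (f k) by apply: integral_ge0 => x _; rewrite expe_ge0.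
have h3 : 0 <= energy (f k.+1) by apply: integral_ge0 => x _; rewrite expe_ge0.
move: h0 h1 h2 h3 e1 e2; rewrite -(fineK sfin).
move: (energy (fun x => 2^-1%:E * `|f k x - f k.+1 x|))
  (energy (fun x => 2^-1%:E * (f k x + f k.+1 x))) (energy (f k)) (energy (f k.+1)).
move=> [A||]// [B||]// [C||]// [D||]//; rewrite -?EFinD -?EFinB -?EFinM ?lee_fin ?lte_fin//.
by have := eps0 k; have := eps0 k.+1; have := eps_dec k; lra.
Qed.

Lemma telescope_abs (f : nat -> \bar R) k : (forall i, 0 <= f i) ->
  f k <= f 0%N + \sum_(0 <= i < 0 + k) `|f i - f i.+1|.
Proof.
move=> f0; elim: k => [|k IH]; first by rewrite big_geq// adde0.
rewrite add0n big_nat_recr//= addeA; apply: le_trans (leeD IH (lexx _)).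
move: (f0 k) (f0 k.+1); case: (f k) => [a||]//; case: (f k.+1) => [b||]//; last first.
  by move=> _ _; rewrite ge0_addye ?abse_ge0// leey.
by rewrite -EFinB abse_EFin -EFinD !lee_fin => _ _; have := ler_norm (b - a)%R; rewrite distrC; lra.
Qed.

(** The bound is the same for all [k], so its root is a density above all the
    [f k]. Keeping the coefficient of [f 0] close to 1 is the reason for
    using a small weight [l] instead of 1/2. *)
Lemma telescope_power_le (f : nat -> \bar R) (l : R) p k : (0 < l < 1)%R ->
  (forall i, 0 <= f i) -> f k ^+ p.+1 <= ((1 - l) ^- p)%:E * f 0%N ^+ p.+1 +
    (l ^- p)%:E * \sum_(i <oo) (2 ^+ (p * i.+1))%:E * `|f i - f i.+1| ^+ p.+1.
Proof.
move=> l01 f0; have [l0 l1] := andP l01.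
apply: le_trans (lee_expe _ (f0 k) (telescope_abs k f0)) _.
have S0 : 0 <= \sum_(0 <= i < 0 + k) `|f i - f i.+1| by apply: sume_ge0.
apply: le_trans (power_convexe p l01 (f0 0%N) S0) _.
apply: leeD2l; apply: lee_wpmul2l; first by rewrite lee_fin invr_ge0 exprn_ge0// ltW.
apply: le_trans (power_sum_le p k 0 (fun j => abse_ge0 (f j - f j.+1))) _.
rewrite add0n; under eq_bigr do rewrite subn0.
apply: nneseries_lim_ge => i _.
by rewrite mule_ge0 ?expe_ge0// lee_fin exprn_ge0.
Qed.

Lemma bernoulli_ge (l : R) p : (0 <= l <= 1)%R -> (1 - p%:R * l <= (1 - l) ^+ p)%R.
Proof.
move=> /andP[l0 l1]; elim: p => [|p IH]; first by rewrite mul0r subr0 expr0.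
rewrite exprS -natr1; have : (0 <= p%:R :> R)%R by [].
have h : (0 <= 1 - l)%R by lra.
have := ler_wpM2l h IH; nra.
Qed.

(** Ziemer's theorem that the modulus is continuous along increasing families.
    The root of the bound in [telescope_power_le] is above every [f k], hence
    admissible for the union, and the energy of that root exceeds [M] by an
    error which is small if [l] is small and the [f k] converge fast,
    depending on [l]. *)
Lemma modulus_bigcup_le : modulus (\bigcup_i G i) <= M%:E.
Proof.
have M0 : (0 <= M)%R by rewrite -lee_fin (le_trans (modulus_ge0 (G 0)) (GM 0)).
pose p := n.-1; have nE : n = p.+1 by rewrite /p prednK// (leq_trans _ n2).
apply/lee_addgt0Pr => e e0.
(* The weight [l] is chosen so that [(1 - l) ^- p * M <= M + e / 3]. *)
pose l : R := (e / (3 * p.+1%:R * (M + e + 1)))%R.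
have Me : (0 < M + e + 1)%R by lra.
have p1 : (0 < p.+1%:R :> R)%R by [].
have den0 : (0 < 3 * p.+1%:R * (M + e + 1))%R by rewrite !mulr_gt0.
have l0 : (0 < l)%R by rewrite divr_gt0.
have plE : (3 * p.+1%:R * l * (M + e + 1) = e)%R.
  by rewrite /l; field; rewrite !gt_eqF.
pose q := (p%:R * l)%R.
have q0 : (0 <= q)%R by rewrite mulr_ge0// ltW.
have qle : (3 * (q + l) * (M + e + 1) = e)%R.
  by rewrite -[RHS]plE /q -natr1; ring.
have ql3 : (3 * (q + l) <= 1)%R.
  by rewrite -(ler_pM2r Me) qle mul1r; lra.
have l01 : (0 < l < 1)%R by apply/andP; split => //; lra.
have K1 : (1 - q <= (1 - l) ^+ p)%R by apply: bernoulli_ge; apply/andP; split; lra.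
have K0 : (0 < (1 - l) ^+ p)%R by rewrite exprn_gt0//; lra.
pose K := ((1 - l) ^- p)%R.
have KM : (K * M <= M + e / 3)%R.
  rewrite /K mulrC ler_pdivrMr//.
  apply: (@le_trans _ _ ((M + e / 3) * (1 - q))%R); last by rewrite ler_wpM2l//; lra.
  by nra.
have K2 : (K <= 2)%R by rewrite /K invf_ple ?posrE//; lra.
have K00 : (0 < K)%R by rewrite invr_gt0.
pose D := (l ^- p)%R.
have D0 : (0 < D)%R by rewrite invr_gt0 exprn_gt0.
pose d := (e / 3 / (2 + D))%R.
have D2 : (0 < 2 + D)%R by lra.
have d0 : (0 < d)%R by rewrite !divr_gt0.
have dE : (d * (2 + D) = e / 3)%R by rewrite /d divfK// gt_eqF.
(* The rate [eps] beats the weights [2 ^+ (p * k.+1)] of [telescope_power_le]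
   and makes the error terms add up to at most [d]. *)
pose eps k := (d / (2 ^+ n.+1 * 2 ^+ (p.+1 * k.+1)))%R.
have den_gt0 q' : (0 < 2 ^+ n.+1 * 2 ^+ q' :> R)%R.
  by apply: mulr_gt0; exact: exprn_gt0.
have eps0 k : (0 < eps k)%R by exact: divr_gt0.
have epsd k : (eps k.+1 <= eps k)%R.
  rewrite /eps ler_pM2l// lef_pV2 ?posrE; [|exact: den_gt0..].
  apply: ler_wpM2l; first exact: exprn_ge0.
  by apply: ler_weXn2l; rewrite ?ler1n// leq_mul2l leqnSn orbT.
have eps0d : (eps 0%N <= d)%R.
  rewrite /eps ler_pdivrMr; last exact: den_gt0.
  rewrite -exprD; apply: ler_peMr; first exact: ltW.
  by apply: exprn_ege1; rewrite ler1n.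
have [j [f [jk fa fe fd]]] := almost_extremal_sequence eps0 epsd.
have mf k : measurable_fun setT (f k) by have [] := fa k.
have f0 k x : 0 <= f k x by have [_ + _] := fa k; exact.
pose t k x := `|f k x - f k.+1 x|.
have mt k : measurable_fun setT (t k) by apply: measurable_absB.
have t0 k x : 0 <= t k x by exact: abse_ge0.
pose a k x := (2 ^+ (p * k.+1))%:E * t k x ^+ n.
have a0 k x : 0 <= a k x by rewrite mule_ge0 ?expe_ge0// lee_fin exprn_ge0.
have ma k : measurable_fun setT (a k).
  by apply: emeasurable_funM => //; exact: measurable_funXe.
pose S x := \sum_(k <oo) a k x.
have S0 x : 0 <= S x by apply: nneseries_ge0.
have mS : measurable_fun setT S by apply: ge0_emeasurable_sum.
pose B x := K%:E * f 0%N x ^+ n + D%:E * S x.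
have B0 x : 0 <= B x by rewrite adde_ge0// mule_ge0 ?expe_ge0// lee_fin ltW.
have mKf : measurable_fun setT (fun x => K%:E * f 0%N x ^+ n).
  by apply: emeasurable_funM => //; exact: measurable_funXe.
have mDS : measurable_fun setT (fun x => D%:E * S x) by exact: emeasurable_funM.
have mB : measurable_fun setT B by exact: emeasurable_funD.
have n0 : (0 < n)%N by rewrite nE.
have fB k x : f k x <= rootn n (B x).
  apply: le_rootn => //; rewrite /B /S /a /t nE.
  exact: (@telescope_power_le (fun k => f k x) l p k l01 (fun k => f0 k x)).
have adm : admissible (\bigcup_i G i) (fun x => rootn n (B x)).
  have mr : measurable_fun setT (fun x => rootn n (B x)).
    exact: (measurableT_comp (measurable_poweR _) mB).
  split => //; first by move=> x; exact: rootn_ge0.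
  move=> c [i _ Gc] rc; have [_ _ /(_ c)] := fa i.
  have Gjc : G (j i) c by apply: Ginc Gc; case/andP: (jk i).
  move=> /(_ Gjc rc) /le_trans; apply.
  exact: line_integral_le.
apply: le_trans (modulus_le_energy adm) _; rewrite /energy.
under eq_integral do rewrite rootnK//.
rewrite ge0_integralD//; last 2 first.
- by move=> x _; rewrite mule_ge0 ?expe_ge0// lee_fin ltW.
- by move=> x _; rewrite mule_ge0// lee_fin ltW.
rewrite (ge0_integralZl_EFin _ measurableT _ _ (ltW K00)); last 2 first.
- by move=> x _; exact: expe_ge0.
- exact: measurable_funXe.
rewrite (ge0_integralZl_EFin _ measurableT _ _ (ltW D0))//.
have ES : \int[@lebesgue_rV R n]_x S x <= d%:E.
  rewrite integral_nneseries//; apply: sum_geometric_le; [exact: ltW| |]; last first.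
    by move=> k; exact: integral_ge0.
  move=> k; rewrite ge0_integralZl_EFin//; last 2 first.
  - by move=> x _; exact: expe_ge0.
  - exact: measurable_funXe.
  have tE : \int[@lebesgue_rV R n]_x (t k x ^+ n) <= (2 ^+ n * (2 * eps k))%:E.
    have -> : \int[@lebesgue_rV R n]_x (t k x ^+ n) = energy (fun x => 2%:E * (2^-1%:E * t k x)).
      by apply: eq_integral => x _; rewrite muleA -EFinM divff// mul1e.
    rewrite energyZl//; last 2 first.
    - exact: emeasurable_funM.
    - by move=> x; rewrite mule_ge0// lee_fin.
    by rewrite EFinM; apply: lee_wpmul2l; [rewrite lee_fin exprn_ge0|exact: fd].
  apply: le_trans (lee_wpmul2l _ tE) _; first by rewrite lee_fin exprn_ge0.
  rewrite -EFinM lee_fin le_eqVlt; apply/orP; left; apply/eqP.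
  rewrite /eps mulSn exprD (exprS _ n) mulnC; field.
  by rewrite !expf_neq0.
have f0E : \int[@lebesgue_rV R n]_x (f 0%N x ^+ n) <= (M + eps 0%N)%:E by exact: fe.
apply: le_trans (leeD (lee_wpmul2l _ f0E) (lee_wpmul2l _ ES)) _.
- by rewrite lee_fin ltW.
- by rewrite lee_fin ltW.
rewrite -!EFinM -!EFinD lee_fin mulrDr.
have := ler_wpM2l (ltW K00) eps0d; have := ler_wpM2r (ltW d0) K2.
by lra.
Qed.

End exhaustion.

(** * Integration tools *)

Section measure_tools.
Local Open Scope ereal_scope.

Section tonelli.
Context d1 d2 (T1 : measurableType d1) (T2 : measurableType d2) {R : realType}.
Variables (m1 : {sigma_finite_measure set T1 -> \bar R})
  (m2 : {sigma_finite_measure set T2 -> \bar R}).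
Variables (A : set T1) (B : set T2) (f : T1 * T2 -> \bar R).
Hypotheses (mA : measurable A) (mB : measurable B).
Hypotheses (mf : measurable_fun setT f) (f0 : forall z, 0 <= f z).

Let g := f \_ (A `*` B).

Let mg : measurable_fun setT g.
Proof.
apply/(measurable_restrictT _ (measurableX mA mB)); exact: measurable_funTS.
Qed.

Let g0 z : 0 <= g z. Proof. by apply: erestrict_ge0. Qed.

Let gE1 x : \int[m2]_y g (x, y) = ((fun x => \int[m2]_(y in B) f (x, y)) \_ A) x.
Proof.
rewrite patchE; case: ifPn => [xA|xA].
  rewrite [RHS]integral_mkcond; apply: eq_integral => y _.
  rewrite /g !patchE; have -> : ((x, y) \in A `*` B) = (y \in B) => //.
  apply/idP/idP => [/set_mem[_ /mem_set//]|yB].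
  by apply/mem_set; split; exact: set_mem.
rewrite -[RHS](integral0 m2 setT); apply: eq_integral => y _.
rewrite /g patchE ifF//; apply/negP => /set_mem[/= Ax _].
by move/negP: xA; apply; exact: mem_set.
Qed.

Let gE2 y : \int[m1]_x g (x, y) = ((fun y => \int[m1]_(x in A) f (x, y)) \_ B) y.
Proof.
rewrite patchE; case: ifPn => [yB|yB].
  rewrite [RHS]integral_mkcond; apply: eq_integral => x _.
  rewrite /g !patchE; have -> : ((x, y) \in A `*` B) = (x \in A) => //.
  apply/idP/idP => [/set_mem[/mem_set//]|xA].
  by apply/mem_set; split; exact: set_mem.
rewrite -[RHS](integral0 m1 setT); apply: eq_integral => x _.
rewrite /g patchE ifF//; apply/negP => /set_mem[_ /= By].
by move/negP: yB; apply; exact: mem_set.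
Qed.

Lemma tonelli_in : \int[m1]_(x in A) \int[m2]_(y in B) f (x, y) =
  \int[m2]_(y in B) \int[m1]_(x in A) f (x, y).
Proof.
rewrite [LHS]integral_mkcond [RHS]integral_mkcond.
under eq_integral do rewrite -gE1.
under [RHS]eq_integral do rewrite -gE2.
exact: fubini_tonelli.
Qed.

End tonelli.

Lemma measurable_integral_in d1 d2 (T1 : measurableType d1) (T2 : measurableType d2)
    {R : realType} (m2 : {sigma_finite_measure set T2 -> \bar R}) (B : set T2)
    (f : T1 * T2 -> \bar R) : measurable B -> measurable_fun setT f ->
    (forall z, 0 <= f z) ->
  measurable_fun setT (fun x => \int[m2]_(y in B) f (x, y)).
Proof.
move=> mB mf f0; pose g := f \_ (setT `*` B).
have mg : measurable_fun setT g.
  apply/(measurable_restrictT _ (measurableX measurableT mB)); exact: measurable_funTS.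
have g0 z : 0 <= g z by apply: erestrict_ge0.
rewrite (_ : (fun x => _) = fubini_F m2 g).
  exact: (measurable_fun_fubini_tonelli_F g mg g0).
apply/funext => x; rewrite integral_mkcond; apply: eq_integral => y _.
rewrite /g !patchE; have -> // : ((x, y) \in setT `*` B) = (y \in B).
apply/idP/idP => [/set_mem[_ /mem_set//]|yB].
by apply/mem_set; split => //; exact: set_mem.
Qed.

Lemma exists_lt_mean d (T : measurableType d) {R : realType}
    (mu : {measure set T -> \bar R}) (D N : set T) (g : T -> \bar R) (M : R) :
    measurable D -> measurable_fun D g -> (forall x, 0 <= g x) ->
    mu.-negligible N -> (0 <= M)%R -> \int[mu]_(x in D) g x < M%:E * mu D ->
  exists x, [/\ D x, ~ N x & g x < M%:E].
Proof.
move=> mD mg g0 [N' [mN' N'0 NN']] M0; apply: contraPP => H.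
apply/negP; rewrite -leNgt.
have mDN : measurable (D `\` N') by exact: measurableD.
apply: (@le_trans _ _ (\int[mu]_(x in D `\` N') g x)); last first.
  by apply: ge0_subset_integral => //; exact: subDsetl.
apply: (@le_trans _ _ (\int[mu]_(x in D `\` N') cst M%:E x)).
  rewrite integral_cst//; apply: lee_wpmul2l; first by rewrite lee_fin.
  apply: (@le_trans _ _ (mu (D `\` N') + mu N')).
    apply: le_trans (measureU2 _ mDN mN').
    apply: le_measure; rewrite ?inE//; first exact: measurableU.
    by move=> x Dx; have [N'x|N'x] := pselect (N' x); [right|left].
  by rewrite [mu N']N'0 adde0.
apply: ge0_le_integral => //.
- by apply: measurable_funS mg => //; exact: subDsetl.
- move=> x [Dx N'x]; rewrite leNgt; apply/negP => gM; apply: H; exists x.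
  by split => //; move=> /NN'.
Qed.

(** The graph of the power function lies above its tangent at [m]. *)
Lemma young_power {R : realType} (a m : R) k : (0 <= a)%R -> (0 <= m)%R ->
  (k.+1%:R * (m ^+ k * a) <= a ^+ k.+1 + k%:R * m ^+ k.+1)%R.
Proof.
move=> a0 m0; elim: k => [|k IH]; first by rewrite expr0 !mul1r mul0r addr0 expr1.
have := ler_wpM2l a0 IH.
rewrite !(exprS _ k.+1) !(exprS m k) -!(natr1 k.+1) -!(natr1 k).
set A := (a ^+ k.+1)%R; set P := (m ^+ k)%R; set K := (k%:R)%R.
have P0 : (0 <= P)%R by exact: exprn_ge0.
have K0 : (0 <= K :> R)%R by exact: ler0n.
have h : (0 <= (K + 1) * P * (a - m) ^+ 2)%R.
  by rewrite mulr_ge0 ?sqr_ge0// mulr_ge0// addr_ge0.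
rewrite expr2 in h; nra.
Qed.

Lemma le_1Dexpe {R : realType} (x : \bar R) k : 0 <= x -> x <= 1 + x ^+ k.+1.
Proof.
case: x => [a||]// a0; last by rewrite expye.
rewrite lee_fin in a0; rewrite -EFin_expe -EFinD lee_fin.
have [a1|a1] := leP a 1%R.
  by rewrite (le_trans a1)// lerDl exprn_ge0.
by rewrite (le_trans (ler_eXnr (ltn0Sn k) (ltW a1)))// lerDr.
Qed.

(** The tangent inequality [young_power] at the mean value is integrated over
    [D]. *)
Lemma jensen_power d (T : measurableType d) {R : realType}
    (mu : {measure set T -> \bar R}) (D : set T) (f : T -> \bar R) (V : R) k :
    measurable D -> measurable_fun D f -> (forall x, 0 <= f x) ->
    mu D = V%:E -> (0 < V)%R ->
  (V^-1%:E * \int[mu]_(x in D) f x) ^+ k.+1 <=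
  V^-1%:E * \int[mu]_(x in D) (f x ^+ k.+1).
Proof.
move=> mD mf f0 DV V0.
have If0 : 0 <= \int[mu]_(x in D) f x by exact: integral_ge0.
have mfk : measurable_fun D (fun x => f x ^+ k.+1) by exact: measurable_funXe.
have fk0 x : 0 <= f x ^+ k.+1 by exact: expe_ge0.
have J0 : 0 <= \int[mu]_(x in D) (f x ^+ k.+1) by exact: integral_ge0.
have [fy|fy] := eqVneq (\int[mu]_(x in D) f x) +oo.
  have : \int[mu]_(x in D) f x <= \int[mu]_(x in D) (1 + f x ^+ k.+1).
    apply: ge0_le_integral => //; first by apply: emeasurable_funD.
    by move=> x _; exact: le_1Dexpe.
  rewrite ge0_integralD// integral_cst// mul1e DV fy leye_eq.
  move: J0; case: (\int[mu]_(x in D) (f x ^+ k.+1)) => [r||]// _ _.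
  by rewrite [leRHS]gt0_mulEy ?invr_gt0// leey.
have : \int[mu]_(x in D) f x \is a fin_num by rewrite ge0_fin_numE// ltey.
move=> /fineK; set I := fine _ => IE.
have I0 : (0 <= I)%R by rewrite /I fine_ge0.
pose m := (V^-1 * I)%R; have m0 : (0 <= m)%R by rewrite mulr_ge0// invr_ge0 ltW.
have ImV : (I = m * V)%R by rewrite /m; field; rewrite gt_eqF.
rewrite -IE -EFinM -/m -EFin_expe.
have H : (k.+1%:R * m ^+ k)%:E * \int[mu]_(x in D) f x <=
    \int[mu]_(x in D) (f x ^+ k.+1) + (k%:R * m ^+ k.+1)%:E * V%:E.
  rewrite -DV -integral_cst// -ge0_integralD//; last first.
    by move=> x _ /=; rewrite lee_fin mulr_ge0// exprn_ge0.
  rewrite -ge0_integralZl_EFin//; last by rewrite mulr_ge0// exprn_ge0.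
  apply: ge0_le_integral => //.
  - by move=> x _; rewrite mule_ge0// lee_fin mulr_ge0// exprn_ge0.
  - exact: emeasurable_funM.
  - exact: emeasurable_funD.
  - move=> x _; rewrite /cst; case: (f x) (f0 x) => [a||]// a0; last first.
      by rewrite expye ge0_addye ?leey// lee_fin mulr_ge0// exprn_ge0.
    by rewrite -EFin_expe -EFinM -EFinD lee_fin -mulrA; apply: young_power.
move: H J0; rewrite -IE; case: (\int[mu]_(x in D) (f x ^+ k.+1)) => [J||]//; last first.
  by move=> _ _; rewrite [leRHS]gt0_mulEy ?invr_gt0// leey.
rewrite -!EFinM -EFinD !lee_fin ImV => H _.
rewrite ler_pdivlMl// exprS; move: H; rewrite exprS -natr1.
set P := (m ^+ k)%R; lra.
Qed.

Lemma jensen_power_gt0 d (T : measurableType d) {R : realType}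
    (mu : {measure set T -> \bar R}) (D : set T) (f : T -> \bar R) (V : R) k :
    (0 < k)%N -> measurable D -> measurable_fun D f -> (forall x, 0 <= f x) ->
    mu D = V%:E -> (0 < V)%R ->
  (V^-1%:E * \int[mu]_(x in D) f x) ^+ k <=
  V^-1%:E * \int[mu]_(x in D) (f x ^+ k).
Proof. by case: k => // k _; exact: jensen_power. Qed.

Lemma absolutely_continuous_integral d (T : measurableType d) {R : realType}
    (mu : {measure set T -> \bar R}) (f : T -> \bar R) (e : R) :
    measurable_fun setT f -> (forall x, 0 <= f x) ->
    \int[mu]_x f x < +oo -> (0 < e)%R ->
  exists2 dl : R, (0 < dl)%R & forall A, measurable A -> mu A < dl%:E ->
    \int[mu]_(x in A) f x <= e%:E.
Proof.
move=> mf f0 foo e0.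
have intf : mu.-integrable setT f.
  apply/integrableP; split => //.
  by under eq_integral do rewrite gee0_abs//.
have aefin : {ae mu, forall x, setT x -> f x \is a fin_num}.
  exact: integrable_ae.
have intg : mu.-integrable setT (EFin \o (fine \o f)).
  have mg : measurable_fun setT (EFin \o (fine \o f)).
    by apply/measurable_EFinP; exact: measurableT_comp.
  apply/integrableP; split => //; apply: le_lt_trans foo.
  apply: ge0_le_integral => //; first exact: measurableT_comp.
  move=> x _ /=; case: (f x) (f0 x) => [r||]//= r0; last by rewrite normr0 leey.
  by rewrite lee_fin ger0_norm.
have [dl [dl0 H]] := integral_normr_continuous intg e0.
exists dl => // A mA muA; have := H _ mA muA.
have IA : \int[mu]_(x in A) f x = \int[mu]_(x in A) `|(fine \o f) x|%:E.
  apply: ae_eq_integral => //.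
  - exact: measurable_funTS.
  - apply: measurable_funTS; apply: measurableT_comp => //.
    by apply: measurableT_comp => //; apply: measurableT_comp.
  - apply: filterS aefin => x /(_ Logic.I) fx _ /=.
    by rewrite ger0_norm ?fine_ge0// fineK.
rewrite IA /Rintegral -lte_fin fineK => [/ltW//|].
rewrite -IA ge0_fin_numE ?integral_ge0//.
by apply: le_lt_trans foo; apply: ge0_subset_integral.
Qed.

End measure_tools.

(** * Averages over cubes *)

Section cubes.
Context {R : realType} {n : nat}.
Local Open Scope ereal_scope.
Local Notation leb := (@lebesgue_rV R n).
Implicit Types (x y p : 'rV[R]_n) (r s : R) (rho : 'rV[R]_n -> \bar R).

(** The balls of the sup norm: their measure is explicit, and they serve as balls
    throughout. *)
Definition cube x r : set 'rV[R]_n := rV_box (x - const_mx r)%R (x + const_mx r)%R.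

Lemma cubeP x r y : (0 <= r)%R -> cube x r y <-> (`|y - x| <= r)%R.
Proof.
move=> r0; rewrite norm_rV_le//; split => [H|/forallP H i].
  by apply/forallP => i; have := H i; rewrite !mxE ler_norml; lra.
by have := H i; rewrite !mxE ler_norml; lra.
Qed.

Lemma cubeS x (r s : R) : (0 <= r)%R -> (r <= s)%R -> cube x r `<=` cube x s.
Proof.
move=> r0 rs y /(cubeP _ _ r0) yx; apply/cubeP; first exact: le_trans rs.
exact: le_trans rs.
Qed.

Lemma measurable_cube x r : measurable (cube x r).
Proof. exact: measurable_rV_box. Qed.

Lemma lebesgue_cube x r : (0 <= r)%R -> leb (cube x r) = ((2 * r) ^+ n)%:E.
Proof.
move=> r0; rewrite /cube lebesgue_rV_box; last first.
  by move=> i; rewrite !mxE; lra.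
congr _%:E; rewrite (eq_bigr (fun=> 2 * r)%R); last first.
  by move=> i _; rewrite !mxE; ring.
by rewrite prodr_const card_ord.
Qed.

Lemma measurable_translate rho y : measurable_fun setT rho ->
  measurable_fun setT (fun x => rho (y + x)%R).
Proof.
move=> mr; apply: (measurableT_comp mr).
by apply: measurable_addrV; [exact: measurable_cst|exact: measurable_id].
Qed.

Lemma measurable_add_pair rho d (T : measurableType d) (P : T -> 'rV[R]_n) :
  measurable_fun setT rho -> measurable_fun setT P ->
  measurable_fun setT (fun z : T * 'rV[R]_n => rho (P z.1 + z.2)%R).
Proof.
move=> mr mP; apply: (measurableT_comp mr); apply: measurable_addrV => //.
exact: (measurableT_comp mP).
Qed.

Definition cube_mean rho r y : \bar R :=
  ((2 * r) ^- n)%:E * \int[leb]_(x in cube 0 r) rho (y + x)%R.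

Section mean.
Variables (rho : 'rV[R]_n -> \bar R) (r : R).
Hypotheses (mr : measurable_fun setT rho) (r0 : forall x, 0 <= rho x) (rpos : (0 < r)%R).

Let V0 : (0 < (2 * r) ^+ n)%R. Proof. by rewrite exprn_gt0// mulr_gt0. Qed.

Lemma measurable_cube_mean : measurable_fun setT (cube_mean rho r).
Proof.
apply: emeasurable_funM => //.
apply: (measurable_integral_in _ (f := fun z : 'rV[R]_n * 'rV[R]_n => rho (z.1 + z.2)%R)) => //.
- exact: measurable_cube.
- exact: (measurable_add_pair mr (@measurable_id _ _ setT)).
Qed.

Lemma cube_mean_ge0 y : 0 <= cube_mean rho r y.
Proof. by rewrite mule_ge0 ?integral_ge0// lee_fin invr_ge0 ltW. Qed.

(** Jensen's inequality on each cube, then Tonelli's theorem and translation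
    invariance. *)
Lemma energy_cube_mean_le : (0 < n)%N -> energy (cube_mean rho r) <= energy rho.
Proof.
move=> n0; rewrite /energy.
have mX : measurable_fun setT (fun x => rho x ^+ n) by exact: measurable_funXe.
have X0 x : 0 <= rho x ^+ n by exact: expe_ge0.
have mXp : measurable_fun setT
    (fun z : 'rV[R]_n * 'rV[R]_n => rho (z.1 + z.2)%R ^+ n).
  exact: (measurable_add_pair mX (@measurable_id _ _ setT)).
apply: (@le_trans _ _ (\int[leb]_y (((2 * r) ^- n)%:E *
    \int[leb]_(x in cube 0 r) (rho (y + x)%R ^+ n)))).
  apply: ge0_le_integral => //.
  - by move=> y _; rewrite expe_ge0// cube_mean_ge0.
  - by apply: measurable_funXe; exact: measurable_cube_mean.
  - apply: emeasurable_funM => //.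
    exact: (measurable_integral_in leb (measurable_cube 0%R r) mXp).
  - move=> y _; rewrite /cube_mean.
    apply: jensen_power_gt0 => //; first exact: measurable_cube.
      by apply: measurable_funTS; exact: measurable_translate.
    exact: lebesgue_cube (ltW rpos).
rewrite ge0_integralZl_EFin//; first last.
- by rewrite invr_ge0 ltW.
- exact: (measurable_integral_in leb (measurable_cube 0%R r) mXp).
- by move=> y _; exact: integral_ge0.
rewrite (tonelli_in leb leb measurableT (measurable_cube 0%R r) mXp)//.
rewrite (eq_integral (cst (\int[leb]_x (rho x ^+ n)))); last first.
  move=> x _ /=; have := integral_rV_affine x (@ltr01 R) mX X0.
  rewrite expr1n invr1 mul1e => <-; apply: eq_integral => z _.
  by rewrite scale1r addrC.
rewrite integral_cst; last exact: measurable_cube.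
rewrite [X in _ * (_ * X)](lebesgue_cube 0%R (ltW rpos)) muleCA -EFinM mulVf ?mule1//.
by rewrite gt_eqF.
Qed.

(** By Tonelli's theorem, averaging the density amounts to averaging the line
    integrals over the translates of the curve. This is how almost every
    translate, as in [P_translate], enters. *)
Lemma line_integral_cube_mean c : rectifiable c ->
  line_integral (cube_mean rho r) c =
  ((2 * r) ^- n)%:E * \int[leb]_(x in cube 0 r) line_integral rho (translate c x).
Proof.
move=> rc; have mP := measurable_arclength_path rc.
rewrite [LHS]line_integralE// ge0_integralZl_EFin//; last 3 first.
- by move=> s _; exact: integral_ge0.
- apply: measurable_funTS.
  apply: (measurable_integral_in _ (f := fun z : R * 'rV[R]_n => rho (arclength_path c z.1 + z.2)%R)) => //.
    exact: measurable_cube.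
  exact: (measurable_add_pair mr mP).
- by rewrite invr_ge0 ltW.
congr (_ * _).
rewrite (tonelli_in lebesgue_measure leb (f := fun z : R * 'rV[R]_n => rho (arclength_path c z.1 + z.2)%R))//.
- by apply: eq_integral => x _; rewrite line_integral_translate.
- exact: measurable_cube.
- exact: (measurable_add_pair mr mP).
Qed.

Lemma measurable_line_integral_translate c : rectifiable c ->
  measurable_fun setT (fun x => line_integral rho (translate c x)).
Proof.
move=> rc; have mP := measurable_arclength_path rc.
rewrite (_ : (fun x => _) = (fun x => \int[lebesgue_measure]_(s in `[0%R, fine (length c)])
    rho (arclength_path c s + x)%R)); last first.
  by apply/funext => x; rewrite line_integral_translate.
apply: (measurable_integral_in lebesgue_measure (f := fun z : 'rV[R]_n * R => rho (arclength_path c z.2 + z.1)%R)) => //.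
apply: (measurableT_comp mr); apply: measurable_addrV => //.
exact: (measurableT_comp mP).
Qed.

Lemma exists_good_translate c (N : set 'rV[R]_n) (M : R) : rectifiable c ->
  leb.-negligible N -> (0 <= M)%R -> line_integral (cube_mean rho r) c < M%:E ->
  exists x, [/\ (`|x| <= r)%R, ~ N x & line_integral rho (translate c x) < M%:E].
Proof.
move=> rc nN M0 cM.
have mg : measurable_fun (cube 0%R r) (fun x => line_integral rho (translate c x)).
  by apply: measurable_funTS; exact: measurable_line_integral_translate.
have g0 x : 0 <= line_integral rho (translate c x) by exact: integral_ge0.
have gM : \int[leb]_(x in cube 0 r) line_integral rho (translate c x) <
    M%:E * leb (cube 0%R r).
  move: cM; rewrite line_integral_cube_mean// [X in _ -> _ < _ * X](lebesgue_cube 0%R (ltW rpos)).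
  by rewrite lte_pdivrMl// muleC.
have [x [xr Nx xM]] := exists_lt_mean (measurable_cube 0%R r) mg g0 nN M0 gM.
exists x; split => //; by move/(cubeP _ _ (ltW rpos)): xr; rewrite subr0.
Qed.

End mean.

Lemma energy_small_cubes rho (k : R) : (0 < n)%N -> measurable_fun setT rho ->
  (forall x, 0 <= rho x) -> energy rho < +oo -> (0 < k)%R ->
  exists2 r0 : R, (0 < r0)%R & forall x r, (0 < r)%R -> (r <= r0)%R ->
    \int[leb]_(y in cube x r) (rho y ^+ n) <= k%:E.
Proof.
move=> n0 mr rho0 roo k0.
have mX : measurable_fun setT (fun x => rho x ^+ n) by exact: measurable_funXe.
have X0 x : 0 <= rho x ^+ n by exact: expe_ge0.
have [d d0 dP] := absolutely_continuous_integral mX X0 roo k0.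
pose r0 := (Num.min 1 d / 4)%R.
have m0 : (0 < Num.min 1 d)%R by rewrite lt_min ltr01.
exists r0; first by rewrite divr_gt0.
move=> x r r00 rr0; apply: dP; first exact: measurable_cube.
rewrite [X in X < _](lebesgue_cube x (ltW r00)) lte_fin.
have r1 : (2 * r < Num.min 1 d)%R by move: rr0; rewrite /r0; lra.
have [r2 r3] : (2 * r < 1 /\ 2 * r < d)%R by move: r1; rewrite lt_min => /andP[].
have r4 : (0 <= 2 * r)%R by lra.
apply: le_lt_trans r3; case: (n) n0 => // m _.
by rewrite exprS ler_piMr// exprn_ile1// ltW.
Qed.

End cubes.

(** * Good points on connected sets *)

Section good_points.
Context {R : realType}.

(** Finitely many of the balls cover the segment; the finite Vitali lemma
    extracts disjoint ones whose dilations by 3, of length [6 * S v], still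
    cover it. *)
Lemma vitali_segment (a b : R) (S : R -> R) : a < b -> (forall v, 0 < S v) ->
  exists E : seq R, [/\ uniq E, {in E, forall v, a <= v <= b},
    trivIset [set` E] (fun v => ball v (S v)) &
    b - a <= \sum_(v <- E) 6 * S v].
Proof.
move=> ab S0; pose B v := ball v (S v).
have cov : `[a, b]%classic `<=` cover [set` `[a, b]] B.
  by move=> v vab; exists v => //; exact: ballxx.
have [D Dsub Dcov] : finite_subset_cover [set` `[a, b]] B `[a, b]%classic.
  have := @segment_compact R a b; rewrite compact_cover => /(_ _ _ _ _ cov); apply.
  by move=> v _; exact: ball_open.
have is_ballB i : is_ball (B i) by exact: is_ball_ball.
have Bset0 i : B i !=set0 by exists i; exact: ballxx.
have [E [uE ED tEB DE]] := @vitali_lemma_finite_cover _ _ B is_ballB Bset0 (finmap.enum_fset D).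
exists E; split => //.
  by move=> v /ED vD; have := Dsub v vD; rewrite inE/= in_itv.
have KE : `[a, b]%classic `<=` cover [set` E] (scale_ball 3%:R \o B).
  by apply: subset_trans DE => v /Dcov [w wD wv]; exists w.
rewrite -lee_fin.
have -> : ((b - a)%:E = lebesgue_measure (`[a, b]%classic : set R))%E.
  by rewrite lebesgue_measure_itv/= lte_fin ab.
apply: (le_trans (@content_subadditive _ _ _ lebesgue_measure `[a, b]%classic
      (fun i => 3 *` B (nth 0%R E i)) (size E) _ _ _)) => //.
- by move=> k ?; rewrite scale_ballE//; exact: measurable_ball.
- by apply: (subset_trans KE); rewrite /cover bigcup_seq (big_nth 0%R)//= big_mkord.
- rewrite -sumEFin (big_nth 0%R) big_mkord; apply: lee_sum => i _.
  have mE : lebesgue_measure (3 *` B E`_i) = ((3 * S E`_i) *+ 2)%:E.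
    by rewrite /B scale_ballE//; apply: lebesgue_measure_ball; rewrite mulr_ge0// ltW.
  by rewrite [X in (X <= _)%E]mE lee_fin; have := S0 E`_i; lra.
Qed.

Context {n : nat}.
Implicit Types (A : set 'rV[R]_n) (x p y : 'rV[R]_n).

Lemma dist_continuous x : continuous (fun y : 'rV[R]_n => `|y - x|).
Proof.
move=> y; apply: (@continuous_comp _ _ _ (fun z : 'rV[R]_n => z - x)
  (fun z : 'rV[R]_n => `|z|)); last exact: norm_continuous.
by apply: (@cvgB _ 'rV[R]_n _ (nbhs y) _ id (fun=> x)); [exact: cvg_id|exact: cvg_cst].
Qed.

Lemma connected_crosses A x (r s v : R) : connected A ->
  (exists2 a, A a & `|a - x| <= r) -> (exists2 a, A a & s <= `|a - x|) ->
  r <= v <= s -> exists2 p, A p & `|p - x| = v.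
Proof.
move=> cA [a Aa ar] [b Ab bs] /andP[rv vs].
have cf : {within A, continuous (fun y : 'rV[R]_n => `|y - x|)}.
  by apply: continuous_subspaceT; exact: dist_continuous.
have /connected_intervalP itvA := connected_continuous_connected cA cf.
have /= := itvA `|a - x| `|b - x|.
have h1 : [set `|y - x| | y in A] `|a - x| by exists a.
have h2 : [set `|y - x| | y in A] `|b - x| by exists b.
move=> /(_ h1 h2 v); rewrite (le_trans ar rv) (le_trans vs bs) => /(_ isT)[p Ap <-].
by exists p.
Qed.

(** If there were no such point, every level [v] between [r / 2] and [r] of the
    distance to [x] would be attained at a point of [A] that is the centre of
    a cube of some radius [s] on which [g] has integral above [k * s / r].
    Cubes around different points are disjoint once the ranges of the
    distance on them are. Vitali's lemma on the line of levels thus yields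
    disjoint cubes inside [cube x (3 * r)] whose radii add up to a multiple
    of [r], and the integral of [g] over that cube is too large. *)
Lemma good_point A x (r k : R) (g : 'rV[R]_n -> \bar R) :
  0 < r -> 0 < k -> measurable_fun setT g -> (forall y, 0 <= g y)%E ->
  connected A -> (exists2 a, A a & `|a - x| <= r / 2) ->
  (exists2 a, A a & r <= `|a - x|) ->
  (\int[@lebesgue_rV R n]_(y in cube x (3 * r)) g y <= (k / 96)%:E)%E ->
  exists p, [/\ A p, r / 2 < `|p - x|, `|p - x| < r & forall s, 0 < s <= 2 * r ->
    (\int[@lebesgue_rV R n]_(y in cube p s) g y <= (k * s / r)%:E)%E].
Proof.
move=> r0 k0 mg g0 cA hA1 hA2 gk; apply: contrapT => bad.
have H v : exists ps : 'rV[R]_n * R, 0 < ps.2 /\ (r / 2 < v < r ->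
    [/\ A ps.1, `|ps.1 - x| = v, ps.2 <= 2 * r &
    ((k * ps.2 / r)%:E < \int[@lebesgue_rV R n]_(y in cube ps.1 ps.2) g y)%E]).
  have [vr|nvr] := boolP (r / 2 < v < r); last by exists (0, 1).
  have /andP[v1 v2] := vr.
  have [|p Ap pv] := @connected_crosses A x _ _ v cA hA1 hA2.
    by rewrite (ltW v1) (ltW v2).
  apply: contrapT => nH; apply: bad; exists p; split; rewrite ?pv//.
  move=> s /andP[s0 s2]; rewrite leNgt; apply/negP => sg; apply: nH.
  by exists (p, s).
have [ps psP] := choice H.
(* On the cube of radius [s] the distance to [x] stays within [s] of [v]; the
   factor 2 puts this closed range inside an open ball of the line. *)
pose S v := 2 * (ps v).2.
have S0 v : 0 < S v by rewrite mulr_gt0//; have [] := psP v.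
(* A compact segment of levels inside the open interval where bad points are
   available. *)
have ab : 5 / 8 * r < 7 / 8 * r by lra.
have [E [uE Eab tE Esum]] := vitali_segment ab S0.
have Er v : v \in E -> r / 2 < v < r by move=> /Eab /andP[? ?]; apply/andP; split; lra.
have EP v : v \in E -> [/\ 0 < (ps v).2, A (ps v).1, `|(ps v).1 - x| = v,
    (ps v).2 <= 2 * r &
    ((k * (ps v).2 / r)%:E < \int[@lebesgue_rV R n]_(y in cube (ps v).1 (ps v).2) g y)%E].
  by move=> /Er vr; have [? /(_ vr)[]] := psP v.
have near_level v y : v \in E -> cube (ps v).1 (ps v).2 y -> `|v - `|y - x| | <= (ps v).2.
  move=> vE; have [s0 _ pv _ _] := EP v vE; move/(cubeP _ _ (ltW s0)) => yp.
  rewrite -{1}pv; apply: le_trans (ler_dist_dist _ _) _.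
  by rewrite opprB addrA subrK distrC.
have tE' : trivIset [set` E] (fun v => cube (ps v).1 (ps v).2).
  move=> v w vE wE [y [yv yw]]; apply: tE => //; exists `|y - x|; split.
    apply: le_lt_trans (near_level v y vE yv) _.
    by have [? _ _ _ _] := EP v vE; rewrite /S; lra.
  apply: le_lt_trans (near_level w y wE yw) _.
  by have [? _ _ _ _] := EP w wE; rewrite /S; lra.
have sumE : ((\sum_(v <- E) (k * (ps v).2 / r))%:E <= (k / 96)%:E)%E.
  apply: le_trans gk; rewrite -sumEFin.
  apply: (@le_trans _ _ (\sum_(v <- E) \int[@lebesgue_rV R n]_(y in cube (ps v).1 (ps v).2) g y)%E).
    rewrite [leLHS]big_seq [leRHS]big_seq; apply: lee_sum => v vE.
    by have [_ _ _ _ /ltW] := EP v vE.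
  rewrite -ge0_integral_bigsetU//=; last 2 first.
  - by move=> v; exact: measurable_cube.
  - exact: measurable_funTS.
  apply: ge0_subset_integral => //.
  - by apply: bigsetU_measurable => v _; exact: measurable_cube.
  - exact: measurable_cube.
  - exact: measurable_funTS.
  rewrite -bigcup_seq => y [v /= vE yv].
  have [s0 _ pv s2 _] := EP v vE.
  apply/cubeP; first by rewrite mulr_ge0// ltW.
  have /andP[_ vr] := Er v vE; have := near_level v y vE yv.
  have := ler_norm (- (v - `|y - x|)); rewrite normrN; lra.
move: sumE; rewrite lee_fin.
have -> : \sum_(v <- E) (k * (ps v).2 / r) = k / r / 12 * \sum_(v <- E) 6 * S v.
  rewrite mulr_sumr; apply: eq_bigr => v _; rewrite /S; field.
  by rewrite gt_eqF.
have kr : 0 < k / r / 12 by rewrite !divr_gt0.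
have := ler_wpM2l (ltW kr) Esum.
have -> : k / r / 12 * (7 / 8 * r - 5 / 8 * r) = k / 48 by field; rewrite gt_eqF.
lra.
Qed.

End good_points.

(** * Segments issued from a good point *)

Section segment_means.
Context {R : realType}.
Local Open Scope ereal_scope.

(** If the energy on a cube is bounded linearly in the radius, the bound on the
    L^n norm shrinks by the factor [w] when the radius is halved. *)
Lemma half_root n : (0 < n)%N -> exists w : R, [/\ (0 < w)%R, (w < 1)%R & (w ^+ n = 2^-1)%R].
Proof.
move=> n0; pose w := (2^-1 `^ n%:R^-1 : R)%R.
have w0 : (0 < w)%R by rewrite powR_gt0.
have wn : (w ^+ n = 2^-1)%R.
  rewrite -powR_mulrn ?(ltW w0)// -powRrM mulVf ?powRr1//.
  by rewrite pnatr_eq0 -lt0n.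
exists w; split => //; rewrite ltNge; apply/negP => w1.
by have := exprn_ege1 n w1; rewrite wn; lra.
Qed.

Lemma geometric_nneseries_le (w C : R) : (0 < w)%R -> (w < 1)%R -> (0 <= C)%R ->
  \sum_(k <oo) (C * w ^+ k)%:E <= (C / (1 - w))%:E.
Proof.
move=> w0 w1 C0; apply: lime_le.
  by apply: is_cvg_nneseries => k _; rewrite lee_fin mulr_ge0// exprn_ge0// ltW.
apply: nearW => m /=; rewrite sumEFin lee_fin -mulr_sumr ler_wpM2l//.
have w1' : (0 < 1 - w)%R by lra.
rewrite -[leRHS]mul1r ler_pdivlMr// mulrC.
have -> : ((1 - w) * \sum_(0 <= i < m) w ^+ i = 1 - w ^+ m)%R.
  elim: m => [|m IH]; first by rewrite big_geq// mulr0 expr0 subrr.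
  by rewrite big_nat_recr//= mulrDr IH exprS; ring.
by rewrite gerBl exprn_ge0// ltW.
Qed.

Lemma dyadic_scale (t : R) : (0 < t <= 1)%R ->
  exists k, (2^-1 ^+ k.+1 < t <= 2^-1 ^+ k)%R.
Proof.
move=> /andP[t0 t1].
have ex : exists k, (2^-1 ^+ k.+1 < t)%R.
  have half : (`|2^-1 : R| < 1)%R by rewrite ger0_norm; lra.
  have /cvgrPdist_lt/(_ _ t0)[k _ /(_ k.+1 (leqnSn k))] := cvg_expr half.
  by rewrite sub0r normrN ger0_norm ?exprn_ge0 ?invr_ge0// => h; exists k.
case: (ex_minnP ex) => k kt kmin; exists k; rewrite kt/=.
case: k kt kmin => [|k] kt kmin; first by rewrite expr0.
by rewrite leNgt; apply/negP => /kmin; rewrite ltnn.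
Qed.

Lemma le_weighted_power (x : \bar R) (l : R) m : (0 < l)%R -> 0 <= x ->
  x <= l%:E + (l ^- m)%:E * x ^+ m.+1.
Proof.
move=> l0 x0; have lV0 : (0 < l^-1)%R by rewrite invr_gt0.
have y0 : 0 <= l^-1%:E * x by rewrite mule_ge0// lee_fin ltW.
have l0' : 0 <= l%:E by rewrite lee_fin ltW.
have := lee_wpmul2l l0' (le_1Dexpe m y0).
rewrite muleA -EFinM divff ?gt_eqF// mul1e => /le_trans; apply.
rewrite ge0_muleDr ?expe_ge0// mule1 expeM muleA -EFin_expe -EFinM.
rewrite le_eqVlt; apply/orP; left; apply/eqP; congr (_ + _%:E * _).
by rewrite exprS exprVn mulrA divff ?mul1r// gt_eqF.
Qed.

Context {n : nat}.
Local Notation leb := (@lebesgue_rV R n).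
Implicit Types (x p z : 'rV[R]_n) (rho : 'rV[R]_n -> \bar R).

Definition segment_mean rho p z : \bar R :=
  \int[lebesgue_measure]_(t in `[0%R, 1%R]) rho (p + t *: (z - p))%R.

Section fixed.
Variables (rho : 'rV[R]_n -> \bar R) (p : 'rV[R]_n).
Hypotheses (mr : measurable_fun setT rho) (r0 : forall x, 0 <= rho x).

Let mpair : measurable_fun setT (fun u : 'rV[R]_n * R => rho (p + u.2 *: (u.1 - p))%R).
Proof.
apply: (measurableT_comp mr); apply: measurable_addrV; first exact: measurable_cst.
apply: measurable_scalerV => //.
by apply: measurable_addrV => //; exact: measurable_cst.
Qed.

Lemma measurable_segment_mean : measurable_fun setT (segment_mean rho p).
Proof. exact: (measurable_integral_in lebesgue_measure (measurable_itv _) mpair). Qed.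

Lemma segment_mean_ge0 z : 0 <= segment_mean rho p z.
Proof. exact: integral_ge0. Qed.

Lemma integral_homothety (r t : R) : (0 < r)%R -> (0 < t)%R ->
  \int[leb]_(z in cube p r) rho (p + t *: (z - p))%R =
  (t ^- n)%:E * \int[leb]_(z in cube p (t * r)) rho z.
Proof.
move=> rpos tpos; rewrite [LHS]integral_mkcond [in RHS]integral_mkcond.
have mg : measurable_fun setT (rho \_ (cube p (t * r))).
  by apply/(measurable_restrictT _ (measurable_cube _ _)); exact: measurable_funTS.
have g0 x : 0 <= (rho \_ (cube p (t * r))) x by apply: erestrict_ge0.
rewrite -(integral_rV_affine (p - t *: p)%R tpos mg g0).
apply: eq_integral => z _.
have -> : (p - t *: p + t *: z = p + t *: (z - p))%R by rewrite scalerBr addrAC addrA.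
rewrite !patchE; have -> // : (z \in cube p r) = ((p + t *: (z - p))%R \in cube p (t * r)).
have tr : (0 <= t * r)%R by rewrite mulr_ge0// ltW.
apply/idP/idP => /set_mem /cubeP h; apply/mem_set/cubeP => //; try exact: ltW.
  by rewrite addrC addKr normrZ gtr0_norm// ler_pM2l// h// ltW.
by move: h => /(_ tr); rewrite addrC addKr normrZ gtr0_norm// ler_pM2l.
Qed.

(** A form of Hoelder's inequality with the free parameter [l], to be optimized
    at each scale. *)
Lemma integral_cube_le (r k l : R) m : n = m.+1 -> (0 < r)%R -> (0 < l)%R ->
  \int[leb]_(y in cube p r) (rho y ^+ n) <= k%:E ->
  \int[leb]_(y in cube p r) rho y <= (l * (2 * r) ^+ n + l ^- m * k)%:E.
Proof.
move=> nm rpos l0 kP; have mX : measurable_fun setT (fun x => rho x ^+ n).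
  exact: measurable_funXe.
have mc := measurable_cube p r.
apply: (@le_trans _ _ (\int[leb]_(y in cube p r)
    (l%:E + (l ^- m)%:E * rho y ^+ n))).
  apply: ge0_le_integral => //.
  - exact: measurable_funTS.
  - apply: measurable_funTS; apply: emeasurable_funD => //.
    by apply: emeasurable_funM.
  - by move=> y _; rewrite nm; exact: le_weighted_power.
have lm0 : (0 <= l ^- m)%R by rewrite invr_ge0 exprn_ge0// ltW.
have X0 y : 0 <= rho y ^+ n by exact: expe_ge0.
rewrite ge0_integralD//; last 3 first.
- by move=> y _; rewrite lee_fin ltW.
- by move=> y _; rewrite mule_ge0// lee_fin.
- by apply: measurable_funTS; exact: emeasurable_funM.
rewrite integral_cst// [X in _ * X + _](lebesgue_cube p (ltW rpos)).
rewrite ge0_integralZl_EFin//; last exact: measurable_funTS.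
rewrite EFinD; apply: leeD; first by rewrite -EFinM.
by rewrite EFinM; apply: lee_wpmul2l; rewrite ?lee_fin.
Qed.

End fixed.

(** The homothety of ratio [t] centred at [p] turns the integral at time [t] into
    the mean of [rho] over [cube p (2 * t * r)]. For [t] of order [2^-k],
    Hoelder's inequality bounds this mean by a multiple of
    [eta / r * 2^k * w^k] with [w ^+ n = 1 / 2], since the energy on that
    cube is at most of order [eta ^+ n * 2^-k]. The factor [2^k] is
    compensated by the length [2^-k] of the interval of such times [t], and
    the sum over [k] is a convergent geometric series. *)
Lemma segment_mean_bound : (0 < n)%N -> exists2 C : R, (0 < C)%R &
  forall rho p x (r eta : R), measurable_fun setT rho -> (forall y, 0 <= rho y) ->
  (0 < r)%R -> (0 < eta)%R -> (`|p - x| <= r)%R ->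
  (forall s, (0 < s <= 2 * r)%R -> \int[leb]_(y in cube p s) (rho y ^+ n)
     <= (eta ^+ n * s / r)%:E) ->
  \int[leb]_(z in cube x r) ((enorm (z - p))%:E * segment_mean rho p z) <=
    (C * eta * r ^+ n)%:E.
Proof.
move=> n0; have [w [w0 w1 wn]] := half_root n0.
pose m := n.-1; have nm : n = m.+1 by rewrite /m prednK.
pose C1 : R := (4 ^+ n + 2 ^+ n)%R.
have C10 : (0 < C1)%R by rewrite addr_gt0// exprn_gt0.
pose C : R := (n%:R * 2 * (C1 / (1 - w)))%R.
have w1' : (0 < 1 - w)%R by lra.
exists C; first by rewrite !mulr_gt0 ?ltr0n// invr_gt0.
move=> rho p x r eta mr r0 rpos eta0 px good.
have r20 : (0 < 2 * r)%R by rewrite mulr_gt0.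
have mJ : measurable_fun setT (segment_mean rho p).
  exact: measurable_segment_mean.
have J0 z : 0 <= segment_mean rho p z by exact: segment_mean_ge0.
have mE : measurable_fun setT (fun z : 'rV[R]_n => (enorm (z - p))%:E).
  apply/measurable_EFinP; apply: (measurableT_comp (@measurable_enorm R n)).
  by apply: measurable_addrV => //; exact: measurable_cst.
have K0 : (0 <= n%:R * (2 * r))%R by rewrite mulr_ge0// ltW.
have mKJ : measurable_fun setT (fun z => (n%:R * (2 * r))%:E * segment_mean rho p z).
  by apply: emeasurable_funM; [exact: measurable_cst|exact: mJ].
apply: (@le_trans _ _ (\int[leb]_(z in cube p (2 * r))
    ((n%:R * (2 * r))%:E * segment_mean rho p z))).
  have sub : cube x r `<=` cube p (2 * r).
    move=> z /cubeP zx; apply/cubeP; first exact: ltW.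
    have := zx (ltW rpos) => {}zx.
    have -> : (z - p = (z - x) - (p - x))%R by rewrite opprB addrA subrK.
    by apply: le_trans (ler_normB _ _) _; lra.
  apply: (@le_trans _ _ (\int[leb]_(z in cube x r)
      ((n%:R * (2 * r))%:E * segment_mean rho p z))).
    apply: ge0_le_integral => //; first exact: measurable_cube.
    - by move=> z _; rewrite mule_ge0// lee_fin enorm_ge0.
    - by apply: measurable_funTS; apply: emeasurable_funM; [exact: mE|exact: mJ].
    - exact: measurable_funTS.
    - move=> z /sub /cubeP zp; apply: lee_wpmul2r => //; rewrite lee_fin.
      apply: le_trans (enorm_le_norm _) _.
      by rewrite ler_wpM2l// zp// ltW.
  apply: ge0_subset_integral => //; try exact: measurable_cube.
  - exact: measurable_funTS.
  - by move=> z _; rewrite mule_ge0// lee_fin.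
rewrite ge0_integralZl_EFin//; first last.
- exact: measurable_funTS.
- exact: measurable_cube.
have mpair : measurable_fun setT (fun u : 'rV[R]_n * R => rho (p + u.2 *: (u.1 - p))%R).
  apply: (measurableT_comp mr); apply: measurable_addrV; first exact: measurable_cst.
  apply: measurable_scalerV => //.
  by apply: measurable_addrV => //; exact: measurable_cst.
rewrite (tonelli_in leb lebesgue_measure (measurable_cube p (2 * r))
  (measurable_itv `[0%R, 1%R]) mpair)//.
pose H (t : R) := \int[leb]_(z in cube p (2 * r)) rho (p + t *: (z - p))%R.
have H0 t : 0 <= H t by exact: integral_ge0.
have mH : measurable_fun setT H.
  apply: (measurable_integral_in leb (f := fun u : R * 'rV[R]_n => rho (p + u.1 *: (u.2 - p))%R)) => //.
    exact: measurable_cube.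
  apply: (measurableT_comp mr); apply: measurable_addrV; first exact: measurable_cst.
  apply: measurable_scalerV => //.
  by apply: measurable_addrV => //; exact: measurable_cst.
pose a k : R := (r ^+ m * eta * (4 ^+ n * (w ^+ k * 2 ^+ k) + 2 * (w ^+ k / 2) ^- m))%R.
have a0 k : (0 <= a k)%R.
  rewrite /a mulr_ge0//; first by rewrite mulr_ge0 ?exprn_ge0// ltW.
  by rewrite addr_ge0// !mulr_ge0// ?invr_ge0 ?exprn_ge0// ?divr_ge0 ?exprn_ge0// ltW.
pose h k (t : R) : \bar R := (a k)%:E * (\1_(`[0%R, 2^-1 ^+ k]%classic : set R) t)%:E.
have h0 k t : 0 <= h k t by rewrite mule_ge0 ?lee_fin.
have mh k : measurable_fun setT (h k).
  by apply: emeasurable_funM => //; apply/measurable_EFinP; exact: measurable_indic.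
have Hh t : (0 < t <= 1)%R -> H t <= \sum_(k <oo) h k t.
  move=> t01; have [k /andP[kt tk]] := dyadic_scale t01.
  have /andP[t0 t1] := t01.
  have hk : h k t = (a k)%:E.
    by rewrite /h indicE mem_set ?mule1//= in_itv/= (ltW t0).
  apply: (@le_trans _ _ (h k t)); last first.
    apply: (@le_trans _ _ (\sum_(0 <= i < k.+1) h i t)); last first.
      by apply: nneseries_lim_ge => i _.
    by rewrite big_nat_recr//= leeDr//; apply: sume_ge0.
  rewrite hk /H (integral_homothety p mr r0 r20 t0).
  (* The order of the mean of [rho] at this scale: it balances the two terms of
     [integral_cube_le]. *)
  pose l : R := (eta * (w ^+ k * 2 ^+ k) / r)%R.
  have l0 : (0 < l)%R by rewrite divr_gt0// mulr_gt0// mulr_gt0// exprn_gt0.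
  have tr0 : (0 < t * (2 * r))%R by rewrite mulr_gt0.
  have gs : (0 < t * (2 * r) <= 2 * r)%R by rewrite tr0/= ler_piMl// ltW.
  have := integral_cube_le mr r0 nm tr0 l0 (good _ gs).
  have tn0 : (0 <= t ^- n)%R by rewrite invr_ge0 exprn_ge0// ltW.
  have tn0' : 0 <= (t ^- n)%:E by rewrite lee_fin.
  move=> /(lee_wpmul2l tn0') /le_trans; apply.
  rewrite -EFinM lee_fin /a (_ : t ^- n * _ =
      r ^+ m * eta * (4 ^+ n * (w ^+ k * 2 ^+ k) + 2 * ((w ^+ k * 2 ^+ k) * t) ^- m))%R; last first.
    rewrite /l (_ : 2 * (t * (2 * r)) = 4 * t * r)%R; last by ring.
    rewrite nm !exprS !exprMn exprVn; field.
    by rewrite !expf_neq0 ?gt_eqF// ?exprn_gt0.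
  apply: ler_wpM2l; first by rewrite mulr_ge0 ?exprn_ge0// ltW.
  rewrite lerD2l ler_wpM2l//.
  have wk0 : (0 < w ^+ k)%R by rewrite exprn_gt0.
  have wk2 : (0 < w ^+ k / 2)%R by rewrite divr_gt0.
  have wt : (w ^+ k / 2 <= w ^+ k * 2 ^+ k * t)%R.
    rewrite -mulrA ler_wpM2l ?(ltW wk0)//.
    have -> : (2^-1 = 2 ^+ k * 2^-1 ^+ k.+1 :> R)%R.
      by rewrite exprS mulrCA -exprMn divff// expr1n mulr1.
    by rewrite ler_wpM2l ?exprn_ge0// ltW.
  have wt0 := lt_le_trans wk2 wt.
  rewrite lef_pV2 ?posrE; [|exact: exprn_gt0..].
  by apply: lerXn2r; rewrite ?nnegrE// ltW.
apply: (@le_trans _ _ ((n%:R * (2 * r))%:E * \int[lebesgue_measure]_(t in `]0%R, 1%R]) H t)).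
  apply: lee_wpmul2l; first by rewrite lee_fin.
  rewrite integral_itv_obnd_cbnd//; exact: measurable_funTS.
have mS : measurable_fun setT (fun t => \sum_(k <oo) h k t).
  by apply: ge0_emeasurable_sum.
apply: (@le_trans _ _ ((n%:R * (2 * r))%:E * \sum_(k <oo) (r ^+ m * eta * C1 * w ^+ k)%:E)).
  apply: lee_wpmul2l; first by rewrite lee_fin.
  apply: (@le_trans _ _ (\int[lebesgue_measure]_(t in `]0%R, 1%R]) \sum_(k <oo) h k t)).
    apply: ge0_le_integral => //; try exact: measurable_funTS.
  apply: (@le_trans _ _ (\int[lebesgue_measure]_t \sum_(k <oo) h k t)).
    by apply: ge0_subset_integral => // t _; apply: nneseries_ge0.
  rewrite integral_nneseries//; apply: lee_nneseries.
    by move=> *; apply: integral_ge0 => *; exact: h0.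
  move=> k _.
  rewrite /h ge0_integralZl_EFin//; last first.
    by apply/measurable_EFinP; exact: measurable_indic.
  have lE : lebesgue_measure (`[0%R, (2^-1 ^+ k)%R]%classic : set R) = (2^-1 ^+ k)%:E.
    have h2 : (0 < 2^-1 ^+ k :> R)%R by rewrite exprn_gt0.
    by rewrite lebesgue_measure_itv/= lte_fin h2 -EFinB subr0.
  rewrite integral_indic// setIT [X in _ * X]lE -EFinM lee_fin /a /C1.
  have e1 : (2^-1 ^+ k = w ^+ k * w ^+ k ^+ m :> R)%R.
    by rewrite -wn -exprS -nm -!exprM mulnC.
  have e2 : (2 ^+ k * 2^-1 ^+ k = 1 :> R)%R by rewrite -exprMn divff// expr1n.
  have wk0 : (0 < w ^+ k)%R by rewrite exprn_gt0.
  rewrite le_eqVlt; apply/orP; left; apply/eqP.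
  rewrite -[LHS]mulrA -[RHS]mulrA; congr (_ * _)%R.
  rewrite [LHS]mulrDl [RHS]mulrDl; congr (_ + _)%R; first by rewrite -!mulrA e2 mulr1.
  rewrite e1 nm (exprS 2 m) exprMn exprVn invfM invrK; field.
  by rewrite expf_neq0// gt_eqF.
apply: le_trans (lee_wpmul2l _ (geometric_nneseries_le w0 w1 _)) _.
- by rewrite lee_fin.
- by rewrite !mulr_ge0 ?exprn_ge0// ltW.
rewrite -EFinM lee_fin /C le_eqVlt; apply/orP; left; apply/eqP.
by rewrite nm exprS; ring.
Qed.

End segment_means.

(** * Cones over null sets of directions *)

Section cones.
Context {R : realType} {n : nat}.
Local Open Scope ereal_scope.
Local Notation leb := (@lebesgue_rV R n).
Implicit Types (W E : set 'rV[R]_n) (x w : 'rV[R]_n).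

Lemma negligible_small_covers d (T : measurableType d) (mu : {measure set T -> \bar R})
    (N : set T) : (forall e : R, (0 < e)%R ->
      exists A, [/\ measurable A, N `<=` A & mu A <= e%:E]) -> mu.-negligible N.
Proof.
move=> H; have e0 k : (0 < k.+1%:R^-1 :> R)%R by [].
have [A AP] := choice (fun k => H _ (e0 k)).
exists (\bigcap_k A k); split.
- by apply: bigcapT_measurable => k; have [] := AP k.
- apply/le_anti; rewrite measure_ge0 andbT; apply/lee_addgt0Pr => e e1.
  rewrite add0e; have [k _ /(_ k (leqnn k)) ke] := near_infty_natSinv_lt (PosNum e1).
  have [mA _ muA] := AP k; apply: le_trans (le_trans muA _); last by rewrite lee_fin ltW.
  apply: le_measure; rewrite ?inE//.
    by apply: bigcapT_measurable => i; have [] := AP i.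
  by apply: bigcap_inf.
- by move=> z Nz k _; have [_ NA _] := AP k; exact: NA.
Qed.

Lemma ediam_ge0 E : 0 <= ediam E.
Proof. by apply: ereal_sup_ubound; left. Qed.

Lemma enorm_le_ediam E (u v : 'rV[R]_n) : E u -> E v ->
  (enorm (u - v))%:E <= ediam E.
Proof. by move=> Eu Ev; apply: ereal_sup_ubound; right; exists u => //; exists v. Qed.

Definition cone x W (r : R) : set 'rV[R]_n :=
  [set z | exists t w, [/\ W w, (0 <= t <= r)%R & z = (x + t *: w)%R]].

(** A cone over a set of directions of diameter [s] stays within [(r + 1) * s] of
    the points at distance a multiple of [s] from the vertex along any one of
    its rays. There are about [r / s] such points, so the cubes around them
    have total measure of order [s ^+ n.-1]. *)
Lemma cone_cover x W E (r s : R) : (0 < n)%N -> W `<=` unit_sphere -> (0 < r)%R -> (0 < s)%R ->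
  (s <= 2)%R -> ediam E <= s%:E -> exists A, [/\ measurable A,
    cone x (W `&` E) r `<=` A & leb A <= ((2 * (r + 1)) ^+ n * (r + 2) * s ^+ n.-1)%:E].
Proof.
move=> n0 WS r0 s0 s2 Es.
have [[w [Ww Ew]]|nWE] := pselect (exists w, (W `&` E) w); last first.
  exists set0; split => //; first by move=> z [t [w [? _ _]]]; exfalso; apply: nWE; exists w.
  rewrite measure0 lee_fin !mulr_ge0// ?exprn_ge0// ?mulr_ge0// ?addr_ge0// ltW//.
pose N := (Num.truncn (r / s)).+1.
pose Q (j : nat) := cube (x + (j%:R * s) *: w)%R ((r + 1) * s)%R.
have rs0 : (0 < (r + 1) * s)%R by rewrite mulr_gt0// addr_gt0.
have mQ j : measurable (Q j) by exact: measurable_cube.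
exists (\big[setU/set0]_(j < N) Q j); split.
- by apply: bigsetU_measurable => j _; exact: mQ.
- move=> z [t [v [[Wv Ev] /andP[t0 tr] ->]]]; rewrite -bigcup_mkord.
  have ts0 : (0 <= t / s)%R by rewrite divr_ge0// ltW.
  exists (Num.truncn (t / s)).
    by rewrite /= /N ltnS; apply: le_truncn; rewrite ler_pM2r// invr_gt0.
  apply/cubeP; first exact: ltW.
  set j := Num.truncn (t / s).
  have /andP[j1 j2] : (j%:R <= t / s < j.+1%:R)%R by rewrite /j truncn_itv.
  have -> : (x + t *: v - (x + (j%:R * s) *: w) =
      t *: (v - w) + (t - j%:R * s) *: w)%R.
    by rewrite opprD addrACA subrr add0r scalerBr scalerBl addrA subrK.
  apply: le_trans (ler_normD _ _) _; rewrite !normrZ.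
  have vw : (`|v - w| <= s)%R.
    apply: le_trans (norm_le_enorm _) _; rewrite -lee_fin.
    by apply: le_trans Es; exact: enorm_le_ediam.
  have w1 : (`|w| <= 1)%R.
    by apply: le_trans (norm_le_enorm _) _; have := WS _ Ww; rewrite /unit_sphere/= => ->.
  have tj : (`|t - j%:R * s| <= s)%R.
    move: j1 j2; rewrite ler_pdivlMr// ltr_pdivrMr// -natr1 => j1 j2.
    by rewrite ger0_norm; lra.
  rewrite ger0_norm//.
  have := ler_pM (normr_ge0 _) (normr_ge0 _) tj w1.
  have := ler_pM t0 (normr_ge0 _) tr vw; lra.
- apply: (@le_trans _ _ (\sum_(j < N) leb (Q j))).
    apply: content_subadditive => //; first by apply: bigsetU_measurable => j _; exact: mQ.
  rewrite (eq_bigr (fun=> ((2 * ((r + 1) * s)) ^+ n)%:E)); last first.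
    by move=> j _; rewrite [LHS](lebesgue_cube _ (ltW rs0)).
  rewrite sumEFin lee_fin sumr_const card_ord -[leLHS]mulr_natl mulrA exprMn mulrCA.
  rewrite -[leRHS]mulrA ler_wpM2l ?exprn_ge0 ?mulr_ge0 ?addr_ge0// ?(ltW r0)//.
  rewrite -[in leLHS](prednK n0) exprS mulrA ler_wpM2r ?exprn_ge0 ?(ltW s0)//.
  have : (N%:R <= r / s + 1)%R.
    have rs : (0 <= r / s)%R by rewrite divr_ge0// ltW.
    by rewrite /N -natr1 lerD2r; have /andP[] := truncn_itv rs.
  move=> /(ler_wpM2r (ltW s0)) /le_trans; apply.
  by rewrite mulrDl divfK ?gt_eqF// mul1r lerD2l.
Qed.

(** A covering of [W] whose sum of [n.-1]-th powers of diameters is small gives,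
    by [cone_cover], a covering of the cone of small measure. *)
Lemma cone_negligible x W (r : R) : (2 <= n)%N -> W `<=` unit_sphere -> (0 < r)%R ->
  hausdorff_measure n.-1 W = 0 -> leb.-negligible (cone x W r).
Proof.
move=> n2 WS r0 HW; apply: negligible_small_covers => e e0.
have m0 : (0 < n.-1)%N by case: (n) n2 => [|[|]].
have n0 : (0 < n)%N by exact: leq_trans n2.
pose K : R := ((2 * (r + 1)) ^+ n * (r + 2))%R.
have K0 : (0 < K)%R by rewrite mulr_gt0 ?exprn_gt0 ?mulr_gt0 ?addr_gt0.
pose c : R := (K * 2 ^+ n.-2)%R.
have c0 : (0 < c)%R by rewrite mulr_gt0// exprn_gt0.
pose eps := Num.min 1%R (e / (2 * c))%R.
have eps0 : (0 < eps)%R by rewrite lt_min ltr01 divr_gt0// mulr_gt0.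
have eps1 : (eps <= 1)%R by rewrite ge_min lexx.
have epsc : (c * (2 * eps) <= e)%R.
  have : (eps <= e / (2 * c))%R by rewrite ge_min lexx orbT.
  have h : (0 < 2 * c)%R by exact: mulr_gt0.
  by rewrite ler_pdivlMr// (_ : eps * (2 * c) = c * (2 * eps))%R//; ring.
have : hausdorff_content n.-1 1 W < eps%:E.
  apply: (@le_lt_trans _ _ 0); last by rewrite lte_fin.
  by rewrite -HW; apply: ereal_sup_ubound; exists 1%R => //=.
move=> /ereal_inf_lt[_ [E [WE E1] <-] Esum].
have dfin k : ediam (E k) \is a fin_num.
  by rewrite ge0_fin_numE ?ediam_ge0// (le_lt_trans (E1 k))// ltry.
pose d k := fine (ediam (E k)).
have d0 k : (0 <= d k)%R by apply: fine_ge0; exact: ediam_ge0.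
have dE k : (d k)%:E = ediam (E k) by rewrite fineK.
have d1 k : (d k <= 1)%R by rewrite -lee_fin dE.
(* [cone_cover] needs a positive diameter, so each diameter is enlarged by a
   summable [g k]. *)
pose g k := (eps / 2 ^+ k.+1)%R.
have g0 k : (0 < g k)%R by rewrite divr_gt0// exprn_gt0.
have g1 k : (g k <= 1)%R.
  by rewrite ler_pdivrMr ?exprn_gt0// mul1r (le_trans eps1)// exprn_ege1// ler1n.
have s0 k : (0 < d k + g k)%R by rewrite ltr_wpDl.
have s2 k : (d k + g k <= 2)%R by have := d1 k; have := g1 k; lra.
have dg k : ediam (E k) <= (d k + g k)%:E by rewrite -dE lee_fin lerDl ltW.
have [A AP] := choice (fun k => cone_cover x n0 WS r0 (s0 k) (s2 k) (dg k)).
have mA k : measurable (A k) by have [] := AP k.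
exists (\bigcup_k A k); split.
- exact: bigcupT_measurable.
- move=> z [t [w [Ww tr zE]]]; have [k _ Ekw] := WE _ Ww.
  by exists k => //; have [_ + _] := AP k; apply; exists t, w; split.
apply: (@le_trans _ _ (\sum_(k <oo) leb (A k))).
  by apply: measure_sigma_subadditive => //; exact: bigcupT_measurable.
apply: (@le_trans _ _ (\sum_(k <oo) (c%:E * (ediam (E k) ^+ n.-1 + (g k)%:E)))).
  apply: lee_nneseries => // k _; have [_ _ AK] := AP k.
  apply: le_trans AK _; rewrite -/K -dE -EFin_expe -EFinD -EFinM lee_fin /c -[leRHS]mulrA.
  apply: ler_wpM2l; first exact: ltW.
  have half : (0 < (2^-1 : R) < 1)%R by apply/andP; split; lra.
  have := power_convex n.-2 half (d0 k) (ltW (g0 k)).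
  have -> : (1 - 2^-1 = 2^-1 :> R)%R by field.
  rewrite exprVn invrK -mulrDr (_ : n.-2.+1 = n.-1); last by rewrite prednK.
  move=> /le_trans; apply; apply: ler_wpM2l; first exact: exprn_ge0.
  rewrite lerD2l -(prednK m0) exprS ler_piMr// ?(ltW (g0 k))//.
  by rewrite exprn_ile1// ltW.
have G0 k : 0 <= ediam (E k) ^+ n.-1 by rewrite expe_ge0// ediam_ge0.
have g0' k : 0 <= (g k)%:E by rewrite lee_fin ltW.
rewrite nneseriesZl; last by move=> k _; rewrite adde_ge0.
rewrite nneseriesD//.
apply: (@le_trans _ _ (c%:E * (eps%:E + eps%:E))).
  apply: lee_wpmul2l; first by rewrite lee_fin ltW.
  apply: leeD; first exact: ltW.
  by apply: sum_geometric_le => //; exact: ltW.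
by rewrite -EFinD -EFinM lee_fin -mulr2n -mulr_natl.
Qed.

End cones.

(** * Radial segments, reversal and concatenation *)

Section radial_curves.
Context {R : realType} {n : nat}.
Local Notation leb := (@lebesgue_rV R n).
Implicit Types (x p q z w : 'rV[R]_n) (rho : 'rV[R]_n -> \bar R) (c d : curve R n).

Definition direction p z : 'rV[R]_n := (enorm (z - p))^-1 *: (z - p).

Lemma enorm_gt0 p z : z != p -> 0 < enorm (z - p).
Proof.
move=> zp; rewrite lt_neqAle enorm_ge0 andbT eq_sym.
by apply: contra_neq zp => /enorm_eq0/eqP; rewrite subr_eq0 => /eqP.
Qed.

Lemma enorm_direction p z : z != p -> enorm (direction p z) = 1.
Proof.
move=> zp; rewrite /direction enormZ ger0_norm ?invr_ge0 ?enorm_ge0//.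
by rewrite mulVf// gt_eqF// enorm_gt0.
Qed.

Lemma scale_direction p z : z != p -> enorm (z - p) *: direction p z = z - p.
Proof. by move=> zp; rewrite /direction scalerA divff ?scale1r// gt_eqF// enorm_gt0. Qed.

Lemma radialE p w (r : R) (r0 : 0 <= r) t : 0 <= t <= r ->
  radial_segment p w r0 t = p + t *: w.
Proof. by move=> tr; rewrite mk_curveE// in_itv. Qed.

Lemma reverseE c t : lo c <= t <= hi c -> reverse c t = c (lo c + hi c - t).
Proof. by move=> tc; rewrite mk_curveE// in_itv. Qed.

Lemma trace_reverse c : trace (reverse c) `<=` trace c.
Proof.
move=> _ [t tc <-]; have /andP[t1 t2] : lo c <= t <= hi c by move: tc; rewrite /= in_itv.
rewrite reverseE ?t1//; exists (lo c + hi c - t) => //=.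
by rewrite in_itv/=; apply/andP; split; lra.
Qed.

Lemma trace_concat c d (cd : c (hi c) = d (lo d)) :
  trace (concat cd) `<=` trace c `|` trace d.
Proof.
move=> _ [t tc <-]; have ld := lo_le_hi d.
have /andP[t1 t2] : lo c <= t <= hi c + (hi d - lo d) by move: tc; rewrite /= in_itv.
have [tc'|ct] := leP t (hi c).
  left; rewrite concatE1 ?t1//; exists t => //=; by rewrite in_itv/= t1.
right; have td : lo d <= t - (hi c - lo d) <= hi d.
  by clear cd tc; apply/andP; split; lra.
have -> : t = (t - (hi c - lo d)) + (hi c - lo d) by rewrite subrK.
by rewrite concatE2//; exists (t - (hi c - lo d)).
Qed.

Lemma concat_lo c d (cd : c (hi c) = d (lo d)) : concat cd (lo (concat cd)) = c (lo c).
Proof. by rewrite concatE1//= lexx lo_le_hi. Qed.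

Lemma concat_hi c d (cd : c (hi c) = d (lo d)) : concat cd (hi (concat cd)) = d (hi d).
Proof.
have -> : hi (concat cd) = hi d + (hi c - lo d) by rewrite /=; ring.
by rewrite concatE2// lexx lo_le_hi.
Qed.

Lemma integral_segment_scale rho p w (k : R) : 0 < k ->
  measurable_fun setT rho -> (forall x, 0 <= rho x)%E ->
  (\int[lebesgue_measure]_(s in `[0%R, k]) rho (p + s *: w)%R =
   k%:E * \int[lebesgue_measure]_(t in `[0%R, 1%R]) rho (p + t *: (k *: w))%R)%E.
Proof.
move=> k0 mr r0.
have mf : measurable_fun setT (fun s : R => rho (p + s *: w)%R).
  apply: (measurableT_comp mr); apply: measurable_addrV; first exact: measurable_cst.
  by apply: measurable_scalerV => //; exact: measurable_cst.
pose f := (fun s : R => rho (p + s *: w)%R) \_ `[0%R, k].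
have mg : measurable_fun setT f.
  by apply/(measurable_restrictT _ (measurable_itv _)); exact: measurable_funTS.
have f0 (u : R) : (0 <= f u)%E by apply: erestrict_ge0.
have e := integral_affine 0 (lt0r_neq0 k0) mg f0; rewrite gtr0_norm// in e.
rewrite [LHS]integral_mkcond -/f.
transitivity (k%:E * \int[lebesgue_measure]_x f (k * x + 0)%R)%E.
  by rewrite e muleA -EFinM divff ?gt_eqF// mul1e.
congr (_ * _)%E.
rewrite [RHS]integral_mkcond; apply: eq_integral => t _.
rewrite /f !patchE addr0 scalerA mulrC; congr (if _ then _ else _).
by apply/idP/idP => /set_mem /=; rewrite in_itv/= => /andP[t1 t2];
  apply/mem_set; rewrite /= in_itv/=; apply/andP; split; nra.
Qed.

Lemma integral_segment_reflect rho p w (k : R) :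
  measurable_fun setT rho -> (forall x, 0 <= rho x)%E ->
  (\int[lebesgue_measure]_(s in `[0%R, k]) rho (p + k *: w + s *: (- w))%R =
   \int[lebesgue_measure]_(s in `[0%R, k]) rho (p + s *: w)%R)%E.
Proof.
move=> mr r0.
have mf : measurable_fun setT (fun s : R => rho (p + s *: w)%R).
  apply: (measurableT_comp mr); apply: measurable_addrV; first exact: measurable_cst.
  by apply: measurable_scalerV => //; exact: measurable_cst.
pose f := (fun s : R => rho (p + s *: w)%R) \_ `[0%R, k].
have mg : measurable_fun setT f.
  by apply/(measurable_restrictT _ (measurable_itv _)); exact: measurable_funTS.
have f0 (u : R) : (0 <= f u)%E by apply: erestrict_ge0.
have N1 : (-1 : R) != 0 by rewrite oppr_eq0 oner_neq0.
rewrite [RHS]integral_mkcond -/f.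
have := integral_affine k N1 mg f0; rewrite normrN1 invr1 mul1e => <-.
rewrite integral_mkcond; apply: eq_integral => s _.
rewrite /f !patchE scalerN -addrA -scalerBl mulN1r [- s + k]addrC; congr (if _ then _ else _).
by apply/idP/idP => /set_mem /=; rewrite in_itv/= => /andP[t1 t2];
  apply/mem_set; rewrite /= in_itv/=; apply/andP; split; lra.
Qed.

Section segment.
Variables (rho : 'rV[R]_n -> \bar R) (p z : 'rV[R]_n).
Hypotheses (mr : measurable_fun setT rho) (r0 : forall x, (0 <= rho x)%E) (zp : z != p).
Let d0 := enorm_ge0 (z - p).

(** The segment from [p] to [z] is taken as a radial one, of unit speed, to match
    [P_radial]. *)
Definition segment : curve R n := radial_segment p (direction p z) d0.

Lemma segmentE t : 0 <= t <= enorm (z - p) -> segment t = p + t *: direction p z.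
Proof. exact: radialE. Qed.

Lemma segment_lo : segment (lo segment) = p.
Proof. by rewrite segmentE/= ?lexx// scale0r addr0. Qed.

Lemma segment_hi : segment (hi segment) = z.
Proof. by rewrite segmentE/= ?lexx ?d0// scale_direction// addrC subrK. Qed.

Lemma rectifiable_segment : rectifiable segment.
Proof.
by apply: (@rectifiable_unit_speed _ _ segment p (direction p z));
  [|exact: enorm_direction|exact: segmentE].
Qed.

Lemma line_integral_segment :
  line_integral rho segment = ((enorm (z - p))%:E * segment_mean rho p z)%E.
Proof.
rewrite (@line_integral_unit_speed _ _ segment p (direction p z))//; first last.
- exact: segmentE.
- exact: enorm_direction.
rewrite [LHS]integral_segment_scale ?enorm_gt0//.
by rewrite scale_direction.
Qed.

Lemma reverse_segmentE t : 0 <= t <= enorm (z - p) ->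
  reverse segment t = p + enorm (z - p) *: direction p z + t *: (- direction p z).
Proof.
move=> /andP[t1 t2]; rewrite reverseE ?t1// [lo _]/= [hi _]/= add0r segmentE.
  by rewrite scalerN -addrA -scalerBl.
by apply/andP; split; lra.
Qed.

Let enormN1 : enorm (- direction p z) = 1. Proof. by rewrite enormN enorm_direction. Qed.

Lemma reverse_segment_lo : reverse segment (lo (reverse segment)) = z.
Proof.
by rewrite reverse_segmentE/= ?lexx ?d0// scale0r addr0 scale_direction// addrC subrK.
Qed.

Lemma reverse_segment_hi : reverse segment (hi (reverse segment)) = p.
Proof.
by rewrite reverse_segmentE/= ?lexx ?d0// scalerN addrK.
Qed.

Lemma rectifiable_reverse_segment : rectifiable (reverse segment).
Proof. exact: (@rectifiable_unit_speed _ _ (reverse segment) _ _ erefl enormN1 reverse_segmentE). Qed.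

Lemma line_integral_reverse_segment :
  line_integral rho (reverse segment) = ((enorm (z - p))%:E * segment_mean rho p z)%E.
Proof.
rewrite (@line_integral_unit_speed _ _ (reverse segment) _ _ erefl enormN1 reverse_segmentE).
by rewrite [LHS]integral_segment_reflect// integral_segment_scale ?enorm_gt0// scale_direction.
Qed.

Lemma trace_segment x (r : R) : `|p - x| <= r -> `|z - x| <= r ->
  trace segment `<=` cube x r.
Proof.
move=> px zx _ [t tc <-]; have rr : 0 <= r by exact: le_trans px.
have ez := enorm_gt0 zp.
have /andP[t1 t2] : 0 <= t <= enorm (z - p) by move: tc; rewrite /= in_itv.
rewrite segmentE ?t1//; apply/cubeP => //.
pose u := t / enorm (z - p).
have u0 : 0 <= u by apply: divr_ge0 => //; exact: ltW.
have u1 : u <= 1 by rewrite ler_pdivrMr// mul1r.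
have -> : p + t *: direction p z - x = (1 - u) *: (p - x) + u *: (z - x).
  have -> : z - x = (z - p) + (p - x) by rewrite addrA subrK.
  have e : (1 - u) *: (p - x) + u *: (p - x) = p - x by rewrite -scalerDl subrK scale1r.
  rewrite [u *: (z - p + _)]scalerDr addrCA e /direction scalerA -/u.
  by rewrite addrAC addrC.
clearbody u; apply: le_trans (ler_normD _ _) _.
rewrite !normrZ (ger0_norm u0) ger0_norm ?subr_ge0//.
have u2 : 0 <= 1 - u by lra.
have := ler_wpM2l u0 zx; have := ler_wpM2l u2 px.
by lra.
Qed.

End segment.

End radial_curves.

(** * Joining two good points inside the family *)

Section joining.
Context {R : realType} {n : nat}.
Local Notation leb := (@lebesgue_rV R n).
Implicit Types (x p q z w : 'rV[R]_n) (rho : 'rV[R]_n -> \bar R) (c d : curve R n).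
Variable F : set (curve R n).
Hypotheses (PF : P_family F) (n2 : (2 <= n)%N).

Let n0 : (0 < n)%N. Proof. exact: leq_trans n2. Qed.

(** By [P_radial] the excluded directions form a null set, and the points seen
    from [p] in these directions form a cone. *)
Lemma bad_direction_negligible p (r : R) (r0 : 0 < r) :
  leb.-negligible [set z | z = p \/ (enorm (z - p) <= r /\
    ~ F (radial_segment p (direction p z) (ltW r0)))].
Proof.
pose W := [set w : 'rV[R]_n | unit_sphere w /\ ~ F (radial_segment p w (ltW r0))].
have nW : leb.-negligible (cone p W r).
  by apply: cone_negligible => // [w []//|]; exact: (P_radial PF).
have np : leb.-negligible [set p].
  exists (cube p 0); split; first exact: measurable_cube.
    by rewrite [LHS](lebesgue_cube _ (lexx 0)) mulr0 expr0n; case: (n) n0.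
  by move=> _ /= ->; apply/cubeP => //; rewrite subrr normr0.
apply: negligibleS (negligibleU np nW) => z /=.
have [->|zp] := eqVneq z p; first by left.
move=> [->|[zr Fz]]; [by left|right].
exists (enorm (z - p)), (direction p z); split.
- by split => //; exact: enorm_direction.
- by rewrite enorm_ge0.
- by rewrite scale_direction// addrC subrK.
Qed.

Lemma segment_in_family p z (r : R) (r0 : 0 < r) : enorm (z - p) <= r ->
  F (radial_segment p (direction p z) (ltW r0)) -> F (segment p z).
Proof.
move=> zr /(P_subpath PF); apply; split => // t tz.
have /andP[t1 t2] : 0 <= t <= enorm (z - p) by move: tz; rewrite in_itv.
by rewrite segmentE ?t1// radialE// t1 (le_trans t2).
Qed.

Lemma interior_not_boundary c t : F c -> lo c <= t <= hi c ->
  c t != c (lo c) -> c t != c (hi c) -> ~ family_boundary F (c t).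
Proof.
move=> Fc tc /eqP n1 /eqP n2' [_ /(_ c Fc)]; apply; split.
  by exists t => //=; rewrite in_itv.
by case.
Qed.

(** The point [z] is interior to the longer radial segment issued from [p]. *)
Lemma segment_end_not_boundary p z (r : R) (r0 : 0 < r) : z != p -> enorm (z - p) < r ->
  F (radial_segment p (direction p z) (ltW r0)) -> ~ family_boundary F z.
Proof.
move=> zp zr Fz.
have ez := enorm_ge0 (z - p).
have tz : 0 <= enorm (z - p) <= r by rewrite ez ltW.
have zE : radial_segment p (direction p z) (ltW r0) (enorm (z - p)) = z.
  by rewrite radialE// scale_direction// addrC subrK.
rewrite -[X in family_boundary _ X]zE; apply: interior_not_boundary => //.
  by rewrite zE [lo _]/= radialE ?lexx ?ltW// scale0r addr0.
rewrite zE [hi _]/= radialE ?lexx ?ltW//; apply/eqP => e.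
have : enorm (z - p) = r.
  by rewrite {1}e addrC addKr enormZ enorm_direction// mulr1 gtr0_norm.
by move=> e'; rewrite e' ltxx in zr.
Qed.

(** For [z] in [cube x r] consider the two segments from [p] to [z] and from [z]
    to [q]. Since [p] and [q] are good points, the mean over [z] of the sum
    of the two line integrals is at most a multiple of [eta] by
    [segment_mean_bound]; so some [z] outside the negligible set of bad
    endpoints does as well as the mean. As [z] does not lie in the boundary
    of the family, [P_concat] permits concatenation at [z]. *)
Lemma joining_curve : exists2 C : R, 0 < C &
  forall rho p q x (r eta : R), measurable_fun setT rho -> (forall y, (0 <= rho y)%E) ->
  0 < r -> 0 < eta -> `|p - x| <= r -> `|q - x| <= r ->
  (forall s, 0 < s <= 2 * r ->
    (\int[leb]_(y in cube p s) (rho y ^+ n) <= (eta ^+ n * s / r)%:E)%E) ->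
  (forall s, 0 < s <= 2 * r ->
    (\int[leb]_(y in cube q s) (rho y ^+ n) <= (eta ^+ n * s / r)%:E)%E) ->
  exists c, [/\ F c /\ rectifiable c, c (lo c) = p, c (hi c) = q, trace c `<=` cube x r &
    (line_integral rho c <= (C * eta)%:E)%E].
Proof.
have [C C0 HC] := @segment_mean_bound R n n0.
exists (2 * C) => [|rho p q x r eta mr rho0 r0 eta0 px qx gp gq]; first exact: mulr_gt0.
pose g z := ((enorm (z - p))%:E * segment_mean rho p z +
  (enorm (z - q))%:E * segment_mean rho q z)%E.
have h0 p' z : (0 <= (enorm (z - p'))%:E * segment_mean rho p' z)%E.
  by rewrite mule_ge0 ?lee_fin ?enorm_ge0 ?segment_mean_ge0.
have mh p' : measurable_fun setT (fun z => ((enorm (z - p'))%:E * segment_mean rho p' z)%E).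
  apply: emeasurable_funM; last exact: measurable_segment_mean.
  apply/measurable_EFinP; apply: (measurableT_comp (@measurable_enorm R n)).
  by apply: measurable_addrV; [exact: measurable_id|exact: measurable_cst].
(* Any radius exceeding the Euclidean diameter of the cube: every [z] in the
   cube is then interior to the radial segment of length [L] through it. *)
pose L := n%:R * (2 * r) + 1.
have L0 : 0 < L by rewrite ltr_wpDl// mulr_ge0// mulr_ge0// ltW.
have nB := negligibleU (bad_direction_negligible p L0) (bad_direction_negligible q L0).
have M0 : 0 < 2 * C * eta by rewrite !mulr_gt0.
have [z [zx zB gz]] : exists z, [/\ cube x r z, ~ ([set z | z = p \/ (enorm (z - p) <= L /\
    ~ F (radial_segment p (direction p z) (ltW L0)))] `|`
    [set z | z = q \/ (enorm (z - q) <= L /\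
    ~ F (radial_segment q (direction q z) (ltW L0)))]) z & (g z < (2 * C * eta)%:E)%E].
  apply: (exists_lt_mean (mu := leb)) nB (ltW M0) _.
  - exact: measurable_cube.
  - by apply: measurable_funTS; exact: emeasurable_funD.
  - by move=> z; rewrite adde_ge0.
  - rewrite ge0_integralD//; first last.
    + exact: measurable_funTS.
    + exact: measurable_funTS.
    + exact: measurable_cube.
    apply: le_lt_trans (leeD (HC _ _ _ _ _ mr rho0 r0 eta0 px gp)
      (HC _ _ _ _ _ mr rho0 r0 eta0 qx gq)) _.
    rewrite [X in (_ < _ * X)%E](lebesgue_cube _ (ltW r0)) -EFinD -EFinM lte_fin.
    have -> : C * eta * r ^+ n + C * eta * r ^+ n = 2 * C * eta * r ^+ n by ring.
    rewrite ltr_pM2l// ltr_pXn2r ?nnegrE ?mulr_ge0 ?(ltW r0)//.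
    by lra.
have {}zx : `|z - x| <= r by apply/cubeP => //; exact: ltW.
have dist p' : `|p' - x| <= r -> enorm (z - p') < L.
  move=> p'x; apply: (@le_lt_trans _ _ (n%:R * (2 * r))); last by rewrite ltrDl.
  apply: le_trans (enorm_le_norm _) _; rewrite ler_wpM2l//.
  by rewrite -(subrKA x) (le_trans (ler_normD _ _))// (distrC x); lra.
have good p' : `|p' - x| <= r -> ~ (z = p' \/ (enorm (z - p') <= L /\
    ~ F (radial_segment p' (direction p' z) (ltW L0)))) ->
    z != p' /\ F (radial_segment p' (direction p' z) (ltW L0)).
  move=> p'x H; split; first by apply/eqP => e; apply: H; left.
  by apply: contrapT => nF; apply: H; right; split => //; exact/ltW/dist.
have [zp Fp] : z != p /\ F (radial_segment p (direction p z) (ltW L0)).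
  by apply: good => // H; apply: zB; left.
have [zq Fq] : z != q /\ F (radial_segment q (direction q z) (ltW L0)).
  by apply: good => // H; apply: zB; right.
have e : segment p z (hi (segment p z)) =
    reverse (segment q z) (lo (reverse (segment q z))).
  by rewrite segment_hi// reverse_segment_lo.
have Fe : F (concat e).
  apply: (P_concat PF (segment_in_family (ltW (dist _ px)) Fp)
    (segment_in_family (ltW (dist _ qx)) Fq)); [by left|by right|].
  by rewrite segment_hi//; exact: (segment_end_not_boundary zp (dist _ px) Fp).
exists (concat e); split.
- split => //; apply: rectifiable_concat; first exact: rectifiable_segment.
  exact: rectifiable_reverse_segment.
- by rewrite concat_lo segment_lo.
- by rewrite concat_hi reverse_segment_hi.
- move=> y /trace_concat[|/trace_reverse]; exact: trace_segment.
- rewrite line_integral_concat//; last 2 first.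
  + exact: rectifiable_segment.
  + exact: rectifiable_reverse_segment.
  by rewrite line_integral_segment// line_integral_reverse_segment// ltW.
Qed.

End joining.

(** * Repairing a curve near its two ends *)

Section detour.
Context {R : realType} {n : nat}.
Local Notation leb := (@lebesgue_rV R n).
Implicit Types (x p q z w : 'rV[R]_n) (rho : 'rV[R]_n -> \bar R) (c d : curve R n).
Variable F : set (curve R n).
Hypotheses (PF : P_family F) (n2 : (2 <= n)%N).

Lemma subcurve_in_family c a b (ab : a <= b) (ca : lo c <= a) (bc : b <= hi c) :
  F c -> F (subcurve ab ca bc).
Proof.
move=> /(P_subpath PF); apply; split => // t tab; apply: subcurveE.
by move: tab; rewrite in_itv.
Qed.

Lemma connected_subtrace c a b : lo c <= a -> b <= hi c -> connected (c @` `[a, b]).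
Proof.
move=> ca bc; apply: connected_continuous_connected; last exact: subcurve_continuous.
by apply/connected_intervalP; exact: interval_is_interval.
Qed.

(** Near [a], both [F1] and an initial part of [c] cross the annulus
    [r / 2 < `|y - a| < r] and contain good points there, which
    [joining_curve] connects inside [cube a r]; the same is done near [b]
    with a final part of [c]. The two good points on [c] differ from the
    endpoints of [c], hence do not lie in the boundary of the family, and
    [P_concat] permits the concatenations. *)
Lemma connecting_detour : exists2 C : R, 0 < C &
  forall rho F1 F2 U c a b (r eta : R), measurable_fun setT rho ->
  (forall y, (0 <= rho y)%E) -> 0 < r -> 0 < eta -> F c -> rectifiable c ->
  connected F1 -> connected F2 -> F1 a -> F2 b ->
  (exists2 y, F1 y & r <= `|y - a|) -> (exists2 y, F2 y & r <= `|y - b|) ->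
  `|c (lo c) - a| <= r / 4 -> `|c (hi c) - b| <= r / 4 -> 4 * r <= `|a - b| ->
  cube a r `<=` U -> cube b r `<=` U -> trace c `<=` U ->
  (\int[leb]_(y in cube a (3 * r)) (rho y ^+ n) <= (eta ^+ n / 96)%:E)%E ->
  (\int[leb]_(y in cube b (3 * r)) (rho y ^+ n) <= (eta ^+ n / 96)%:E)%E ->
  exists e, [/\ (connecting_curves F1 F2 U `&` F) e, rectifiable e &
    (line_integral rho e <= line_integral rho c + (C * eta)%:E)%E].
Proof.
have [C C0 HC] := joining_curve PF n2.
exists (2 * C); first exact: mulr_gt0.
move=> rho F1 F2 U c a b r eta mr rho0 r0 eta0 Fc rc cF1 cF2 F1a F2b F1r F2r ca cb ab.
move=> aU bU cU ia ib.
have lc := lo_le_hi c.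
have mX : measurable_fun setT (fun y => (rho y ^+ n)%E) by exact: measurable_funXe.
have X0 y : (0 <= rho y ^+ n)%E by exact: expe_ge0.
have k0 : 0 < eta ^+ n by exact: exprn_gt0.
have cba : 3 * r <= `|c (hi c) - a|.
  have : `|a - b| <= `|c (hi c) - a| + `|c (hi c) - b|.
    by rewrite (distrC _ a) -(subrKA (c (hi c))) ler_normD.
  by lra.
(* A time separating the part of [c] used near [a] from the part used near [b],
   so that the two good points come in the right order along [c]. *)
have [m mc ma] : exists2 m, lo c <= m <= hi c & `|c m - a| = 2 * r.
  have cT : connected (trace c) by exact: connected_subtrace.
  have [|||_ [m /= mc <-] ma] := connected_crosses (r := r / 4) (s := 3 * r) (v := 2 * r) (x := a) cT.
  - by exists (c (lo c)) => //; exists (lo c) => //=; rewrite in_itv/= lexx.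
  - by exists (c (hi c)) => //; exists (hi c) => //=; rewrite in_itv/= lexx lc.
  - by apply/andP; split; lra.
  by exists m => //; move: mc; rewrite in_itv.
have /andP[lm mh] := mc.
have mb : 2 * r <= `|c m - b|.
  have : `|a - b| <= `|c m - a| + `|c m - b|.
    by rewrite (distrC _ a) -(subrKA (c m)) ler_normD.
  by lra.
have r2 : r / 4 <= r / 2 by lra.
have r3 : r <= 2 * r by lra.
have [p [F1p pa1 pa2 gp]] : exists p, [/\ F1 p, r / 2 < `|p - a|, `|p - a| < r &
    forall s, 0 < s <= 2 * r ->
    (\int[leb]_(y in cube p s) (rho y ^+ n) <= (eta ^+ n * s / r)%:E)%E].
  by apply: good_point => //; exists a => //; rewrite subrr normr0 divr_ge0// ltW.
have [p' [F2p pb1 pb2 gp']] : exists p, [/\ F2 p, r / 2 < `|p - b|, `|p - b| < r &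
    forall s, 0 < s <= 2 * r ->
    (\int[leb]_(y in cube p s) (rho y ^+ n) <= (eta ^+ n * s / r)%:E)%E].
  by apply: good_point => //; exists b => //; rewrite subrr normr0 divr_ge0// ltW.
have [_ [[t /= tc <-] ta1 ta2 gt]] : exists q, [/\ (c @` `[lo c, m]) q, r / 2 < `|q - a|,
    `|q - a| < r & forall s, 0 < s <= 2 * r ->
    (\int[leb]_(y in cube q s) (rho y ^+ n) <= (eta ^+ n * s / r)%:E)%E].
  apply: good_point => //; first exact: connected_subtrace.
  - exists (c (lo c)); last exact: le_trans r2.
    by exists (lo c) => //=; rewrite in_itv/= lexx.
  - by exists (c m); [exists m => //=; rewrite in_itv/= lm lexx|rewrite ma].
have [_ [[u /= uc <-] ub1 ub2 gu]] : exists q, [/\ (c @` `[m, hi c]) q, r / 2 < `|q - b|,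
    `|q - b| < r & forall s, 0 < s <= 2 * r ->
    (\int[leb]_(y in cube q s) (rho y ^+ n) <= (eta ^+ n * s / r)%:E)%E].
  apply: good_point => //; first exact: connected_subtrace.
  - exists (c (hi c)); last exact: le_trans r2.
    by exists (hi c) => //=; rewrite in_itv/= lexx andbT.
  - by exists (c m); [exists m => //=; rewrite in_itv/= lexx|exact: le_trans mb].
have /andP[t1 t2] : lo c <= t <= m by move: tc; rewrite in_itv.
have /andP[u1 u2] : m <= u <= hi c by move: uc; rewrite in_itv.
have tu : t <= u by exact: le_trans u1.
have [J1 [[FJ1 rJ1] J1lo J1hi tJ1 lJ1]] := HC rho p (c t) a r eta mr rho0 r0 eta0
  (ltW pa2) (ltW ta2) gp gt.
have [J2 [[FJ2 rJ2] J2lo J2hi tJ2 lJ2]] := HC rho (c u) p' b r eta mr rho0 r0 eta0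
  (ltW ub2) (ltW pb2) gu gp'.
pose S := subcurve tu t1 u2.
have St : S (lo S) = c t by rewrite subcurveE//= lexx.
have Su : S (hi S) = c u by rewrite subcurveE//= lexx tu.
have e1 : J1 (hi J1) = S (lo S) by rewrite J1hi St.
have e2 : concat e1 (hi (concat e1)) = J2 (lo J2) by rewrite concat_hi J2lo Su.
have dne x y z : `|x - z| != `|y - z| -> x != y.
  by apply: contra_neq => ->.
have ct_bd : ~ family_boundary F (c t).
  apply: interior_not_boundary => //; first by rewrite t1 (le_trans t2).
    by apply: (@dne _ _ a); rewrite gt_eqF// (le_lt_trans ca)// (le_lt_trans r2).
  by apply: (@dne _ _ a); rewrite lt_eqF//; lra.
have cu_bd : ~ family_boundary F (c u).
  apply: interior_not_boundary => //; first by rewrite u2 (le_trans lm).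
    have : `|a - b| <= `|c (lo c) - a| + `|c (lo c) - b|.
      by rewrite (distrC _ a) -(subrKA (c (lo c))) ler_normD.
    by move=> h; apply: (@dne _ _ b); rewrite lt_eqF//; lra.
  by apply: (@dne _ _ b); rewrite gt_eqF// (le_lt_trans cb)// (le_lt_trans r2).
have FS : F S by exact: subcurve_in_family.
have F12 : F (concat e1).
  by apply: (P_concat PF FJ1 FS); [left|left|rewrite J1hi].
have F123 : F (concat e2).
  by apply: (P_concat PF F12 FJ2); [left|left|rewrite concat_hi Su].
have rS : rectifiable S by exact: rectifiable_subcurve.
have r12 : rectifiable (concat e1) by exact: rectifiable_concat.
have tU : trace (concat e2) `<=` U.
  move=> y /trace_concat[/trace_concat[|]|]; [by move=> /tJ1 /aU| |by move=> /tJ2 /bU].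
  move=> [s sS <-]; have /andP[s1 s2] : t <= s <= u by move: sS; rewrite /= in_itv.
  have -> : S s = c s by apply: subcurveE; rewrite s1.
  apply: cU; exists s => //=.
  by rewrite in_itv/= (le_trans t1)// (le_trans s2).
exists (concat e2); split; last 1 first.
- rewrite line_integral_concat// line_integral_concat// addeAC addeC.
  apply: leeD; first exact: line_integral_subcurve_le.
  rewrite (_ : 2 * C * eta = C * eta + C * eta); last by ring.
  by rewrite EFinD; exact: leeD.
- split => //; split.
  + exact: (subset_trans tU (@subset_closure _ U)).
  + by rewrite concat_lo concat_lo J1lo.
  + by rewrite concat_hi J2hi.
  + move=> s ss; apply: tU; exists s => //.
    by move: ss; rewrite /= !in_itv/= => /andP[s1 s2]; rewrite !ltW.
- exact: rectifiable_concat.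
Qed.

End detour.

(** * Uniformly separated connecting curves *)

Section separated.
Context {R : realType} {n : nat}.
Local Notation leb := (@lebesgue_rV R n).
Implicit Types (x p q z w : 'rV[R]_n) (rho : 'rV[R]_n -> \bar R) (c d : curve R n).
Variables (F : set (curve R n)) (F1 F2 U : set 'rV[R]_n).
Hypotheses (PF : P_family F) (n2 : (2 <= n)%N).
Hypotheses (cF1 : connected F1) (cF2 : connected F2).

Let n0 : (0 < n)%N. Proof. exact: leq_trans n2. Qed.

(** One radius of averaging, translation and repair serves all of these curves at
    once. *)
Definition separated_curves (delta : R) : set (curve R n) :=
  [set c | [/\ connecting_curves F1 F2 U c, delta <= `|c (lo c) - c (hi c)| &
    forall y, trace c y -> cube y delta `<=` U]].

(** If the line integral of the average along some [c] were below [theta], some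
    translate of [c] in the family would have line integral of [rho] below
    [theta]. Repaired at a cost of at most [1 - theta], it would be a
    connecting curve of the family along which the line integral of [rho] is
    below 1. *)
Lemma cube_mean_admissible rho (delta theta : R) : 0 < delta -> 0 < theta < 1 ->
  (forall a, F1 a -> exists2 y, F1 y & delta <= `|y - a|) ->
  (forall a, F2 a -> exists2 y, F2 y & delta <= `|y - a|) ->
  admissible (connecting_curves F1 F2 U `&` F) rho -> (energy rho < +oo)%E ->
  exists2 r : R, 0 < r & admissible (separated_curves delta)
    (fun y => ((theta^-1)%:E * cube_mean rho r y)%E).
Proof.
move=> d0 /andP[t0 t1] hF1 hF2 [mr rho0 adm] Eoo.
have [C C0 HC] := connecting_detour PF n2.
pose eta := (1 - theta) / C.
have eta0 : 0 < eta by rewrite divr_gt0// subr_gt0.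
have [r0 r00 hr0] : exists2 r0 : R, 0 < r0 & forall x r, 0 < r -> r <= r0 ->
    (\int[leb]_(y in cube x r) (rho y ^+ n) <= (eta ^+ n / 96)%:E)%E.
  by apply: energy_small_cubes => //; rewrite divr_gt0// exprn_gt0.
pose r := Num.min (r0 / 3) (delta / 4).
have rr : 0 < r by rewrite lt_min !divr_gt0.
have r1 : 3 * r <= r0.
  have : r <= r0 / 3 by rewrite ge_min lexx.
  by lra.
have r2 : 4 * r <= delta.
  have : r <= delta / 4 by rewrite ge_min lexx orbT.
  by lra.
have rd : r <= delta by lra.
have s0 : 0 < r / 4 by rewrite divr_gt0.
exists (r / 4) => //.
have mm : measurable_fun setT (cube_mean rho (r / 4)) by exact: measurable_cube_mean.
have m0 y : (0 <= cube_mean rho (r / 4) y)%E by apply: cube_mean_ge0.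
split.
- exact: emeasurable_funM.
- by move=> y; rewrite mule_ge0// lee_fin invr_ge0 ltW.
move=> c [[tc ca cb cU] cd cubeU] rc.
rewrite line_integralZl ?invr_ge0 ?(ltW t0)//.
rewrite lee_pdivlMl// mule1 leNgt; apply/negP => lt.
have nc : nonconstant c.
  move=> [x tx]; move: cd; have := trace_lo c; have := trace_hi c.
  rewrite tx => /= -> ->; rewrite subrr normr0 => /(lt_le_trans d0).
  by rewrite ltxx.
have [x [xr /contrapT Fx lx]] :=
  exists_good_translate mr rho0 s0 rc (P_translate PF nc rc) (ltW t0) lt.
have lc := lo_le_hi c.
have [||||||||||e [Ge re le_e]] := HC rho F1 F2 U (translate c x) (c (lo c)) (c (hi c)) r eta
  mr rho0 rr eta0 Fx (rectifiable_translate x rc) cF1 cF2 ca cb.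
- by have [y Fy ya] := hF1 _ ca; exists y => //; exact: le_trans ya.
- by have [y Fy ya] := hF2 _ cb; exists y => //; exact: le_trans ya.
- by rewrite translateE ?lexx// addrC addKr.
- by rewrite translateE ?lexx ?lc// addrC addKr.
- exact: le_trans cd.
- by apply: subset_trans (cubeU _ (trace_lo c)); apply: cubeS => //; exact: ltW.
- by apply: subset_trans (cubeU _ (trace_hi c)); apply: cubeS => //; exact: ltW.
- move=> _ [t tt <-]; have tt' : lo c <= t <= hi c by move: tt; rewrite /= in_itv.
  rewrite translateE//; apply: (cubeU (c t)); first by exists t.
  by apply/cubeP; [exact: ltW|rewrite addrC addKr; lra].
- by apply: hr0 => //; exact: mulr_gt0.
- by apply: hr0 => //; exact: mulr_gt0.
have := adm e Ge re; rewrite leNgt => /negP; apply.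
apply: le_lt_trans le_e _.
have -> : 1%E = (theta%:E + (C * eta)%:E)%E.
  rewrite -EFinD; congr _%:E; rewrite /eta mulrC divfK ?gt_eqF//; ring.
by rewrite lteD2rE.
Qed.

(** The admissible density of [cube_mean_admissible] has energy at most
    [theta ^- n * energy rho]; let [theta] tend to 1. *)
Lemma modulus_separated_le (delta : R) : 0 < delta ->
  (forall a, F1 a -> exists2 y, F1 y & delta <= `|y - a|) ->
  (forall a, F2 a -> exists2 y, F2 y & delta <= `|y - a|) ->
  (modulus (separated_curves delta) <= modulus (connecting_curves F1 F2 U `&` F))%E.
Proof.
move=> d0 hF1 hF2; apply: le_ereal_inf_tmp => _ [rho adm <-].
rewrite -/(energy rho).
have [/eqP Eoo|Efin] := boolP (energy rho == +oo)%E; first by rewrite Eoo leey.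
have {}Efin : (energy rho < +oo)%E by rewrite ltey.
have [mr rho0 _] := adm.
have E0 : (0 <= energy rho)%E by apply: integral_ge0 => y _; exact: expe_ge0.
have key (theta : R) : 0 < theta < 1 ->
    ((theta ^+ n)%:E * modulus (separated_curves delta) <= energy rho)%E.
  move=> tt; have /andP[t0 t1] := tt.
  have [r r0 adm'] := cube_mean_admissible d0 tt hF1 hF2 adm Efin.
  apply: (@le_trans _ _ ((theta ^+ n)%:E * (((theta^-1) ^+ n)%:E * energy (cube_mean rho r)))%E).
    apply: lee_wpmul2l; first by rewrite lee_fin exprn_ge0// ltW.
    rewrite -energyZl ?invr_ge0 ?(ltW t0)//; first exact: modulus_le_energy.
    - exact: measurable_cube_mean.
    - by move=> y; apply: cube_mean_ge0.
  rewrite muleA -EFinM -exprMn divff ?gt_eqF// expr1n mul1e.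
  exact: energy_cube_mean_le.
have M0 := modulus_ge0 (separated_curves delta).
have Mfin : modulus (separated_curves delta) \is a fin_num.
  rewrite ge0_fin_numE// ltey; apply/eqP => Moo.
  have /key : 0 < (2^-1 : R) < 1 by apply/andP; split; lra.
  by rewrite Moo gt0_muley ?lte_fin ?exprn_gt0// leye_eq => /eqP Eoo; rewrite Eoo in Efin.
move: key; rewrite -(fineK Mfin) -(fineK (_ : energy rho \is a fin_num)) ?ge0_fin_numE//.
set M := fine _; set E := fine _ => key.
have M0' : 0 <= M by exact: fine_ge0.
rewrite lee_fin; apply/ler_addgt0Pr => e e0.
pose l := Num.min 2^-1 (e / (n%:R * M + 1)).
have nM : 0 < n%:R * M + 1 by rewrite ltr_wpDl// mulr_ge0.
have l0 : 0 < l by rewrite lt_min invr_gt0 divr_gt0// andbT.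
have l1 : l <= 2^-1 by rewrite ge_min lexx.
have le_ : l * (n%:R * M + 1) <= e by rewrite -ler_pdivlMr// ge_min lexx orbT.
have /key : 0 < 1 - l < 1 by apply/andP; split; lra.
rewrite -EFinM lee_fin => /(le_trans _) H.
have b : 1 - n%:R * l <= (1 - l) ^+ n by apply: bernoulli_ge; apply/andP; split; lra.
have := ler_wpM2r M0' b.
have := H _ (lexx _); nra.
Qed.

End separated.

(** * Continua with more than one point *)

Section nondegenerate.
Context {R : realType} {n : nat}.
Implicit Types (x y : 'rV[R]_n) (c : curve R n).
Variables (F1 F2 U : set 'rV[R]_n).
Hypotheses (oU : open U) (F1U : F1 `<=` U) (F2U : F2 `<=` U) (F12 : F1 `&` F2 = set0).

Lemma near_small_cubes (K : set 'rV[R]_n) (d : R) : 0 < d -> compact K -> K `<=` U ->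
  \forall i \near \oo, forall y, K y -> cube y (d / i.+1%:R) `<=` U.
Proof.
move=> d0 /compact_near_coveringP cK KU.
apply: (cK _ \oo (fun i y => cube y (d / i.+1%:R) `<=` U)) => x Kx.
have /nbhs_ballP[r /= r0 rU] : nbhs x U by apply: open_nbhs_nbhs; split => //; exact: KU.
have r2 : 0 < r / 2 / d by rewrite !divr_gt0.
exists (ball x (r / 2), [set i | i.+1%:R^-1 < r / 2 / d]) => /=.
  split; first by apply: nbhsx_ballx; rewrite divr_gt0.
  exact: (near_infty_natSinv_lt (PosNum r2)).
move=> [x' i] [/= xx' ir] y.
have di : 0 < d / i.+1%:R by rewrite divr_gt0.
move=> /(cubeP _ _ (ltW di)) yx; apply: rU.
move: xx'; rewrite -!ball_normE /= => xx'.
have : d / i.+1%:R < r / 2.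
  by move: ir; rewrite -(ltr_pM2l d0) (mulrC d (r / 2 / d)) divfK ?gt_eqF.
have : `|x - y| <= `|x - x'| + `|y - x'|.
  by rewrite (distrC y) -(subrKA x' x) ler_normD.
move=> /le_lt_trans lt h; apply: lt; rewrite (splitr r).
by rewrite ltrD// (le_lt_trans yx).
Qed.

Lemma trace_compact c : compact (trace c).
Proof.
by apply: continuous_compact; [exact: curve_continuous|exact: segment_compact].
Qed.

Lemma connecting_trace c : connecting_curves F1 F2 U c -> trace c `<=` U.
Proof.
move=> [_ c1 c2 cU] _ [t /= tt <-].
have [->|tl] := eqVneq t (lo c); first exact: F1U.
have [->|th] := eqVneq t (hi c); first exact: F2U.
apply: cU; move: tt; rewrite !in_itv/= => /andP[t1 t2].
by rewrite !lt_neqAle t1 t2 th eq_sym tl.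
Qed.

Lemma separated_bigcup (d : R) : 0 < d ->
  \bigcup_i separated_curves F1 F2 U (d / i.+1%:R) = connecting_curves F1 F2 U.
Proof.
move=> d0; apply/seteqP; split=> [c [i _ []]//|c Gc].
have [_ c1 c2 _] := Gc.
have cd : 0 < `|c (lo c) - c (hi c)| / d.
  rewrite divr_gt0// normr_gt0 subr_eq0; apply/eqP => e.
  have : (F1 `&` F2) (c (lo c)) by split => //; rewrite e.
  by rewrite F12.
have [N _ NP] : \forall i \near \oo, (forall y, trace c y -> cube y (d / i.+1%:R) `<=` U)
    /\ i.+1%:R^-1 < `|c (lo c) - c (hi c)| / d.
  apply: filterS2 (near_small_cubes d0 (@trace_compact c) (connecting_trace Gc))
    (near_infty_natSinv_lt (PosNum cd)) => i; exact: conj.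
have [NU Nd] := NP N (leqnn N).
exists N => //; split => //.
by move: (ltW Nd); rewrite ler_pdivlMr// mulrC.
Qed.

Lemma separated_curvesS (d e : R) : 0 <= d -> d <= e ->
  separated_curves F1 F2 U e `<=` separated_curves F1 F2 U d.
Proof.
move=> d0 de c [Gc ce cU]; split => //; first exact: le_trans ce.
by move=> y /cU; apply: subset_trans; exact: cubeS.
Qed.

(** Two points cannot both be close to a third one. *)
Lemma nondegenerate_far (A : set 'rV[R]_n) a b : A a -> A b ->
  forall x, A x -> exists2 y, A y & `|a - b| / 2 <= `|y - x|.
Proof.
move=> Aa Ab x _; have [h|h] := leP (`|a - b| / 2) `|a - x|; first by exists a.
exists b => //; have : `|a - b| <= `|a - x| + `|b - x|.
  by rewrite (distrC b) -(subrKA x a) ler_normD.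
lra.
Qed.

(** Exhausts the connecting curves by separated ones with smaller and smaller
    parameters. *)
Lemma modulus_connecting_nondegenerate (F : set (curve R n)) a1 b1 a2 b2 :
  P_family F -> (2 <= n)%N -> connected F1 -> connected F2 ->
  F1 a1 -> F1 b1 -> a1 != b1 -> F2 a2 -> F2 b2 -> a2 != b2 ->
  (modulus (connecting_curves F1 F2 U) <= modulus (connecting_curves F1 F2 U `&` F))%E.
Proof.
move=> PF n2 cF1 cF2 Fa1 Fb1 ab1 Fa2 Fb2 ab2.
have [/eqP ->|Mfin] := boolP (modulus (connecting_curves F1 F2 U `&` F) == +oo)%E.
  exact: leey.
have {}Mfin : modulus (connecting_curves F1 F2 U `&` F) \is a fin_num.
  by rewrite ge0_fin_numE ?modulus_ge0// ltey.
pose d := Num.min (`|a1 - b1| / 2) (`|a2 - b2| / 2).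
have d0 : 0 < d by rewrite lt_min !divr_gt0// normr_gt0 subr_eq0.
have d1 : d <= `|a1 - b1| / 2 by rewrite ge_min lexx.
have d2 : d <= `|a2 - b2| / 2 by rewrite ge_min lexx orbT.
have di i : 0 < d / i.+1%:R by rewrite divr_gt0.
have did i : d / i.+1%:R <= d by rewrite ler_pdivrMr// ler_peMr ?(ltW d0)// ler1n.
rewrite -(fineK Mfin) -(separated_bigcup d0); apply: modulus_bigcup_le => //.
- move=> i j ij; apply: separated_curvesS; first exact: ltW.
  by rewrite ler_pM2l// lef_pV2 ?posrE// ler_nat ltnS.
- move=> i; rewrite separated_bigcup// fineK//; apply: modulus_separated_le => //.
  + move=> x Fx; have [y Fy xy] := nondegenerate_far Fa1 Fb1 Fx; exists y => //.
    exact: le_trans (le_trans (did i) d1) xy.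
  + move=> x Fx; have [y Fy xy] := nondegenerate_far Fa2 Fb2 Fx; exists y => //.
    exact: le_trans (le_trans (did i) d2) xy.
Qed.

End nondegenerate.

(** * Curves through a point *)

Section point_modulus.
Context {R : realType}.

(** [v] is the smallest time at which the level is attained; an earlier value
    above the level would, by the intermediate value theorem, produce an even
    smaller one. *)
Lemma first_hit (h : R -> R) (a b beta : R) : continuous h -> a <= b ->
  h a <= beta <= h b ->
  exists2 v, a <= v <= b & h v = beta /\ forall t, a <= t <= v -> h t <= beta.
Proof.
move=> ch ab /andP[ha hb].
have ivt u : a <= u -> beta <= h u -> exists2 t, a <= t <= u & h t = beta.
  move=> au hu; have [||t tau <-] := @IVT R h a u beta au.
  - exact: continuous_subspaceT.
  - by rewrite ge_min le_max ha hu orbT.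
  by exists t => //; move: tau; rewrite in_itv.
pose E : set R := `[a, b] `&` h @^-1` [set beta].
have E0 : E !=set0.
  have [t tab tE] := ivt b ab hb; exists t; split => //.
have cE : compact E.
  apply: compact_closedI; first exact: segment_compact.
  by apply: closed_comp => [t _|]; [exact: ch|exact: closed_eq].
have cid : {within E, continuous (id : R -> R)}.
  by apply: continuous_subspaceT => t; exact: cvg_id.
have [v /set_mem [vab hv] vmin] := compact_EVT_min E0 cE cid.
have /andP[av vb] : a <= v <= b by move: vab; rewrite /= in_itv.
exists v; rewrite ?av//; split => // t /andP[at_ tv].
rewrite leNgt; apply/negP => ht.
have [u /andP[au ut] hu] := ivt t at_ (ltW ht).
have Eu : E u by split => //; rewrite /= in_itv/= au (le_trans ut)// (le_trans tv).
have vu := vmin u (mem_set Eu).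
have ut' : t = u by apply/le_anti; rewrite ut (le_trans tv).
by move: ht; rewrite ut' hu ltxx.
Qed.

(** [v] is the first time at level [beta], and [u] the last time before [v] at
    level [alpha]; the latter is a first time for the function [- h (- t)]. *)
Lemma crossing (h : R -> R) (a b alpha beta : R) : continuous h -> a <= b ->
  h a <= alpha -> alpha <= beta -> beta <= h b ->
  exists u v, [/\ a <= u <= v, v <= b, h u = alpha, h v = beta &
    forall t, u <= t <= v -> alpha <= h t <= beta].
Proof.
move=> ch ab ha al hb.
have [|v /andP[av vb] [hv hle]] := first_hit ch ab (beta := beta).
  by rewrite hb (le_trans ha).
have ck : continuous (fun t => - h (- t)).
  move=> t; apply: cvgN; apply: (@continuous_comp _ _ _ -%R h); last exact: ch.
  exact: opp_continuous.
have av' : - v <= - a by rewrite lerN2.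
have [|u /andP[u1 u2] [hu hle']] := first_hit ck av' (beta := - alpha).
  by rewrite !opprK hv !lerN2 al ha.
exists (- u), v; split => //.
- by rewrite lerNr u2 lerNl u1.
- by move/eqP : hu; rewrite eqr_opp => /eqP.
- move=> t /andP[t1 t2]; apply/andP; split; last first.
    by apply: hle; rewrite t2 (le_trans _ t1)// lerNr.
  have := hle' (- t); rewrite opprK !lerN2 t2/=; apply.
  by rewrite lerNl.
Qed.

Lemma crossing_sym (h : R -> R) (a b s t alpha beta : R) : continuous h ->
  a <= s <= b -> a <= t <= b -> h s <= alpha -> alpha <= beta -> beta <= h t ->
  exists u v, [/\ a <= u, u <= v, v <= b, `|h v - h u| = beta - alpha &
    forall w, u <= w <= v -> alpha <= h w <= beta].
Proof.
move=> ch /andP[as_ sb] /andP[at_ tb] hs al ht.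
have [st|ts] := leP s t.
  have [u [v [/andP[su uv] vt hu hv H]]] := crossing ch st hs al ht.
  exists u, v; split => //; [exact: le_trans su|exact: le_trans tb|].
  by rewrite hu hv ger0_norm// subr_ge0.
have ck : continuous (fun t => h (- t)).
  move=> w; apply: (@continuous_comp _ _ _ -%R h); last exact: ch.
  exact: opp_continuous.
have st : - s <= - t by rewrite lerN2 ltW.
have [||u [v [/andP[su uv] vt hu hv H]]] := crossing ck st _ al _; rewrite ?opprK//.
exists (- v), (- u); split.
- by rewrite lerNr (le_trans vt)// lerN2.
- by rewrite lerN2.
- by rewrite lerNl (le_trans _ su)// lerN2.
- by rewrite hu hv distrC ger0_norm// subr_ge0.
- move=> w /andP[w1 w2]; have := H (- w); rewrite opprK; apply.
  by rewrite lerNr w2 lerNl w1.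
Qed.

Context {n : nat}.
Implicit Types (x y : 'rV[R]_n) (c : curve R n).

Definition reaches c x (r : R) := trace c x /\ exists2 y, trace c y & r <= `|y - x|.

Lemma annulus_crossing c x (r s : R) : 0 <= r -> r <= s -> reaches c x s ->
  exists u v, [/\ lo c <= u, u <= v, v <= hi c, s - r <= enorm (c v - c u) &
    forall w, u <= w <= v -> r <= `|c w - x| <= s].
Proof.
move=> r0 rs [[t0 /= t0c t0x] [_ [t1 /= t1c <-] t1s]].
pose h t := `|extend_curve c t - x|.
have ch : continuous h.
  move=> t; apply: (@continuous_comp _ _ _ (extend_curve c) (fun y => `|y - x|)).
    exact: extend_curve_continuous.
  exact: dist_continuous.
have hE t : lo c <= t <= hi c -> h t = `|c t - x| by move=> tc; rewrite /h extend_curveE.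
have t0c' : lo c <= t0 <= hi c by move: t0c; rewrite in_itv.
have t1c' : lo c <= t1 <= hi c by move: t1c; rewrite in_itv.
have [||u [v [cu uv vc huv H]]] := crossing_sym ch t0c' t1c' _ rs _.
- by rewrite hE// t0x subrr normr0.
- by rewrite hE.
exists u, v; split => //.
- rewrite -huv; apply: le_trans (norm_le_enorm _).
  rewrite !hE ?cu ?vc ?(le_trans uv)// ?(le_trans cu)//.
  apply: le_trans (ler_dist_dist _ _) _.
  by rewrite opprB addrA subrK.
- move=> w /andP[uw wv]; rewrite -hE; first by apply: H; rewrite uw.
  by rewrite (le_trans cu)// (le_trans wv).
Qed.

Hypothesis n2 : (2 <= n)%N.
Let n0 : (0 < n)%N. Proof. exact: leq_trans n2. Qed.
Local Notation leb := (@lebesgue_rV R n).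

Let exp0n : ((0 : \bar R) ^+ n = 0)%E. Proof. by case: (n) n0 => // m _; exact: exp0e. Qed.

(** The support lies in a half-open annulus, so that barriers in consecutive
    annuli have disjoint supports. *)
Definition barrier x (r s : R) (f : 'rV[R]_n -> \bar R) :=
  [/\ measurable_fun setT f, (forall y, (0 <= f y)%E),
      (forall y, f y != 0%E -> r <= `|y - x| < s) &
      forall c, rectifiable c -> reaches c x s -> (1 <= line_integral f c)%E].

(** A constant density on an annulus. By scale invariance of the n-energy its
    energy has a bound independent of [s]. *)
Lemma annulus_barrier x (s : R) : 0 < s ->
  exists2 f, barrier x (s / 4) s f & (energy f <= (4 ^+ n)%:E)%E.
Proof.
move=> s0.
pose A : set 'rV[R]_n := (fun y => `|y - x|) @^-1` `[s / 4, s / 2].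
have mA : measurable A.
  apply: closed_measurable_rV; apply: closed_comp; last exact: itv_closed.
  by move=> y _; exact: dist_continuous.
have AP y : A y <-> s / 4 <= `|y - x| <= s / 2 by rewrite /A /= in_itv.
have k0 : 0 < 4 / s by rewrite divr_gt0.
have s2 : 0 <= s / 2 by rewrite divr_ge0// ltW.
pose f : 'rV[R]_n -> \bar R := (cst (4 / s)%:E) \_ A.
have fA y : A y -> f y = (4 / s)%:E by move=> Ay; rewrite /f patchE mem_set.
have fnA y : ~ A y -> f y = 0%E by move=> Ay; rewrite /f patchE memNset.
have mf : measurable_fun setT f.
  by apply/(measurable_restrictT _ mA); exact: measurable_cst.
have f0 y : (0 <= f y)%E by apply: erestrict_ge0 => z _; rewrite lee_fin ltW.
exists f.
  split => // [y fy|c rc cx].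
    have /AP/andP[-> h] /= : A y by apply: contrapT => /fnA e; rewrite e eqxx in fy.
    by apply: le_lt_trans h _; lra.
  have s4 : 0 <= s / 4 by rewrite divr_ge0// ltW.
  have s42 : s / 4 <= s / 2 by lra.
  have cx' : reaches c x (s / 2).
    by have [? [y cy sy]] := cx; split => //; exists y => //; apply: le_trans sy; lra.
  have [u [v [cu uv vc huv H]]] := annulus_crossing s4 s42 cx'.
  apply: le_trans (line_integral_ge (M := 4 / s) mf f0 rc cu uv vc (ltW k0) _); last first.
    by move=> t tuv; rewrite fA//; apply/AP/H.
  rewrite lee_fin; apply: (@le_trans _ _ (4 / s * (s / 2 - s / 4))).
    by rewrite le_eqVlt; apply/orP; left; apply/eqP; field; rewrite gt_eqF.
  by apply: ler_wpM2l => //; exact: ltW.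
rewrite /energy.
have -> : (fun y => f y ^+ n)%E = (cst ((4 / s) ^+ n)%:E) \_ A.
  apply/funext => y; rewrite /f !patchE; case: ifPn => _ /=; first by rewrite EFin_expe.
  exact: exp0n.
rewrite -integral_mkcond integral_cst//.
apply: (@le_trans _ _ (((4 / s) ^+ n)%:E * leb (cube x (s / 2)))%E).
  apply: lee_wpmul2l; first by rewrite lee_fin exprn_ge0// ltW.
  apply: le_measure; rewrite ?inE//; first exact: measurable_cube.
  by move=> y /AP/andP[_ h]; apply/cubeP.
rewrite [X in (_ * X)%E](lebesgue_cube _ s2) -EFinM -exprMn lee_fin.
by rewrite (_ : 4 / s * (2 * (s / 2)) = 4)//; field; rewrite gt_eqF.
Qed.

(** A curve from [x] to distance [s] passes both annuli and pays 1 in each of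
    them, so the mean of the two barriers is still a barrier. Because of the
    disjoint supports its energy is at most [2 ^- n * (K + K)], hence at most
    [K / 2]. *)
Lemma half_barrier x (r r' s K : R) f f' : r' <= r -> r <= s ->
  barrier x r s f -> barrier x r' r f' ->
  (energy f <= K%:E)%E -> (energy f' <= K%:E)%E ->
  exists2 g, barrier x r' s g & (energy g <= (K / 2)%:E)%E.
Proof.
move=> r'r rs [mf f0 sf lf] [mf' f'0 sf' lf'] Ef Ef'.
have mD : measurable_fun setT (fun y => (f y + f' y)%E) by exact: emeasurable_funD.
have D0 y : (0 <= f y + f' y)%E by exact: adde_ge0.
exists (fun y => ((2^-1)%:E * (f y + f' y))%E).
  split.
  - exact: emeasurable_funM.
  - by move=> y; rewrite mule_ge0// lee_fin invr_ge0.
  - move=> y; have [fy|/sf/andP[h1 h2] _] := eqVneq (f y) 0%E.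
      have [fy'|/sf'/andP[h1 h2] _] := eqVneq (f' y) 0%E.
        by rewrite fy fy' adde0 mule0 eqxx.
      by rewrite h1 (lt_le_trans h2).
    by rewrite h2 andbT; apply: le_trans h1.
  - move=> c rc cx; rewrite line_integralZl ?invr_ge0// line_integralD//.
    rewrite lee_pdivlMl// mule1 (_ : 2%:E = 1 + 1)%E//.
    apply: leeD; first exact: lf.
    apply: lf' => //; have [? [y cy sy]] := cx; split => //; exists y => //.
    exact: le_trans sy.
rewrite energyZl ?invr_ge0//.
apply: (@le_trans _ _ ((2^-1 ^+ n)%:E * (K%:E + K%:E))%E).
  apply: lee_wpmul2l; first by rewrite lee_fin exprn_ge0// invr_ge0.
  apply: le_trans (leeD Ef Ef').
  rewrite /energy -ge0_integralD//; try exact: measurable_funXe; try by move=> y _; exact: expe_ge0.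
  apply: ge0_le_integral => //.
  - by move=> y _; exact: expe_ge0.
  - exact: measurable_funXe.
  - by apply: emeasurable_funD; exact: measurable_funXe.
  - move=> y _; have [fy|/sf/andP[h1 _]] := eqVneq (f y) 0%E.
      by rewrite fy add0e exp0n add0e.
    have [fy'|/sf'/andP[_ h2]] := eqVneq (f' y) 0%E.
      by rewrite fy' adde0 exp0n adde0.
    by have := le_lt_trans h1 h2; rewrite ltxx.
have K0 : 0 <= K.
  by rewrite -lee_fin; apply: le_trans Ef; apply: integral_ge0 => y _; exact: expe_ge0.
rewrite -EFinD -EFinM lee_fin.
have : (2^-1 : R) ^+ n <= 2^-1 ^+ 2 by apply: ler_wiXn2l => //; lra.
move=> /(ler_wpM2r K0); lra.
Qed.

Lemma small_barrier x m (s : R) : 0 < s -> exists r f,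
  [/\ 0 < r, r <= s, barrier x r s f & (energy f <= (4 ^+ n / 2 ^+ m)%:E)%E].
Proof.
elim: m s => [|m IH] s s0.
  have [f bf Ef] := annulus_barrier x s0; exists (s / 4), f; split => //.
  - by rewrite divr_gt0.
  - by lra.
  - by rewrite expr0 divr1.
have [r [f [r0 rs bf Ef]]] := IH s s0.
have [r' [f' [r'0 r'r bf' Ef']]] := IH r r0.
have [g bg Eg] := half_barrier r'r rs bf bf' Ef Ef'.
exists r', g; split => //; first exact: le_trans rs.
by rewrite exprS invfM mulrA mulrAC.
Qed.

(** Halving the energy of barriers again and again makes it arbitrarily small. *)
Lemma modulus_reaching (G : set (curve R n)) x (s : R) : 0 < s ->
  (forall c, G c -> reaches c x s) -> modulus G = 0%E.
Proof.
move=> s0 Gx; apply/le_anti; rewrite modulus_ge0 andbT.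
apply/lee_addgt0Pr => e e0; rewrite add0e.
have K0 : 0 < 4 ^+ n / e :> R by rewrite divr_gt0// exprn_gt0.
pose m := (Num.truncn (4 ^+ n / e : R)).+1.
have [r [f [_ _ [mf f0 _ lf] Ef]]] := small_barrier x m s0.
apply: (@le_trans _ _ (energy f)).
  by apply: modulus_le_energy; split => // c /Gx cx rc; exact: lf.
apply: le_trans Ef _; rewrite lee_fin ler_pdivrMr ?exprn_gt0// -ler_pdivrMl//.
rewrite mulrC; apply: (@le_trans _ _ m%:R).
  by rewrite ltW// truncnS_gt.
by rewrite -natrX ler_nat ltnW// ltn_expl.
Qed.

Lemma modulus_connecting_point (F1 F2 U : set 'rV[R]_n) :
  closed F1 -> closed F2 -> F1 `&` F2 = set0 ->
  (exists x, F1 = [set x]) \/ (exists x, F2 = [set x]) ->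
  modulus (connecting_curves F1 F2 U) = 0%E.
Proof.
move=> cF1 cF2 F12.
have far (A : set 'rV[R]_n) x : closed A -> ~ A x ->
    exists2 r, 0 < r & forall y, A y -> r <= `|y - x|.
  move=> cA nAx; have /nbhs_ballP[r /= r0 rA] : nbhs x (~` A).
    by apply: open_nbhs_nbhs; split => //; exact: closed_openC.
  exists r => // y Ay; rewrite leNgt; apply/negP => yx.
  by apply: (rA y) => //; rewrite -ball_normE /= distrC.
move=> [] [x Fx].
- have nx : ~ F2 x.
    by move=> F2x; have : (F1 `&` F2) x by [rewrite Fx|]; rewrite F12.
  have [r r0 hr] := far F2 x cF2 nx; apply: (@modulus_reaching _ x r r0) => c [_ + + _].
  rewrite Fx => /= cx c2; split; first by rewrite -cx; exact: trace_lo.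
  by exists (c (hi c)); [exact: trace_hi|exact: hr].
- have nx : ~ F1 x.
    by move=> F1x; have : (F1 `&` F2) x by [rewrite Fx|]; rewrite F12.
  have [r r0 hr] := far F1 x cF1 nx; apply: (@modulus_reaching _ x r r0) => c [_ + + _].
  rewrite Fx => c1 /= cx; split; first by rewrite -cx; exact: trace_hi.
  by exists (c (lo c)); [exact: trace_lo|exact: hr].
Qed.

End point_modulus.

(** * Equality of the moduli *)

Theorem theorem3p4 (R : realType) (n : nat) (n_ge2 : (2 <= n)%N)
    (F : set (curve R n)) (PF : P_family F)
    (U : set 'rV[R]_n) (openU : open U)
    (F1 F2 : set 'rV[R]_n)
    (F1_nonempty : F1 !=set0) (F2_nonempty : F2 !=set0)
    (F1_continuum : continuum F1) (F2_continuum : continuum F2)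
    (F1_sub : F1 `<=` U) (F2_sub : F2 `<=` U)
    (F12_disjoint : F1 `&` F2 = set0) :
  modulus (connecting_curves F1 F2 U) =
  modulus (connecting_curves F1 F2 U `&` F).
Proof.
have [[K1 C1] [K2 C2]] := (F1_continuum, F2_continuum).
apply/le_anti/andP; split; last by apply: modulus_sub => c [].
have [[x1 Fx1]|n1] := pselect (exists x, F1 = [set x]).
  rewrite modulus_connecting_point ?modulus_ge0//; try exact: compact_closed.
  by left; exists x1.
have [[x2 Fx2]|n2] := pselect (exists x, F2 = [set x]).
  rewrite modulus_connecting_point ?modulus_ge0//; try exact: compact_closed.
  by right; exists x2.
have two (A : set 'rV[R]_n) : A !=set0 -> ~ (exists x, A = [set x]) ->
    exists a b, [/\ A a, A b & a != b].
  move=> [a Aa] nA; apply: contrapT => h; apply: nA; exists a.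
  apply/seteqP; split=> [b Ab /=|_ ->//].
  by apply/eqP; apply: contrapT => /negP ba; apply: h; exists b, a.
have [a1 [b1 [Fa1 Fb1 ab1]]] := two F1 F1_nonempty n1.
have [a2 [b2 [Fa2 Fb2 ab2]]] := two F2 F2_nonempty n2.
exact: (modulus_connecting_nondegenerate openU F1_sub F2_sub F12_disjoint PF n_ge2 C1 C2 Fa1 Fb1 ab1 Fa2 Fb2 ab2).
Qed.
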